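(* Let $\Phi(\gamma,z,\theta)=\phi_1(\gamma)+\phi_2(z)+\phi_3(\theta)+H_\rho(\gamma,z,\theta)$ be the penalized worst-case load-shedding objective defined in the context. Suppose that $\Phi$ is a KL function and that the following conditions hold: (i) $\inf\Phi>-\infty$, $\inf\phi_1>-\infty$, $\inf\phi_2>-\infty$, $\inf\phi_3>-\infty$; (ii) for fixed $(z,\theta)$, $\nabla_\gamma H_\rho(\cdot,z,\theta)$ is globally Lipschitz with constant $L_1(z,\theta)$; for fixed $(\gamma,\theta)$, $\nabla_z H_\rho(\gamma,\cdot,\theta)$ is globally Lipschitz with constant $L_2(\gamma,\theta)$; for fixed $(\gamma,z)$, $\nabla_\theta H_\rho(\gamma,z,\cdot)$ is globally Lipschitz with constant $L_3(\gamma,z)$; (iii) there exist positive constants $s_1,s_2,s_3$ with $\sup_k L_1(z^k,\theta^k)\le s_1$, $\sup_k L_2(\gamma^k,\theta^k)\le s_2$, $\sup_k L_3(\gamma^k,z^k)\le s_3$; (iv) $\nabla H_\rho$ is Lipschitz continuous on bounded subsets of $\mathbb{R}^m\times\mathbb{R}^n\times\mathbb{R}^n$. Let $x^k=(\gamma^k,z^k,\theta^k)$, $k\ge 0$, be a bounded sequence generated by PALM (as defined in the context). Then: 1. The sequence $\{x^k\}$ has finite length, that is, $\sum_{k=1}^\infty\|x^{k+1}-x^k\|_2<\infty$. 2. The sequence $\{x^k\}$ converges to a critical point $x^*=(\gamma^*,z^*,\theta^* )$ of $\Phi$. 3. The sequence $\Phi(x^k)$ is nonincreasing; more precisely, there is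 a constant $d>0$ such that $$\frac d2\|x^{k+1}-x^k\|_2^2\le\Phi(x^k)-\Phi(x^{k+1}),\qquad k\ge 0.$$
   Context: **Data.** A lossless power network has $n$ buses and $m$ lines. A line $l$ connecting buses $i$ and $j$ is described by $e_l\in\mathbb{R}^n$ with entries $1$ and $-1$ at positions $i$ and $j$ and $0$ elsewhere; $E=[e_1\cdots e_m]\in\mathbb{R}^{n\times m}$ is the incidence matrix. $D\in\mathbb{R}^{m\times m}$ is the diagonal matrix of line admittances. $P=[P_d^T\;P_g^T]^T\in\mathbb{R}^n$ is the power injection, with $P_d\le 0$ (loads), $P_g>0$ (generation), $\mathbf 1^TP=0$. Vectors $z\in\mathbb{R}^n$ are partitioned conformally, $z=[z_d^T\;z_g^T]^T$. $K$ is the prescribed number of removed lines, and $\rho>0$. $\mathbf 1$ is the all-ones vector; $\sin,\cos$ act elementwise on vectors; $\operatorname{diag}(\gamma)$ is the diagonal matrix with diagonal $\gamma$, also written $\Gamma$; $\circ$ is the elementwise product; $\|\cdot\|$ is the Euclidean norm of a vector and the maximum singular value of a matrix. **Objective.** For $\gamma\in\mathbb{R}^m$, $z\in\mathbb{R}^n$, $\theta\in\mathbb{R}^n$, $$H_\rho(\gamma,z,\theta)=-\mathbf 1^Tz_d+\tfrac{\rho}{2}\big\|ED\operatorname{diag}(\gamma)\sin(E^T\theta)-(P+z)\big\|_2^2 .$$ $\phi_1(\gamma)=0$ if $\gamma\in\{0,1\}^m$ and $m-\mathbf 1^T\gamma=K$, and $+\infty$ otherwise. $\phi_2(z)=0$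 if $0\le z_d\le -P_d$, $-P_g\le z_g\le 0$ and $\mathbf 1^Tz=0$, and $+\infty$ otherwise. $\phi_3(\theta)=0$ if $-\frac\pi2\le E^T\theta\le\frac\pi2$ (elementwise), and $+\infty$ otherwise. **Constants.** $L_1(z,\theta)=\rho\|(DE^TED)\circ(\sin(E^T\theta)\sin(E^T\theta)^T)\|$, $L_2(\gamma,\theta)=\rho$, $L_3(\gamma,z)=\rho\|E\|^2(2\|Q\|+\|R\|)$ with $Q=\Gamma DE^TED\Gamma$, $R=\Gamma DE^T(P+z)$, $\Gamma=\operatorname{diag}(\gamma)$. **PALM (proximal alternating linearization method).** Fix constants $r_1,r_2,r_3>1$ and any starting point $(\gamma^0,z^0,\theta^0)$. For $k=0,1,2,\dots$: $$\gamma^{k+1}\in\operatorname*{argmin}_\gamma\{\phi_1(\gamma)+\tfrac{a_k}{2}\|\gamma-u^k\|_2^2\},\quad u^k=\gamma^k-\tfrac1{a_k}\nabla_\gamma H_\rho(\gamma^k,z^k,\theta^k),$$ $$z^{k+1}\in\operatorname*{argmin}_z\{\phi_2(z)+\tfrac{b_k}{2}\|z-v^k\|_2^2\},\quad v^k=z^k-\tfrac1{b_k}\nabla_z H_\rho(\gamma^{k+1},z^k,\theta^k),$$ $$\theta^{k+1}\in\operatorname*{argmin}_\theta\{\phi_3(\theta)+\tfrac{c_k}{2}\|\theta-w^k\|_2^2\},\quad w^k=\theta^k-\tfrac1{c_k}\nabla_\theta H_\rho(\gamma^{k+1},z^{k+1},\theta^k),$$ where $a_k=r_1L_1(z^k,\theta^k)$,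 $b_k=r_2L_2(\gamma^{k+1},\theta^k)$, $c_k=r_3L_3(\gamma^{k+1},z^{k+1})$ are positive coefficients. **KL functions and critical points.** $\partial f$ denotes the limiting subdifferential; $x^*$ is a critical point of $f$ if $0\in\partial f(x^* )$. A proper lower semicontinuous $f:\mathbb{R}^d\to(-\infty,+\infty]$ has the Kurdyka-Lojasiewicz (KL) property at $\bar u\in\operatorname{dom}\partial f=\{u:\partial f(u)\ne\emptyset\}$ if there exist $\eta\in(0,+\infty]$, a neighborhood $\mathcal N$ of $\bar u$, and a continuous concave function $\psi:[0,\eta)\to[0,\infty)$ with $\psi(0)=0$, $\psi$ continuously differentiable on $(0,\eta)$ and $\psi'>0$ there, such that for all $u\in\mathcal N$ with $f(\bar u)<f(u)<f(\bar u)+\eta$ one has $\psi'(f(u)-f(\bar u))\cdot\operatorname{dist}(0,\partial f(u))\ge 1$. $f$ is a KL function if it has the KL property at each point of $\operatorname{dom}\partial f$. *)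

(* Defs.v *)
From HB Require Import structures.
From mathcomp Require Export all_boot all_order all_algebra.
From mathcomp Require Export all_classical all_reals all_analysis.
Export Order.TTheory GRing.Theory Num.Theory.
Export numFieldNormedType.Exports.

Set Implicit Arguments.
Unset Strict Implicit.
Unset Printing Implicit Defensive.

Local Open Scope classical_set_scope.
Local Open Scope ring_scope.

Section Euclidean.
Context {R : realType}.

Definition dot d (u v : 'cV[R]_d) : R := \sum_(i < d) u i 0 * v i 0.

(* Every length below is measured with enorm: the norm that the library puts
   on matrices is the maximum of the absolute values of the entries.  Both
   norms have the same topology and the same bounded sets, and for these the
   library notions are used. *)
Definition enorm d (u : 'cV[R]_d) : R := Num.sqrt (\sum_(i < d) u i 0 ^+ 2).

Definition singular_value p q (A : 'M[R]_(p, q)) (s : R) : Prop :=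
  0 <= s /\ eigenvalue (A^T *m A) (s ^+ 2).

(* The set of singular values is finite.  It is empty only for q = 0, and then
   the sup is 0. *)
Definition max_singular_value p q (A : 'M[R]_(p, q)) : R :=
  sup [set s | singular_value A s].

Definition grad d (f : 'cV[R]_d -> R) (x : 'cV[R]_d) : 'cV[R]_d :=
  \col_(i < d) 'D_(delta_mx i 0) f x.

Definition lipschitz_with d e (L : R) (f : 'cV[R]_d -> 'cV[R]_e)
    (A : set 'cV[R]_d) : Prop :=
  forall x y, A x -> A y -> enorm (f x - f y) <= L * enorm (x - y).

End Euclidean.

Section VariationalAnalysis.
Context {R : realType} {d : nat}.
Implicit Types (f : 'cV[R]_d -> \bar R) (x v : 'cV[R]_d).
Local Open Scope ereal_scope.

Definition indicator0 (A : set 'cV[R]_d) x : \bar R :=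
  if x \in A then 0 else +oo.

Definition argmin f : set 'cV[R]_d := [set x | forall y, f x <= f y].

Definition proper_fun f : Prop :=
  (forall x, f x != -oo) /\ (exists x, f x < +oo).

(* f y >= f x + <v, y - x> + o(||y - x||) as y -> x, at points where f is
   finite. *)
Definition regular_subdiff f x : set 'cV[R]_d :=
  [set v | f x \is a fin_num /\
     forall e : R, (0 < e)%R -> \forall y \near x,
       f x + (dot v (y - x) - e * enorm (y - x))%:E <= f y].

Definition limiting_subdiff f x : set 'cV[R]_d :=
  [set v | f x \is a fin_num /\
     exists (u w : nat -> 'cV[R]_d),
       [/\ u @ \oo --> x, f (u k) @[k --> \oo] --> f x,
           forall k, regular_subdiff f (u k) (w k) & w @ \oo --> v]].

Definition critical_point f x : Prop := limiting_subdiff f x 0%R.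

(* The value for the empty set is +oo. *)
Definition dist0 (A : set 'cV[R]_d) : \bar R :=
  ereal_inf [set (enorm v)%:E | v in A].

Definition desingularizing (eta : \bar R) (psi : R -> R) : Prop :=
  let I := [set t : R | (0 <= t)%R /\ t%:E < eta] in
  [/\ psi 0%R = 0%R /\ (forall t, I t -> (0 <= psi t)%R),
      {within I, continuous psi},
      (forall s t l : R, I s -> I t -> (0 <= l <= 1)%R ->
         (l * psi s + (1 - l) * psi t <= psi (l * s + (1 - l) * t))%R)
    & forall t : R, (0 < t)%R -> t%:E < eta ->
        [/\ derivable psi t 1, {for t, continuous (derive1 psi)}
          & (0 < derive1 psi t)%R]].

Definition KL_at f (ub : 'cV[R]_d) : Prop :=
  exists (eta : \bar R) (N : set 'cV[R]_d) (psi : R -> R),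
    [/\ 0 < eta, nbhs ub N, desingularizing eta psi
      & forall u, N u -> f ub < f u -> f u < f ub + eta ->
          1 <= (derive1 psi (fine (f u - f ub)))%:E * dist0 (limiting_subdiff f u)].

Definition KL_function f : Prop :=
  [/\ proper_fun f, lower_semicontinuous f
    & forall ub, limiting_subdiff f ub !=set0 -> KL_at f ub].

End VariationalAnalysis.

(* Buses are numbered with the nd loads first: a vector z on the buses is
   split as z_d = usubmx z and z_g = dsubmx z. *)
Record network (R : realType) (m nd ng : nat) := Network {
  ends : 'I_m -> 'I_(nd + ng) * 'I_(nd + ng);
  admittance : 'rV[R]_m;
  Pd : 'cV[R]_nd;
  Pg : 'cV[R]_ng;
  ends_neq : forall l, (ends l).1 != (ends l).2;
  Pd_le0 : forall i, Pd i 0 <= 0;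
  Pg_gt0 : forall i, 0 < Pg i 0;
  P_balanced : \sum_i col_mx Pd Pg i 0 = 0
}.

Section LoadShedding.
Context {R : realType} {m nd ng : nat}.
Let n := (nd + ng)%N.
Variables (N : network R m nd ng) (K : nat) (rho : R).
Implicit Types (g : 'cV[R]_m) (z th : 'cV[R]_n).

Definition incidence : 'M[R]_(n, m) :=
  \matrix_(i, l) ((i == (ends N l).1)%:R - (i == (ends N l).2)%:R).

Definition Dmat : 'M[R]_m := diag_mx (admittance N).

Definition Pinj : 'cV[R]_n := col_mx (Pd N) (Pg N).

Local Notation E := incidence.

Definition sin_flow th : 'cV[R]_m := map_mx sin (E^T *m th).

Definition Hrho g z th : R :=
  - (\sum_i usubmx z i 0)
  + rho / 2 * enorm (E *m Dmat *m diag_mx g^T *m sin_flow th - (Pinj + z)) ^+ 2.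

Definition phi1 : 'cV[R]_m -> \bar R :=
  indicator0 [set g | (forall l, g l 0 = 0 \/ g l 0 = 1)
                      /\ m%:R - \sum_l g l 0 = K%:R].

Definition phi2 : 'cV[R]_n -> \bar R :=
  indicator0 [set z | [/\ forall i, 0 <= usubmx z i 0 <= - Pd N i 0,
                          forall i, - Pg N i 0 <= dsubmx z i 0 <= 0
                        & \sum_i z i 0 = 0]].

Definition phi3 : 'cV[R]_n -> \bar R :=
  indicator0 [set th | forall l, - (pi / 2) <= (E^T *m th) l 0 <= pi / 2].

Definition L1 z th : R :=
  rho * max_singular_value
    (map2_mx *%R (Dmat *m E^T *m E *m Dmat) (sin_flow th *m (sin_flow th)^T)).

Definition L2 g th : R := rho.

Definition L3 g z : R :=
  let G := diag_mx g^T in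
  let Q := G *m Dmat *m E^T *m E *m Dmat *m G in
  let r := G *m Dmat *m E^T *m (Pinj + z) in
  rho * max_singular_value E ^+ 2 * (2 * max_singular_value Q + enorm r).

Definition grad_g g z th : 'cV[R]_m := grad (fun g' => Hrho g' z th) g.
Definition grad_z g z th : 'cV[R]_n := grad (fun z' => Hrho g z' th) z.
Definition grad_th g z th : 'cV[R]_n := grad (fun th' => Hrho g z th') th.

(* The point (g, z, th) of R^m x R^n x R^n as one vector. *)
Definition triple g z th : 'cV[R]_(m + (n + n)) := col_mx g (col_mx z th).

Definition on_triple T (F : 'cV[R]_m -> 'cV[R]_n -> 'cV[R]_n -> T)
    (x : 'cV[R]_(m + (n + n))) : T :=
  F (usubmx x) (usubmx (dsubmx x)) (dsubmx (dsubmx x)).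

Definition Hjoint : 'cV[R]_(m + (n + n)) -> R := on_triple Hrho.

Definition Phi : 'cV[R]_(m + (n + n)) -> \bar R :=
  on_triple (fun g z th => phi1 g + phi2 z + phi3 th + (Hrho g z th)%:E)%E.

Definition prox_argmin d (phi : 'cV[R]_d -> \bar R) (c : R) (u : 'cV[R]_d) :
    set 'cV[R]_d :=
  argmin (fun x => phi x + (c / 2 * enorm (x - u) ^+ 2)%:E)%E.

Definition PALM (r1 r2 r3 : R) (g : nat -> 'cV[R]_m) (z th : nat -> 'cV[R]_n) :
    Prop :=
  forall k : nat,
    let a := r1 * L1 (z k) (th k) in
    let b := r2 * L2 (g k.+1) (th k) in
    let c := r3 * L3 (g k.+1) (z k.+1) in
    let u := g k - a^-1 *: grad_g (g k) (z k) (th k) in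
    let v := z k - b^-1 *: grad_z (g k.+1) (z k) (th k) in
    let w := th k - c^-1 *: grad_th (g k.+1) (z k.+1) (th k) in
    [/\ [/\ 0 < a, 0 < b & 0 < c],
        prox_argmin phi1 a u (g k.+1),
        prox_argmin phi2 b v (z k.+1)
      & prox_argmin phi3 c w (th k.+1)].

End LoadShedding.

(* Main.v *)
Require Import Defs.
From mathcomp Require Import ring lra.

(** The proof has the usual shape of a convergence proof for alternating proximal
    methods.  Each block update is a minimization of the linearized objective
    plus a quadratic term, and the quadratic term exceeds what the descent
    inequality costs because the factors [r1], [r2], [r3] exceed 1; this gives a
    decrease of the objective in terms of the squared step
    ([sufficient_decrease]).  The optimality conditions of the three blocks form
    a regular subgradient at the new iterate whose length is at most a multiple
    of the step ([iterate_subgradient]).  These two facts and the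
    Kurdyka-Lojasiewicz inequality at one cluster point give finite length and
    convergence to a critical point ([KL_convergence]).

    The difficulty is the decrease.  Its constant for the line variables is
    [L1], which is positive at each step but has no positive lower bound: it
    tends to zero when the angle differences on the lines do.  Line variables
    are binary, so a uniform constant exists, and the claim on the length can
    only hold, if the lines switch finitely often
    ([lines_eventually_constant]).  Suppose they switch infinitely often.

    The total decrease is finite, so [L1] tends to zero along the switches, and
    with it the flow.  Then shedding everything is strictly better than anything
    else, and the proximal step in [z] finds this vertex of the feasible set
    exactly ([full_shed_step]).  The objective thus tends to its least value, and
    from some step on everything is shed ([eventually_fully_shed]).

    What remains is an iteration on the lines and the angles for the squared norm
    of the flow, and the flow tends to zero.  A switch decreases the squared flow
    by a multiple of the squared angle differences.  An error bound for the
    projected gradient step ([projected_step_error_bound]), used backwards in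
    time from the switches, shows that the angle differences are at most a
    multiple of the flow and that the flow decreases geometrically
    ([eventually_geometric]).  So the angles converge, and up to summable errors
    the iteration is one of projected gradient steps for quadratic forms, one
    form for each choice of lines, on the cone that the angle box is around the
    limit.  Such a step cannot increase the Rayleigh quotient of its form
    ([rayleigh_step]), because it damps the stiff directions most.  A switch
    leaves the angles in place and decreases the quotient by a fixed amount.  As
    the quotient is nonnegative, there are finitely many switches
    ([no_infinite_switching]).

    The constant of the angles [L3] has no positive lower bound either, but only
    because it may be small when the chosen lines exchange no power whatever the
    angles are; the angles do not move then ([th_decrease_uniform]). *)

Set Implicit Arguments.
Unset Strict Implicit.
Unset Printing Implicit Defensive.

Local Open Scope classical_set_scope.
Local Open Scope ring_scope.

(** * Euclidean geometry of column vectors *)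

Section EuclideanGeometry.
Context {R : realType}.
Implicit Types d : nat.

Lemma dotC d (u v : 'cV[R]_d) : dot u v = dot v u.
Proof. by apply: eq_bigr => i _; rewrite mulrC. Qed.

Lemma dotDl d (u v w : 'cV[R]_d) : dot (u + v) w = dot u w + dot v w.
Proof. by rewrite -big_split; apply: eq_bigr => i _; rewrite mxE mulrDl. Qed.

Lemma dotDr d (u v w : 'cV[R]_d) : dot w (u + v) = dot w u + dot w v.
Proof. by rewrite !(dotC w) dotDl. Qed.

Lemma dotZl d c (u v : 'cV[R]_d) : dot (c *: u) v = c * dot u v.
Proof. by rewrite mulr_sumr; apply: eq_bigr => i _; rewrite mxE mulrA. Qed.

Lemma dotZr d c (u v : 'cV[R]_d) : dot u (c *: v) = c * dot u v.
Proof. by rewrite !(dotC u) dotZl. Qed.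

Lemma dotNl d (u v : 'cV[R]_d) : dot (- u) v = - dot u v.
Proof. by rewrite -scaleN1r dotZl mulN1r. Qed.

Lemma dotNr d (u v : 'cV[R]_d) : dot u (- v) = - dot u v.
Proof. by rewrite !(dotC u) dotNl. Qed.

Lemma dotBl d (u v w : 'cV[R]_d) : dot (u - v) w = dot u w - dot v w.
Proof. by rewrite dotDl dotNl. Qed.

Lemma dotBr d (u v w : 'cV[R]_d) : dot w (u - v) = dot w u - dot w v.
Proof. by rewrite dotDr dotNr. Qed.

Definition dotE := (dotDl, dotDr, dotNl, dotNr, dotZl, dotZr).

Lemma dot0l d (u : 'cV[R]_d) : dot 0 u = 0.
Proof. by rewrite -(scale0r 0) dotZl mul0r. Qed.

Lemma dot0r d (u : 'cV[R]_d) : dot u 0 = 0.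
Proof. by rewrite dotC dot0l. Qed.

Lemma dot_deltal d (i : 'I_d) (u : 'cV[R]_d) : dot (delta_mx i 0) u = u i 0.
Proof.
rewrite /dot (bigD1 i) //= mxE !eqxx mul1r big1 ?addr0 // => j ji.
by rewrite mxE (negbTE ji) mul0r.
Qed.

Lemma dot_mulmxl p q (M : 'M[R]_(p, q)) x y :
  dot (M *m x) y = dot x (M^T *m y).
Proof.
rewrite /dot; under eq_bigr do rewrite mxE mulr_suml.
rewrite exchange_big; apply: eq_bigr => j _; rewrite mxE mulr_sumr.
by apply: eq_bigr => i _; rewrite mxE; ring.
Qed.

Lemma dot_col_mx p q (u u' : 'cV[R]_p) (v v' : 'cV[R]_q) :
  dot (col_mx u v) (col_mx u' v') = dot u u' + dot v v'.
Proof.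
rewrite /dot big_split_ord /=; congr (_ + _); apply: eq_bigr => i _.
  by rewrite !col_mxEu.
by rewrite !col_mxEd.
Qed.

Lemma enorm_sqr d (u : 'cV[R]_d) : enorm u ^+ 2 = dot u u.
Proof.
rewrite sqr_sqrtr; last by apply: sumr_ge0 => i _; rewrite sqr_ge0.
by apply: eq_bigr => i _; rewrite expr2.
Qed.

Lemma enorm_ge0 d (u : 'cV[R]_d) : 0 <= enorm u.
Proof. exact: sqrtr_ge0. Qed.

Lemma enorm_le_sqr d e (u : 'cV[R]_d) (v : 'cV[R]_e) :
  dot u u <= dot v v -> enorm u <= enorm v.
Proof. by rewrite -!enorm_sqr ler_pXn2r // nnegrE enorm_ge0. Qed.

Lemma enorm_leP d (u : 'cV[R]_d) (c : R) :
  0 <= c -> dot u u <= c ^+ 2 -> enorm u <= c.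
Proof. by move=> c0; rewrite -enorm_sqr ler_pXn2r // nnegrE ?enorm_ge0. Qed.

Lemma enormZ d c (u : 'cV[R]_d) : enorm (c *: u) = `|c| * enorm u.
Proof.
apply/eqP; rewrite -(@eqrXn2 _ 2) ?mulr_ge0 ?enorm_ge0 //.
by rewrite exprMn !enorm_sqr dotZl dotZr mulrA -expr2 real_normK ?num_real.
Qed.

Lemma enormN d (u : 'cV[R]_d) : enorm (- u) = enorm u.
Proof. by rewrite -scaleN1r enormZ normrN1 mul1r. Qed.

Lemma enormC d (u v : 'cV[R]_d) : enorm (u - v) = enorm (v - u).
Proof. by rewrite -opprB enormN. Qed.

Lemma enorm0 d : enorm (0 : 'cV[R]_d) = 0.
Proof. by rewrite -(scale0r 0) enormZ normr0 mul0r. Qed.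

Lemma enorm_coord d (u : 'cV[R]_d) i : `|u i 0| <= enorm u.
Proof.
rewrite -(@ler_pXn2r _ 2) ?nnegrE ?enorm_ge0 // enorm_sqr real_normK ?num_real //.
rewrite /dot (bigD1 i) //= -expr2 lerDl; apply: sumr_ge0 => j _.
by rewrite -expr2 sqr_ge0.
Qed.

Lemma enorm_eq0 d (u : 'cV[R]_d) : enorm u = 0 -> u = 0.
Proof.
move=> u0; apply/matrixP => i j; rewrite ord1 mxE; apply/eqP.
by rewrite -normr_le0 -u0 enorm_coord.
Qed.

Lemma enorm_gt0 d (u : 'cV[R]_d) : (0 < enorm u) = (u != 0).
Proof.
rewrite lt0r enorm_ge0 andbT; apply/idP/idP; apply: contra => /eqP.
  by move=> ->; rewrite enorm0.
by move/enorm_eq0 => ->.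
Qed.

Lemma enormD_sqr d (u v : 'cV[R]_d) :
  enorm (u + v) ^+ 2 = enorm u ^+ 2 + 2 * dot u v + enorm v ^+ 2.
Proof. by rewrite !enorm_sqr !dotE (dotC v u); ring. Qed.

Lemma enormB_sqr d (u v : 'cV[R]_d) :
  enorm (u - v) ^+ 2 = enorm u ^+ 2 - 2 * dot u v + enorm v ^+ 2.
Proof. by rewrite !enorm_sqr !dotE (dotC v u); ring. Qed.

Lemma CauchySchwarz d (u v : 'cV[R]_d) : `|dot u v| <= enorm u * enorm v.
Proof.
have [->|v0] := eqVneq v 0; first by rewrite dot0r normr0 enorm0 mulr0.
have v_gt0 : 0 < enorm v by rewrite enorm_gt0.
rewrite -(@ler_pXn2r _ 2) ?nnegrE ?mulr_ge0 ?enorm_ge0 //.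
rewrite real_normK ?num_real // exprMn.
have := sqr_ge0 (enorm (enorm v ^+ 2 *: u - dot u v *: v)).
rewrite enormB_sqr !enormZ !exprMn !real_normK ?num_real // !dotE.
move: (enorm u ^+ 2) (dot u v) => a b; move: v_gt0; move: (enorm v) => c c0 H.
have c2 : 0 < c ^+ 2 by rewrite exprn_gt0.
rewrite -subr_ge0 -(pmulr_rge0 _ c2); apply: le_trans H _.
by rewrite le_eqVlt; apply/orP; left; apply/eqP; ring.
Qed.

Lemma dot_le d (u v : 'cV[R]_d) : dot u v <= enorm u * enorm v.
Proof. exact: le_trans (ler_norm _) (CauchySchwarz _ _). Qed.

Lemma dot_ge d (u v : 'cV[R]_d) : - (enorm u * enorm v) <= dot u v.
Proof. by rewrite lerNl -dotNl -(enormN u) dot_le. Qed.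

Lemma enormD d (u v : 'cV[R]_d) : enorm (u + v) <= enorm u + enorm v.
Proof.
rewrite -(@ler_pXn2r _ 2) ?nnegrE ?addr_ge0 ?enorm_ge0 // enormD_sqr.
by have := dot_le u v; rewrite sqrrD; lra.
Qed.

Lemma enormB d (u v : 'cV[R]_d) : enorm (u - v) <= enorm u + enorm v.
Proof. by rewrite -(enormN v) enormD. Qed.

Lemma enorm_tri d (v u w : 'cV[R]_d) :
  enorm (u - w) <= enorm (u - v) + enorm (v - w).
Proof. by rewrite -(subrK v u) -addrA -[v - w]opprK opprB addrK enormD. Qed.

Lemma enorm_leD d (u v : 'cV[R]_d) : enorm u <= enorm v + enorm (u - v).
Proof. by rewrite -{1}(subrK v u) addrC enormD. Qed.

Lemma enorm_le_sum d (u : 'cV[R]_d) : enorm u <= \sum_i `|u i 0|.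
Proof.
rewrite [X in enorm X]matrix_sum_delta.
elim/big_ind2 : _ => [|x a y b xa yb|i _]; first by rewrite enorm0.
  exact: le_trans (enormD _ _) (lerD xa yb).
rewrite big_ord1 enormZ -[leRHS]mulr1 ler_wpM2l // enorm_leP //.
by rewrite dot_deltal mxE !eqxx expr1n.
Qed.

Lemma enorm_const_le d (u : 'cV[R]_d) (c : R) :
  (forall i, `|u i 0| <= c) -> enorm u <= d%:R * c.
Proof.
move=> uc; apply: le_trans (enorm_le_sum _) _.
apply: le_trans (ler_sum _ (fun i _ => uc i)) _.
by rewrite sumr_const card_ord mulr_natl.
Qed.

(** A crude bound of the operator norm: only the existence of some bound that
    depends on the matrix alone is ever used. *)
Definition mxbound p q (M : 'M[R]_(p, q)) : R := 1 + \sum_i \sum_j `|M i j|.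

Lemma mxbound_gt0 p q (M : 'M[R]_(p, q)) : 0 < mxbound M.
Proof.
by rewrite ltr_wpDr ?ltr01 // sumr_ge0 // => i _; rewrite sumr_ge0.
Qed.

Lemma mxboundP p q (M : 'M[R]_(p, q)) x :
  enorm (M *m x) <= mxbound M * enorm x.
Proof.
apply: (@le_trans _ _ ((\sum_i \sum_j `|M i j|) * enorm x)); last first.
  by rewrite ler_wpM2r ?enorm_ge0 // /mxbound lerDr.
apply: le_trans (enorm_le_sum _) _; rewrite mulr_suml.
apply: ler_sum => i _; rewrite mxE; apply: le_trans (ler_norm_sum _ _ _) _.
rewrite mulr_suml; apply: ler_sum => j _.
by rewrite normrM ler_wpM2l // enorm_coord.
Qed.

Lemma enorm_col_mx p q (u : 'cV[R]_p) (v : 'cV[R]_q) :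
  enorm (col_mx u v) ^+ 2 = enorm u ^+ 2 + enorm v ^+ 2.
Proof. by rewrite !enorm_sqr dot_col_mx. Qed.

Lemma generalized_inverse p q (M : 'M[R]_(p, q)) :
  exists X : 'M[R]_(q, p), M *m X *m M = M.
Proof.
exists (pinvmx M); exact: mulmxKpV (submx_refl M).
Qed.

End EuclideanGeometry.

Section EuclideanTopology.
Context {R : realType}.
Implicit Types d : nat.

Lemma norm_le_enorm d (u : 'cV[R]_d) : `|u| <= enorm u.
Proof.
rewrite [leLHS]/Num.norm /= mx_normrE; apply/bigmax_leP; split => /=.
  exact: enorm_ge0.
by case=> i j _ /=; rewrite ord1 enorm_coord.
Qed.

Lemma coord_le_norm d (u : 'cV[R]_d) i : `|u i 0| <= `|u|.
Proof.
by rewrite [leRHS]/Num.norm /= mx_normrE; apply/bigmax_geP; right => /=;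
  exists (i, 0).
Qed.

Lemma enorm_le_norm d (u : 'cV[R]_d) : enorm u <= d%:R * `|u|.
Proof. by apply: enorm_const_le => i; exact: coord_le_norm. Qed.

Lemma nbhs_enormP d (x : 'cV[R]_d) (A : set 'cV[R]_d) :
  nbhs x A <-> exists2 e : R, 0 < e & forall y, enorm (y - x) < e -> A y.
Proof.
split.
  move=> /nbhs_ballP [e e0 xA]; exists e => // y yx; apply: xA.
  by rewrite -ball_normE /= -normrN opprB (le_lt_trans (norm_le_enorm _)).
move=> [e e0 xA]; apply/nbhs_ballP.
exists (e / d.+1%:R) => /=; first by rewrite divr_gt0.
move=> y; rewrite -ball_normE /= => yx; apply: xA.
rewrite enormC; apply: le_lt_trans (enorm_le_norm _) _.
move: yx; rewrite ltr_pdivlMr // => /(le_lt_trans _); apply.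
by rewrite mulrC ler_wpM2l // ler_nat.
Qed.

Lemma cvg_enormP d (u : nat -> 'cV[R]_d) (x : 'cV[R]_d) :
  u @ \oo --> x <->
  forall e : R, 0 < e -> exists N, forall k, (N <= k)%N -> enorm (u k - x) < e.
Proof.
split=> [ux e e0|H].
  have /ux : nbhs x [set y | enorm (y - x) < e] by apply/nbhs_enormP; exists e.
  by case=> N _ HN; exists N => k /HN.
move=> A /nbhs_enormP [e /H[N HN] xA]; exists N => // k /= /HN; exact: xA.
Qed.

Lemma bounded_enorm d (A : set 'cV[R]_d) :
  bounded_set A <-> exists M : R, forall x, A x -> enorm x <= M.
Proof.
split=> [[M [Mr HM]]|[M HM]].
  exists (d%:R * (M + 1)) => x Ax; apply: le_trans (enorm_le_norm _) _.
  by rewrite ler_wpM2l //; apply: HM => //; rewrite ltrDl.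
exists M; split; first exact: num_real.
move=> N MN x Ax; apply: le_trans (norm_le_enorm _) _.
by apply: le_trans (HM _ Ax) _; exact: ltW.
Qed.

(** The cube of side [2 M] is compact entrywise. *)
Lemma bounded_cluster d (u : nat -> 'cV[R]_d) (M : R) :
  (forall k, enorm (u k) <= M) ->
  exists x, forall e : R, 0 < e ->
    forall N, exists2 k, (N <= k)%N & enorm (u k - x) < e.
Proof.
move=> uM.
have cpt : compact [set v : 'rV[R]_d | forall i, `[- M, M]%classic (v ord0 i)].
  by apply: (@rV_compact R d (fun=> `[- M, M]%classic)) => i; exact: segment_compact.
have /cpt : ((fun k => (u k)^T) @ \oo)
    [set v : 'rV[R]_d | forall i, `[- M, M]%classic (v ord0 i)].
  exists 0%N => // k _ /= i; rewrite mxE in_itv /= -ler_norml.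
  exact: le_trans (enorm_coord _ _) _.
case=> y [_ yc]; exists y^T => e e0 N.
have e1 : 0 < e / d.+1%:R by rewrite divr_gt0.
have [z [/= [k Nk <-] ]] := yc [set (u k)^T | k in [set k | (N <= k)%N]]
  (ball y (e / d.+1%:R)) ltac:(exists N => // k /= Nk; by exists k)
    (nbhsx_ballx y _ e1).
rewrite -ball_normE /= => yu; exists k => //.
apply: le_lt_trans (enorm_const_le (c := `|y - (u k)^T|) _) _.
  move=> i; rewrite !mxE distrC [leRHS]/Num.norm /= mx_normrE.
  by apply/bigmax_geP; right => /=; exists (0, i) => //=; rewrite !mxE.
move: yu; rewrite ltr_pdivlMr // => /(le_lt_trans _); apply.
by rewrite mulrC ler_wpM2l // ler_nat.
Qed.

End EuclideanTopology.

(** * Elementary bounds for sine and cosine *)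

Section Trigonometry.
Context {R : realType}.
Implicit Types a b t : R.

Lemma MVT_abs (f df : R -> R) a b :
  (forall x : R, is_derive x 1 f (df x)) ->
  exists2 c, `|c - a| <= `|b - a| & f b - f a = df c * (b - a).
Proof.
move=> fd.
have fc : continuous f.
  by move=> x; apply/differentiable_continuous/derivable1_diffP/ex_derive.
have [ab|/ltW ba] := leP a b.
  have [c cab ->] := MVT_segment ab (fun x _ => fd x) (continuous_subspaceT fc).
  exists c => //; move: cab; rewrite in_itv /= => /andP[ac cb].
  by rewrite !ger0_norm; lra.
have [c cab] := MVT_segment ba (fun x _ => fd x) (continuous_subspaceT fc).
move=> H; exists c; last by rewrite -opprB H; ring.
move: cab; rewrite in_itv /= => /andP[ac cb].
by rewrite !ler0_norm; lra.
Qed.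

Lemma sin_lipschitz a b : `|sin b - sin a| <= `|b - a|.
Proof.
have [c _ ->] := MVT_abs a b (@is_derive_sin R).
by rewrite normrM -[leRHS]mul1r ler_wpM2r // cos_max.
Qed.

Lemma cos_lipschitz a b : `|cos b - cos a| <= `|b - a|.
Proof.
have [c _ ->] := MVT_abs a b (@is_derive_cos R).
by rewrite normrM normrN -[leRHS]mul1r ler_wpM2r // sin_max.
Qed.

Lemma sin_expansion a t : `|sin (a + t) - sin a - t * cos a| <= t ^+ 2.
Proof.
have [c] := MVT_abs a (a + t) (@is_derive_sin R).
rewrite addrAC subrr add0r => ca ->.
rewrite [X in `|X|](_ : _ = (cos c - cos a) * t); last by ring.
rewrite normrM -[t ^+ 2]real_normK ?num_real // expr2 ler_wpM2r //.
exact: le_trans (cos_lipschitz _ _) ca.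
Qed.

Lemma cos_sub1 t : `|cos t - 1| <= t ^+ 2.
Proof.
have [c] := MVT_abs 0 t (@is_derive_cos R).
rewrite cos0 !subr0 => ct ->.
rewrite normrM normrN -[t ^+ 2]real_normK ?num_real // expr2 ler_wpM2r //.
by have := sin_lipschitz 0 c; rewrite sin0 !subr0 => /le_trans; apply.
Qed.

Lemma sin_sub_id t : `|sin t - t| <= `|t| ^+ 3.
Proof.
have [c] := MVT_abs 0 t (@is_derive_sin R).
rewrite sin0 !subr0 => ct ->.
rewrite [X in `|X|](_ : _ = (cos c - 1) * t); last by ring.
rewrite normrM exprSr ler_wpM2r //; apply: le_trans (cos_sub1 _) _.
by rewrite -[c ^+ 2]real_normK ?num_real // lerXn2r // nnegrE.
Qed.

(** By the double angle formula [sin t] is [t] times two cosines of angles in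
    [[0, pi / 4]], each at least [cos (pi / 4)]. *)
Lemma half_le_sin t : - (pi / 2) <= t <= pi / 2 -> `|t| / 2 <= `|sin t|.
Proof.
wlog t0 : t / 0 <= t.
  move=> H tpi; have [|/ltW t0] := leP 0 t; first by move/H; apply.
  rewrite -normrN -[`|sin t|]normrN -sinN; apply: H; lra.
move=> tpi; have pi0 := pi_gt0 R.
have cos2 : cos (pi / 4) ^+ 2 = 1 / 2 :> R.
  have := cos_mulr2n (pi / 4 : R).
  rewrite (_ : _ *+ 2 = pi / 2 :> R) ?cos_pihalf; first by rewrite mulr2n; lra.
  by rewrite mulr2n; lra.
have cos_ge (c : R) : 0 <= c <= pi / 4 -> cos (pi / 4) <= cos c.
  move=> cp; rewrite leNgt ltr_cos ?in_itv /= -?leNgt; lra.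
have cos4 : 0 <= cos (pi / 4 : R) by apply: cos_ge0_pihalf; lra.
rewrite [t in sin t](_ : _ = (t / 2) *+ 2); last by rewrite mulr2n; lra.
rewrite sin_mulr2n.
have [c] := MVT_abs 0 (t / 2) (@is_derive_sin R).
rewrite sin0 !subr0 => ct ->; rewrite -(cos_norm c).
have c4 : cos (pi / 4) <= cos `|c|.
  by apply: cos_ge; have := normr_ge0 c; move: ct;
    rewrite (ger0_norm (x := t / 2)); lra.
have c4' : cos (pi / 4) <= cos (t / 2) by apply: cos_ge; lra.
rewrite (ger0_norm t0) ger0_norm; last first.
  have := le_trans cos4 c4; have := le_trans cos4 c4' => ? ?.
  by rewrite mulrn_wge0 // !mulr_ge0 //; lra.
have H : cos (pi / 4) ^+ 2 <= cos (t / 2) * cos `|c|.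
  by rewrite expr2 ler_pM.
rewrite cos2 in H; have {}H := ler_wpM2r t0 H.
rewrite (_ : _ *+ 2 = cos (t / 2) * cos `|c| * t); first by apply: le_trans H; lra.
by rewrite -[LHS]mulr_natr; field.
Qed.

End Trigonometry.

(** * First-order expansions and the descent inequality *)

Section Expansion.
Context {R : realType}.

(** A first-order expansion with quadratic remainder.  It gives the partial derivatives
    without any appeal to total differentiability, and at the same time it is
    the inequality from which regular subgradients are read off. *)
Definition expands d (f : 'cV[R]_d -> R) (x w : 'cV[R]_d) : Prop :=
  exists C : R, forall h, enorm h <= 1 ->
    `|f (x + h) - f x - dot w h| <= C * enorm h ^+ 2.

Lemma is_derive_quad (V : normedModType R) (f : V -> R) (x v : V) (l C D : R) :
  0 < D ->
  (forall s : R, `|s| <= D -> `|f (s *: v + x) - f x - s * l| <= C * s ^+ 2) ->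
  is_derive x v f l.
Proof.
move=> D0 H.
have cv : (fun h : R => h^-1 *: ((f \o shift x) (h *: v) - f x)) @ 0^' --> l.
  apply/cvgrPdist_le => e e0.
  have C0 : 0 < `|C| + 1 by rewrite ltr_wpDl.
  near=> h.
  have h0 : h != 0 by near: h; exact: nbhs_dnbhs_neq.
  have hD : `|h| <= D.
    by near: h; apply: dnbhs0_le.
  have he : `|h| <= e / (`|C| + 1).
    by near: h; apply: dnbhs0_le; rewrite divr_gt0.
  rewrite /= /shift /= distrC.
  rewrite (_ : _ - _ = h^-1 * (f (h *: v + x) - f x - h * l)); last first.
    by rewrite [in LHS]/GRing.scale /=; field.
  rewrite normrM normfV ler_pdivrMl ?normr_gt0 //.
  apply: le_trans (H _ hD) _; apply: le_trans (ler_norm _) _.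
  rewrite normrM normrX expr2 mulrCA ler_wpM2l //.
  apply: le_trans (_ : (`|C| + 1) * `|h| <= e); first by rewrite ler_wpM2r // lerDl.
  by rewrite -ler_pdivlMl // mulrC.
by constructor; [apply/cvg_ex; exists l|exact/cvg_lim].
Unshelve. all: by end_near. Qed.

Lemma expands_is_derive d (f : 'cV[R]_d -> R) x w v :
  expands f x w -> is_derive x v f (dot w v).
Proof.
move=> [C H]; pose D := (enorm v + 1)^-1.
have v1 : 0 < enorm v + 1 by rewrite ltr_wpDl ?enorm_ge0.
apply: (@is_derive_quad _ _ _ _ _ (C * enorm v ^+ 2) D); first by rewrite invr_gt0.
move=> s sD; rewrite [s *: v + x]addrC -dotZr.
apply: le_trans (H _ _) _; rewrite enormZ.
  apply: (@le_trans _ _ (D * (enorm v + 1))); last by rewrite mulVf ?gt_eqF.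
  by apply: ler_pM => //; rewrite ?enorm_ge0 // lerDl.
rewrite exprMn real_normK ?num_real //.
by rewrite le_eqVlt; apply/orP; left; apply/eqP; ring.
Qed.

Lemma expands_grad d (f : 'cV[R]_d -> R) x w : expands f x w -> grad f x = w.
Proof.
move=> fx; apply/matrixP => i j; rewrite ord1 mxE.
have /@derive_val -> := expands_is_derive (delta_mx i 0) fx.
by rewrite dotC dot_deltal.
Qed.

(** Integrating the gradient along a segment costs half of its Lipschitz
    constant. *)
Lemma descent d (f : 'cV[R]_d -> R) (gf : 'cV[R]_d -> 'cV[R]_d) (L : R) x y :
  (forall u, expands f u (gf u)) -> lipschitz_with L gf setT ->
  f y <= f x + dot (gf x) (y - x) + L / 2 * enorm (y - x) ^+ 2.
Proof.
move=> fgf Lgf; set v := y - x.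
pose psi (t : R) := f (x + t *: v) - t * dot (gf x) v - t ^+ 2 *
  (L / 2 * enorm v ^+ 2).
pose dpsi (t : R) := dot (gf (x + t *: v)) v - dot (gf x) v - t * (L * enorm v ^+ 2).
have dp (t : R) : is_derive t 1 psi (dpsi t).
  have [C H] := fgf (x + t *: v).
  have v1 : 0 < enorm v + 1 by rewrite ltr_wpDl ?enorm_ge0.
  apply: (@is_derive_quad R psi t 1 (dpsi t)
    (C * enorm v ^+ 2 + `|L / 2 * enorm v ^+ 2|) (enorm v + 1)^-1).
    by rewrite invr_gt0.
  move=> s sD; have := H (s *: v).
  rewrite -[x + _ + _]addrA -scalerDl [t + s]addrC dotZr => {}H.
  rewrite /psi /dpsi [s *: 1]mulr1.
  rewrite [X in `|X|](_ : _ = (f (x + (s + t) *: v) - f (x + t *: v)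
     - s * dot (gf (x + t *: v)) v) - s ^+ 2 * (L / 2 * enorm v ^+ 2)); last by field.
  apply: le_trans (ler_normB _ _) _; rewrite mulrDl lerD //; last first.
    by rewrite normrM normrX real_normK ?num_real // mulrC.
  apply: le_trans (H _) _.
    rewrite enormZ; apply: (@le_trans _ _ ((enorm v + 1)^-1 * (enorm v + 1))).
      by apply: ler_pM => //; rewrite ?enorm_ge0 // lerDl.
    by rewrite mulVf ?gt_eqF.
  rewrite enormZ exprMn real_normK ?num_real //.
  by rewrite le_eqVlt; apply/orP; left; apply/eqP; ring.
have pc : continuous psi.
  by move=> t; apply/differentiable_continuous/derivable1_diffP/ex_derive.
have [c] := MVT_segment (@ler01 R) (fun t _ => dp t) (continuous_subspaceT pc).
rewrite in_itv /= => /andP[c0 c1].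
rewrite /psi !scale1r !scale0r addr0 !mul1r !mul0r expr1n expr0n /= !mul0r.
rewrite [x + v]addrC subrK !subr0 mulr1 => H.
suff : dpsi c <= 0 by rewrite -H; lra.
rewrite /dpsi -dotBl subr_le0; apply: le_trans (dot_le _ _) _.
have := Lgf (x + c *: v) x I I; rewrite [_ + _ - x]addrC addKr.
rewrite enormZ (ger0_norm c0) => /(ler_wpM2r (enorm_ge0 v)) /le_trans; apply.
by rewrite le_eqVlt; apply/orP; left; apply/eqP; ring.
Qed.

End Expansion.

(** * Entrywise products and block vectors *)

Section Hadamard.
Context {R : realType} {d : nat}.
Implicit Types u v w : 'cV[R]_d.

Definition had u v : 'cV[R]_d := \col_i (u i 0 * v i 0).

Lemma hadE u v i : had u v i 0 = u i 0 * v i 0.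
Proof. by rewrite mxE. Qed.

Lemma hadC u v : had u v = had v u.
Proof. by apply/matrixP => i j; rewrite !mxE mulrC. Qed.

Lemma hadDr u v w : had u (v + w) = had u v + had u w.
Proof. by apply/matrixP => i j; rewrite !mxE mulrDr. Qed.

Lemma hadZr c u v : had u (c *: v) = c *: had u v.
Proof. by apply/matrixP => i j; rewrite !mxE mulrCA. Qed.

Lemma hadNr u v : had u (- v) = - had u v.
Proof. by rewrite -scaleN1r hadZr scaleN1r. Qed.

Lemma hadBr u v w : had u (v - w) = had u v - had u w.
Proof. by rewrite hadDr hadNr. Qed.

Lemma had0r u : had u 0 = 0.
Proof. by rewrite -(scale0r 0) hadZr !scale0r. Qed.

Lemma hadCA u v w : had u (had v w) = had v (had u w).
Proof. by apply/matrixP => i j; rewrite !mxE mulrCA. Qed.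

Lemma dot_had u v w : dot (had u v) w = dot v (had u w).
Proof. by rewrite /dot; apply: eq_bigr => i _; rewrite !mxE -mulrA mulrCA. Qed.

Lemma enorm_had u v (c : R) :
  0 <= c -> (forall i, `|u i 0| <= c) -> enorm (had u v) <= c * enorm v.
Proof.
move=> c0 uc; apply: enorm_leP; first by rewrite mulr_ge0 ?enorm_ge0.
rewrite exprMn enorm_sqr mulr_sumr; apply: ler_sum => i _; rewrite !mxE.
rewrite -!expr2 exprMn ler_wpM2r ?sqr_ge0 //.
by rewrite -[u i 0 ^+ 2]real_normK ?num_real // lerXn2r // nnegrE.
Qed.

Lemma enorm_had_le u v : enorm (had u v) <= enorm u * enorm v.
Proof. by apply: enorm_had => [|i]; [exact: enorm_ge0|exact: enorm_coord]. Qed.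

Lemma diag_mx_had u v : diag_mx u^T *m v = had u v.
Proof. by apply/matrixP => i j; rewrite mul_diag_mx ord1 !mxE. Qed.

End Hadamard.

Section Triple.
Context {R : realType} {m n : nat}.
Implicit Types (x y : 'cV[R]_(m + (n + n))).

Lemma enorm_usub p q (x : 'cV[R]_(p + q)) : enorm (usubmx x) <= enorm x.
Proof.
rewrite -{2}(vsubmxK x) enorm_le_sqr // -!enorm_sqr enorm_col_mx.
by rewrite lerDl sqr_ge0.
Qed.

Lemma enorm_dsub p q (x : 'cV[R]_(p + q)) : enorm (dsubmx x) <= enorm x.
Proof.
rewrite -{2}(vsubmxK x) enorm_le_sqr // -!enorm_sqr enorm_col_mx.
by rewrite lerDr sqr_ge0.
Qed.

Lemma tripleK x :
  x = col_mx (usubmx x) (col_mx (usubmx (dsubmx x)) (dsubmx (dsubmx x))).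
Proof. by rewrite !vsubmxK. Qed.

Lemma on_tripleE nd ng T
   (F : 'cV[R]_m -> 'cV[R]_(nd + ng) -> 'cV[R]_(nd + ng) -> T) g z th :
  on_triple F (triple g z th) = F g z th.
Proof. by rewrite /on_triple /triple !(col_mxKu, col_mxKd). Qed.

End Triple.

(** * Derivatives of the penalized objective *)

Section Model.
Context {R : realType} {m nd ng : nat}.
Let n := (nd + ng)%N.
Variables (N : network R m nd ng) (K : nat) (rho : R).
Implicit Types (g : 'cV[R]_m) (z th : 'cV[R]_n).

Local Notation E := (incidence N).
Local Notation B := (incidence N *m Dmat N).

Definition angles th : 'cV[R]_m := E^T *m th.

Definition cos_flow th : 'cV[R]_m := map_mx cos (angles th).

Definition inflow g th : 'cV[R]_n := B *m had g (sin_flow N th).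

Definition residual g z th : 'cV[R]_n := inflow g th - (Pinj N + z).

Definition load_ones : 'cV[R]_n := col_mx (const_mx 1) 0.

Definition dH_g g z th : 'cV[R]_m :=
  rho *: had (sin_flow N th) (B^T *m residual g z th).
Definition dH_z g z th : 'cV[R]_n := - load_ones - rho *: residual g z th.
Definition dH_th g z th : 'cV[R]_n :=
  rho *: (E *m had g (had (cos_flow th) (B^T *m residual g z th))).

Lemma HrhoE g z th :
  Hrho N rho g z th = - dot load_ones z + rho / 2 * enorm (residual g z th) ^+ 2.
Proof.
rewrite /Hrho /residual /inflow -!mulmxA diag_mx_had; congr (- _ + _).
rewrite -[X in dot _ X](vsubmxK z) dot_col_mx dot0l addr0.
by apply: eq_bigr => i _; rewrite !mxE mul1r.
Qed.

Lemma anglesD th h : angles (th + h) = angles th + angles h.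
Proof. by rewrite /angles mulmxDr. Qed.

Lemma angles_coordD th h l : angles (th + h) l 0 = angles th l 0 + angles h l 0.
Proof. by rewrite anglesD mxE. Qed.

Lemma angles_coordZ c th l : angles (c *: th) l 0 = c * angles th l 0.
Proof. by rewrite /angles -scalemxAr mxE. Qed.

(** Only the angles enter nonlinearly: per line the remainder consists of the
    second-order error of the sine and of a product of two increments. *)
Lemma residual_expansion g z th : exists C : R, forall hg hz hth (e : R),
  enorm hg <= e -> enorm hz <= e -> enorm hth <= e -> e <= 1 ->
  let J := B *m (had hg (sin_flow N th) + had g (had (cos_flow th) (angles hth)))
    - hz in
  exists eps, [/\ residual (g + hg) (z + hz) (th + hth) = residual g z th + J + eps,
     enorm J <= C * e & enorm eps <= C * e ^+ 2].
Proof.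
have bnd p q (M : 'M[R]_(p, q)) : exists2 b, 0 <= b & forall x,
  enorm (M *m x) <= b * enorm x.
  by exists (mxbound M); [exact/ltW/mxbound_gt0|exact: mxboundP].
have [b b0 bP] := bnd _ _ B; have [a a0 aP] := bnd _ _ E^T.
(* [C1] bounds the linear part, [C2] the remainder *)
pose C1 := b * (1 + enorm g * a) + 1.
pose C2 := b * (m%:R * (enorm g * a ^+ 2 + a)).
exists (C1 + C2) => hg hz hth e hge hze hthe e1 J.
have e0 : 0 <= e by exact: le_trans (enorm_ge0 _) hge.
have g0 := enorm_ge0 g.
have dth : enorm (angles hth) <= a * e.
  by apply: le_trans (aP _) _; rewrite ler_wpM2l //.
have C1p : 0 <= C1 by rewrite /C1 !(mulr_ge0, addr_ge0).
have C2e : 0 <= C2 by rewrite /C2 !(mulr_ge0, addr_ge0, exprn_ge0).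
have JC : enorm J <= C1 * e.
  rewrite /J; apply: le_trans (enormB _ _) _; rewrite mulrDl mul1r lerD //.
  apply: le_trans (bP _) _; rewrite -mulrA ler_wpM2l //.
  apply: le_trans (enormD _ _) _; rewrite mulrDl mul1r lerD //.
    rewrite hadC; apply: le_trans (enorm_had (c := 1) _ ler01 _) _;
      last by rewrite mul1r.
    by move=> i; rewrite !mxE sin_max.
  rewrite -mulrA; apply: le_trans (enorm_had_le _ _) _; rewrite ler_wpM2l //.
  apply: le_trans (enorm_had (c := 1) _ ler01 _) _; last by rewrite mul1r.
  by move=> i; rewrite !mxE cos_max.
exists (residual (g + hg) (z + hz) (th + hth) - residual g z th - J); split.
- move: (residual (g + hg) _ _) (residual g z th) (J) => X r j.
  by apply/matrixP => i k; rewrite !mxE; ring.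
- by apply: le_trans JC _; apply: ler_wpM2r => //; rewrite lerDl.
pose ep := \col_l ((g + hg) l 0 * sin (angles th l 0 + angles hth l 0)
   - g l 0 * sin (angles th l 0) - (hg l 0 * sin (angles th l 0)
   + g l 0 * (cos (angles th l 0) * angles hth l 0))).
have -> : residual (g + hg) (z + hz) (th + hth) - residual g z th - J = B *m ep.
  rewrite /residual /J /inflow.
  rewrite (_ : ep = had (g + hg) (sin_flow N (th + hth)) - had g (sin_flow N th)
    - (had hg (sin_flow N th) + had g (had (cos_flow th) (angles hth)))); last first.
    by apply/matrixP => i j; rewrite ord1 /sin_flow -/(angles _) anglesD !mxE.
  rewrite [in RHS]mulmxBr [in X in _ = X - _]mulmxBr.
  move: (B *m had (g + hg) _) (B *m had g _) (B *m (_ + _)) => u v w.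
  by apply/matrixP => i j; rewrite !mxE; ring.
apply: (@le_trans _ _ (C2 * e ^+ 2)); last first.
  by apply: ler_wpM2r; [exact: exprn_ge0|rewrite lerDr].
apply: le_trans (bP _) _; rewrite -[C2 * _]mulrA ler_wpM2l //.
rewrite -mulrA; apply: enorm_const_le => l; rewrite [ep l 0]mxE [(g + hg) l 0]mxE.
set A := angles th l 0; set h := angles hth l 0.
have hh : `|h| <= a * e by apply: le_trans dth; exact: enorm_coord.
have hl : `|hg l 0| <= e by apply: le_trans hge; exact: enorm_coord.
have gl := enorm_coord g l.
rewrite [X in `|X|](_ : _ = g l 0 * (sin (A + h) - sin A - h * cos A)
   + hg l 0 * (sin (A + h) - sin A)); last by ring.
apply: le_trans (ler_normD _ _) _; rewrite !normrM mulrDl lerD //.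
  rewrite -mulrA ler_pM //; apply: le_trans (sin_expansion _ _) _.
  by rewrite -[h ^+ 2]real_normK ?num_real // -exprMn lerXn2r // nnegrE mulr_ge0 //.
rewrite expr2 mulrCA ler_pM //; apply: le_trans (sin_lipschitz _ _) _.
by rewrite addrAC subrr add0r.
Qed.

(** The right-hand side pairs the increments with the gradient, up to the factor
    [rho] and the linear term of the objective. *)
Lemma residual_adjoint g th r hg hz hth :
  dot r (B *m (had hg (sin_flow N th) + had g (had (cos_flow th) (angles hth))) - hz)
  = dot (had (sin_flow N th) (B^T *m r)) hg - dot r hz
    + dot (E *m had g (had (cos_flow th) (B^T *m r))) hth.
Proof.
rewrite dotBr mulmxDr dotDr !(dotC r (_ *m _)) !(dot_mulmxl B).
rewrite (dot_mulmxl E) -/(angles hth); move: (B^T *m r) => b.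
rewrite (hadC hg) (dot_had _ hg) (dotC hg)
  [dot (had g (had _ (angles hth))) b]dot_had.
by rewrite [dot (had _ (angles hth)) _]dot_had (dotC (angles hth)) hadCA; ring.
Qed.

Definition dH x : 'cV[R]_(m + (n + n)) :=
  on_triple (fun g z th => triple (dH_g g z th) (dH_z g z th) (dH_th g z th)) x.

Lemma Hjoint_expands x : expands (Hjoint N rho) x (dH x).
Proof.
rewrite {2}[x]tripleK -/(triple _ _ _) /dH on_tripleE.
set g := usubmx x; set z := usubmx (dsubmx x); set th := dsubmx (dsubmx x).
have [C HC] := residual_expansion g z th.
pose r := residual g z th.
exists (`|rho / 2| * (4 * C ^+ 2 + 2 * (enorm r * `|C|))) => h h1.
have dh1 := enorm_usub h; have dh2 := enorm_dsub h.
have dh3 := le_trans (enorm_usub _) dh2; have dh4 := le_trans (enorm_dsub _) dh2.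
have [eps [rE JC epsC]] := HC _ _ _ _ dh1 dh3 dh4 h1.
rewrite /Hjoint /on_triple /= !HrhoE !linearD /= -/g -/z -/th.
set hg := usubmx h; set hz := usubmx (dsubmx h); set hth := dsubmx (dsubmx h).
move: rE JC; set J := (_ - _); rewrite -/hg -/hz -/hth => rE JC.
rewrite rE -/r.
have dE : dot (triple (dH_g g z th) (dH_z g z th) (dH_th g z th)) h =
    - dot load_ones hz + rho * dot r J.
  rewrite /J residual_adjoint [X in dot _ X]tripleK /triple !dot_col_mx -/hg -/hz
    -/hth.
  rewrite /dH_g /dH_z /dH_th -/r !dotZl dotBl dotNl dotZl; ring.
rewrite dE dotDr -(addrA r) (enormD_sqr r) (dotDr J eps r).
rewrite [X in `|X|](_ : _ = rho / 2 * (enorm (J + eps) ^+ 2 + 2 * dot r eps));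
  last by field.
rewrite normrM -(mulrA `|_|) ler_wpM2l // (mulrDl (4 * _)).
apply: le_trans (ler_normD _ _) _.
have h0 := enorm_ge0 h.
have C0 : 0 <= C * enorm h by exact: le_trans (enorm_ge0 _) JC.
have hh : enorm h ^+ 2 <= enorm h by rewrite expr2 ler_piMl.
have eC : enorm eps <= C * enorm h.
  have [Cp|Cn] := leP 0 C; first by apply: le_trans epsC _; rewrite ler_wpM2l.
  by apply: le_trans epsC _; nra.
apply: lerD.
  rewrite ger0_norm ?sqr_ge0 //.
  rewrite (_ : 4 * _ * _ = (2 * (C * enorm h)) ^+ 2); last by ring.
  have C2 : 0 <= 2 * (C * enorm h) by exact: mulr_ge0.
  rewrite ler_pXn2r ?nnegrE ?enorm_ge0 //.
  by apply: le_trans (enormD _ _) _; lra.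
rewrite normrM (ger0_norm (x := 2)) // -!mulrA ler_wpM2l //.
apply: le_trans (CauchySchwarz _ _) _; rewrite ler_wpM2l ?enorm_ge0 //.
by apply: le_trans epsC _; rewrite ler_wpM2r ?exprn_ge0 // ler_norm.
Qed.

Lemma triple_add g z th hg hz hth :
  triple g z th + triple hg hz hth = triple (g + hg) (z + hz) (th + hth)
  :> 'cV[R]_(m + (n + n)).
Proof. by rewrite /triple !add_col_mx. Qed.

Lemma triple_sub g z th hg hz hth :
  triple g z th - triple hg hz hth = triple (g - hg) (z - hz) (th - hth)
  :> 'cV[R]_(m + (n + n)).
Proof. by rewrite /triple !opp_col_mx !add_col_mx. Qed.

Lemma enorm_triple_sqr g z th :
  enorm (triple g z th : 'cV[R]_(m + (n + n))) ^+ 2 =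
  enorm g ^+ 2 + enorm z ^+ 2 + enorm th ^+ 2.
Proof. by rewrite /triple !enorm_col_mx addrA. Qed.

Lemma dot_triple g z th hg hz hth :
  dot (triple g z th) (triple hg hz hth : 'cV[R]_(m + (n + n))) =
  dot g hg + dot z hz + dot th hth.
Proof. by rewrite /triple !dot_col_mx addrA. Qed.

Lemma expands_g g z th : expands (fun g' => Hrho N rho g' z th) g (dH_g g z th).
Proof.
have [C HC] := Hjoint_expands (triple g z th); exists C => h h1.
have eh : enorm (triple h 0 0 : 'cV[R]_(m + (n + n))) = enorm h.
  apply/eqP; rewrite -(@eqrXn2 _ 2) ?enorm_ge0 // enorm_triple_sqr !enorm0.
  by rewrite expr0n /= !addr0.
have := HC (triple h 0 0); rewrite eh triple_add !addr0 /Hjoint /dH !on_tripleE.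
by rewrite dot_triple !dot0r !addr0; apply.
Qed.

Lemma expands_z g z th : expands (fun z' => Hrho N rho g z' th) z (dH_z g z th).
Proof.
have [C HC] := Hjoint_expands (triple g z th); exists C => h h1.
have eh : enorm (triple 0 h 0 : 'cV[R]_(m + (n + n))) = enorm h.
  apply/eqP; rewrite -(@eqrXn2 _ 2) ?enorm_ge0 // enorm_triple_sqr !enorm0.
  by rewrite expr0n /= add0r !addr0.
have := HC (triple 0 h 0); rewrite eh triple_add !addr0 /Hjoint /dH !on_tripleE.
by rewrite dot_triple !dot0r add0r !addr0; apply.
Qed.

Lemma expands_th g z th : expands (fun th' => Hrho N rho g z th') th (dH_th g z th).
Proof.
have [C HC] := Hjoint_expands (triple g z th); exists C => h h1.
have eh : enorm (triple 0 0 h : 'cV[R]_(m + (n + n))) = enorm h.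
  apply/eqP; rewrite -(@eqrXn2 _ 2) ?enorm_ge0 // enorm_triple_sqr !enorm0.
  by rewrite expr0n /= !add0r.
have := HC (triple 0 0 h); rewrite eh triple_add !addr0 /Hjoint /dH !on_tripleE.
by rewrite dot_triple !dot0r !add0r; apply.
Qed.

End Model.

(** * Proximal steps on indicator functions *)

Section Prox.
Context {R : realType} {d : nat}.
Implicit Types (A : set 'cV[R]_d) (x y w : 'cV[R]_d).

Lemma indicator0_in A x : A x -> indicator0 A x = 0%E.
Proof. by move=> Ax; rewrite /indicator0 mem_set. Qed.

Lemma indicator0_notin A x : ~ A x -> indicator0 A x = +oo%E.
Proof. by move=> Ax; rewrite /indicator0 memNset. Qed.

(** Completing the square turns the proximal problem into the minimization of
    the linearized objective plus a quadratic term. *)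
Lemma prox_indicator A (c : R) x0 w x :
  0 < c -> A !=set0 -> prox_argmin (indicator0 A) c (x0 - c^-1 *: w) x ->
  A x /\ forall y, A y ->
    dot w (x - y) + c / 2 * (enorm (x - x0) ^+ 2 - enorm (y - x0) ^+ 2) <= 0.
Proof.
move=> c0 [a Aa] H.
have Ax : A x.
  apply: contrapT => nAx; have := H a.
  by rewrite (indicator0_in Aa) (indicator0_notin nAx) add0e addye.
split => // y Ay; have := H y.
rewrite !indicator0_in // !add0e lee_fin !opprB !(addrCA _ (c^-1 *: w))
  !(addrC (c^-1 *: w)).
rewrite !enormD_sqr !dotZr !enormZ dotBr (dotC w) (dotC w) !dotBl.
set u := enorm (x - x0); set v := enorm (y - x0); set e := `|c^-1| * enorm w.
rewrite -subr_le0 => {}H; apply: le_trans H.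
by rewrite le_eqVlt; apply/orP; left; apply/eqP; field; rewrite gt_eqF.
Qed.

Definition convex_set A :=
  forall x y (t : R), A x -> A y -> 0 <= t <= 1 -> A (x + t *: (y - x)).

(** The first-order form of the minimality, obtained by moving from [x] toward
    [y] by a vanishing fraction [t]. *)
Lemma prox_convex A (c : R) x0 w x :
  0 < c -> convex_set A -> A x ->
  (forall y, A y ->
    dot w (x - y) + c / 2 * (enorm (x - x0) ^+ 2 - enorm (y - x0) ^+ 2) <= 0) ->
  forall y, A y -> dot (w + c *: (x - x0)) (x - y) <= 0.
Proof.
move=> c0 cA Ax H y Ay; apply/ler_addgt0Pr => e e0; rewrite add0r.
pose C := c / 2 * enorm (y - x) ^+ 2.
have C0 : 0 <= C by rewrite mulr_ge0 ?sqr_ge0 // divr_ge0 // ltW.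
(* small enough for the quadratic term [C] not to exceed [e] *)
pose t := Num.min 1 (e / (C + 1)).
have t0 : 0 < t by rewrite lt_min ltr01 divr_gt0 // ltr_wpDl.
have t1 : t <= 1 by rewrite ge_min lexx.
have te : t * C <= e.
  apply: (@le_trans _ _ (e / (C + 1) * (C + 1)));
    last by rewrite divfK // gt_eqF // ltr_wpDl.
  apply: ler_pM => //; [exact: ltW|by rewrite ge_min lexx orbT|by rewrite lerDl].
have tt : 0 <= t <= 1 by rewrite ltW.
have := H _ (cA _ _ _ Ax Ay tt); rewrite (_ : x - _ = t *: (x - y)); last first.
  by apply/matrixP => i j; rewrite !mxE; ring.
rewrite (_ : x + _ - x0 = (x - x0) + t *: (y - x)); last first.
  by apply/matrixP => i j; rewrite !mxE; ring.
rewrite (enormD_sqr (x - x0)) enormZ exprMn real_normK ?num_real // !dotZr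
  -(opprB x y) dotNr enormN.
rewrite (dotDl w) dotZl.
move: te; rewrite /C (enormC y x);
  move: (enorm _ ^+ 2) (dot w _) (dot (x - x0) _) (enorm _ ^+ 2).
move=> X a b Y te H1.
rewrite -(ler_pM2l t0); apply: le_trans (_ : t * (t * (c / 2 * Y)) <= _); last first.
  by rewrite (ler_pM2l t0).
lra.
Qed.

(** The excess [r - 1] of the step-size factor is what remains after paying for
    the descent inequality. *)
Lemma prox_decrease A (f : 'cV[R]_d -> R) gf (L r : R) x0 x :
  (forall u, expands f u (gf u)) -> lipschitz_with L gf setT -> A x0 ->
  (forall y, A y -> dot (gf x0) (x - y)
     + (r * L) / 2 * (enorm (x - x0) ^+ 2 - enorm (y - x0) ^+ 2) <= 0) ->
  (r - 1) / 2 * L * enorm (x - x0) ^+ 2 <= f x0 - f x.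
Proof.
move=> fgf Lf A0 /(_ _ A0); rewrite subrr enorm0 expr0n /= subr0.
by have := descent x0 x fgf Lf; lra.
Qed.

End Prox.

(** * Uniformity over finite families *)

Section FiniteUniform.
Context {R : realType} {T : finType}.

Lemma finite_uniform (P : T -> R -> Prop) :
  (forall t C C', C <= C' -> P t C -> P t C') -> (forall t, exists C, P t C) ->
  exists2 C, 0 < C & forall t, P t C.
Proof.
move=> mono /choice[F HF]; exists (1 + \sum_t `|F t|).
  by rewrite ltr_wpDr ?ltr01 // sumr_ge0.
move=> t; apply: mono (HF t); rewrite (bigD1 t) //= addrCA.
apply: le_trans (ler_norm _) _; rewrite lerDl addr_ge0 // sumr_ge0 //.
Qed.

Lemma finite_gap (f : T -> R) : (forall t, 0 <= f t) ->
  exists2 c, 0 < c & forall t, f t = 0 \/ c <= f t.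
Proof.
move=> f0; have [|t|C C0 H] := @finite_uniform (fun t C => f t = 0 \/ (f t)^-1 <= C).
- by move=> t C C' CC' [->|H]; [left|right; exact: le_trans CC'].
- by exists (f t)^-1; right.
exists C^-1; first by rewrite invr_gt0.
move=> t; have [|ft] := eqVneq (f t) 0; first by left.
have fp : 0 < f t by rewrite lt0r ft f0.
by case: (H t) => [/eqP|]; rewrite ?(negbTE ft) // => H'; right;
  rewrite invf_ple // posrE.
Qed.

End FiniteUniform.

(** * The Rayleigh quotient along a projected gradient step *)

Section Rayleigh.
Context {R : realType} {n : nat}.
Implicit Types (u v q : 'cV[R]_n).

(** The vector [v'] stands for the projection of [v - gr] on a cone: it is
    orthogonal to the residual of the projection, and [v] has a nonpositive
    product with it.  Write [v' = s v + q] with [q] orthogonal to [v].  The two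
    conditions give [s >= 1 - b - e], where [b] is the quotient at [v], and
    [dot q (S v) <= - |q| ^ 2] up to the error [e] of the gradient.  Since
    [|S| < 1], the cross term then outweighs what [q] adds to the quadratic
    form, so that for [e = 0] the quotient cannot increase. *)
Lemma rayleigh_step (S : 'M[R]_n) (mu e : R) v v' gr :
  (forall u w, dot (S *m u) w = dot u (S *m w)) ->
  (forall u, enorm (S *m u) <= mu * enorm u) ->
  mu < 1 -> v != 0 ->
  enorm (gr - S *m v) <= e * enorm v -> e <= (1 - mu) / 2 ->
  dot v' (v - gr - v') = 0 -> dot v (v - gr - v') <= 0 ->
  v' != 0 /\
  dot v' (S *m v') / enorm v' ^+ 2 <= dot v (S *m v) / enorm v ^+ 2 + 2 * e.
Proof.
move=> Ssym Smu mu1 v0 ev e1 Nv' Nv.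
have nv : 0 < enorm v by rewrite enorm_gt0.
have nv2 : 0 < enorm v ^+ 2 by rewrite exprn_gt0.
have ep : 0 <= e by rewrite -(pmulr_lge0 _ nv); exact: le_trans (enorm_ge0 _) ev.
have [er grE {}ev] : exists2 er, gr = S *m v + er & enorm er <= e * enorm v.
  by exists (gr - S *m v); rewrite // addrC subrK.
have [h hE] : exists h, h = dot v (S *m v) by eexists.
rewrite -hE; have [b bE] : exists b, b = h / enorm v ^+ 2 by eexists.
have hb : h = b * enorm v ^+ 2 by rewrite bE divfK // gt_eqF.
have bmu : b <= mu.
  rewrite bE hE ler_pdivrMr //; apply: le_trans (dot_le _ _) _.
  by rewrite expr2 mulrCA ler_wpM2l ?enorm_ge0.
(* the decomposition of [v'] along [v] and its orthogonal complement *)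
have [s sE] : exists s, s = dot v' v / enorm v ^+ 2 by eexists.
have [q qE] : exists q, q = v' - s *: v by eexists.
have qv : dot q v = 0.
  by rewrite qE dotBl dotZl -enorm_sqr sE divfK ?subrr // gt_eqF.
have v'E : v' = s *: v + q by rewrite qE addrC subrK.
have n2 : enorm v' ^+ 2 = s ^+ 2 * enorm v ^+ 2 + enorm q ^+ 2.
  rewrite [in LHS]v'E enormD_sqr enormZ exprMn real_normK ?num_real // dotZl
    (dotC v) qv.
  by rewrite !mulr0 addr0.
have er1 : dot v er <= e * enorm v ^+ 2.
  by apply: le_trans (dot_le _ _) _; rewrite expr2 mulrCA ler_wpM2l ?enorm_ge0.
have sge : 1 - b - e <= s.
  rewrite -(ler_pM2r nv2).
  have : dot v (v - gr - v') = enorm v ^+ 2 - h - dot v er - s * enorm v ^+ 2.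
    rewrite grE !dotBr dotDr -enorm_sqr -hE (dotC v v').
    by rewrite sE divfK ?gt_eqF //; ring.
  by move: Nv => /[swap] ->; rewrite hb; lra.
have sp : 0 < s by lra.
have qN : dot q (S *m v) <= - enorm q ^+ 2 + enorm q * (e * enorm v).
  have H1 : dot q (v - gr - v') = - s * dot v (v - gr - v').
    by rewrite qE dotBl Nv' dotZl sub0r mulNr.
  have H2 : dot q (v - gr - v') = - dot q (S *m v) - dot q er - enorm q ^+ 2.
    rewrite grE [in LHS]v'E !dotBr !dotDr dotZr qv -enorm_sqr; ring.
  have H3 : 0 <= - s * dot v (v - gr - v')
    by rewrite mulNr oppr_ge0 mulr_ge0_le0 // ltW.
  have H4 := dot_ge q er.
  have H5 : enorm q * enorm er <= enorm q * (e * enorm v)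
    by rewrite ler_wpM2l ?enorm_ge0.
  by rewrite -H1 H2 in H3; lra.
have qS : dot q (S *m q) <= mu * enorm q ^+ 2.
  by apply: le_trans (dot_le _ _) _; rewrite expr2 mulrCA ler_wpM2l ?enorm_ge0.
have nv' : 0 < enorm v' ^+ 2.
  by rewrite n2 ltr_wpDr ?sqr_ge0 // mulr_gt0 // exprn_gt0.
have v'0 : v' != 0 by apply: contraTneq nv' => ->; rewrite enorm0 expr0n /= ltxx.
split => //; rewrite ler_pdivrMr // -bE.
have -> : dot v' (S *m v') = s ^+ 2 * h + 2 * s * dot q (S *m v) + dot q (S *m q).
  rewrite [in LHS]v'E mulmxDr -scalemxAr !dotE -(Ssym v) (dotC _ q) -hE; ring.
have sv : s * enorm v <= enorm v'.
  rewrite -(@ler_pXn2r _ 2) ?nnegrE ?enorm_ge0 ?mulr_ge0 ?(ltW sp) ?(ltW nv) //.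
  by rewrite n2 exprMn lerDl sqr_ge0.
have qv' : enorm q <= enorm v'.
  rewrite -(@ler_pXn2r _ 2) ?nnegrE ?enorm_ge0 //.
  by rewrite n2 lerDr mulr_ge0 ?sqr_ge0.
have H6 : s * dot q (S *m v) <= s * (- enorm q ^+ 2 + enorm q * (e * enorm v)).
  by rewrite ler_pM2l.
have H7 : s * enorm v * enorm q <= enorm v' * enorm v'.
  by apply: ler_pM; rewrite ?mulr_ge0 ?enorm_ge0 // ltW.
have H8 := ler_wpM2l ep H7.
have H9 : 0 <= enorm q ^+ 2 * (2 * s + b - mu).
  by rewrite mulr_ge0 ?sqr_ge0 //; lra.
move: qS H6 H8 H9; rewrite mulrDl n2 hb -expr2 n2.
move: (enorm q) (enorm v) (dot q (S *m v)) (dot q (S *m q)) => x y X Y qS H6 H8 H9.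
lra.
Qed.

End Rayleigh.

(** * Linearized power flow *)

Section Linearization.
Context {R : realType} {m nd ng : nat}.
Let n := (nd + ng)%N.
Variables (N : network R m nd ng) (K : nat) (rho : R).
Implicit Types (g : 'cV[R]_m) (z th u v : 'cV[R]_n).

Local Notation E := (incidence N).
Local Notation B := (incidence N *m Dmat N).

(** The angle differences are weighted by the admittances, so that lines of zero
    admittance do not count. *)
Definition spread th : R := enorm (B^T *m th).

Definition linflow g th : 'cV[R]_n := B *m had g (angles N th).

(** The gradient of the objective in the angles, divided by [rho], when all load
    and all generation is shed. *)
Definition thgrad g th : 'cV[R]_n :=
  E *m had g (had (cos_flow N th) (B^T *m inflow N g th)).

Definition unit_box g := forall l, `|g l 0| <= 1.

Lemma spread_ge0 th : 0 <= spread th.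
Proof. exact: enorm_ge0. Qed.

Lemma dH_th_shed g th : dH_th N rho g (- Pinj N) th = rho *: thgrad g th.
Proof. by rewrite /dH_th /residual subrr subr0. Qed.

Lemma Dmat_coord (u : 'cV[R]_m) l : (Dmat N *m u) l 0 = admittance N 0 l * u l 0.
Proof. by rewrite /Dmat mul_diag_mx !mxE. Qed.

Lemma Dmat_had g (u : 'cV[R]_m) : Dmat N *m had g u = had g (Dmat N *m u).
Proof.
by apply/matrixP => i j; rewrite ord1 Dmat_coord !hadE Dmat_coord mulrCA.
Qed.

Lemma BT_E th : B^T *m th = Dmat N *m angles N th.
Proof. by rewrite trmx_mul /Dmat tr_diag_mx mulmxA. Qed.

Lemma BT_coord th l : (B^T *m th) l 0 = admittance N 0 l * angles N th l 0.
Proof. by rewrite BT_E Dmat_coord. Qed.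

Lemma enorm_mono p (u v : 'cV[R]_p) (c : R) : 0 <= c ->
  (forall i, `|u i 0| <= c * `|v i 0|) -> enorm u <= c * enorm v.
Proof.
move=> c0 uv; apply: enorm_leP; first by rewrite mulr_ge0 ?enorm_ge0.
rewrite exprMn enorm_sqr mulr_sumr; apply: ler_sum => i _.
rewrite -!expr2 -(real_normK (num_real (u i 0))) -(real_normK (num_real (v i 0))).
by rewrite -exprMn lerXn2r // nnegrE mulr_ge0.
Qed.

Lemma linflowE g th : linflow g th = E *m had g (B^T *m th).
Proof. by rewrite /linflow -mulmxA Dmat_had -BT_E. Qed.

Lemma linflow_sym g u v : dot (linflow g u) v = dot u (linflow g v).
Proof.
rewrite [in RHS]linflowE /linflow dot_mulmxl dot_had [RHS]dotC (dot_mulmxl E).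
by rewrite dotC.
Qed.

Lemma linflowD g u v : linflow g (u + v) = linflow g u + linflow g v.
Proof. by rewrite /linflow /angles mulmxDr hadDr mulmxDr. Qed.

Lemma linflowZ g c u : linflow g (c *: u) = c *: linflow g u.
Proof. by rewrite /linflow /angles -scalemxAr hadZr -scalemxAr. Qed.

Lemma linflowB g u v : linflow g (u - v) = linflow g u - linflow g v.
Proof. by rewrite linflowD -scaleN1r linflowZ scaleN1r. Qed.

Lemma inflowE g th : inflow N g th = E *m had g (Dmat N *m sin_flow N th).
Proof. by rewrite /inflow -mulmxA Dmat_had. Qed.

Lemma mulmx_bounded p q (M : 'M[R]_(p, q)) :
  exists2 b, 0 < b & forall x, enorm (M *m x) <= b * enorm x.
Proof. by exists (mxbound M); [exact/mxbound_gt0|exact: mxboundP]. Qed.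

Lemma had_unit_le g (u : 'cV[R]_m) : unit_box g -> enorm (had g u) <= enorm u.
Proof. by move=> g1; have := enorm_had u ler01 g1; rewrite mul1r. Qed.

Lemma spread_le : exists2 C, 0 < C & forall th, spread th <= C * enorm th.
Proof. exact: mulmx_bounded. Qed.

Lemma linflow_le : exists2 C, 0 < C & forall g th, unit_box g ->
  enorm (linflow g th) <= C * spread th.
Proof.
have [e e0 eP] := mulmx_bounded E; exists e => // g th g1.
rewrite linflowE; apply: le_trans (eP _) _; apply: ler_wpM2l; first exact: ltW.
exact: had_unit_le.
Qed.

Lemma inflow_le : exists2 C, 0 < C & forall g th, unit_box g ->
  enorm (inflow N g th) <= C * spread th.
Proof.
have [e e0 eP] := mulmx_bounded E; exists e => // g th g1.
rewrite inflowE; apply: le_trans (eP _) _; apply: ler_wpM2l; first exact: ltW.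
apply: le_trans (had_unit_le _ g1) _.
rewrite -[leRHS]mul1r; apply: enorm_mono => // l.
rewrite mul1r Dmat_coord BT_coord !normrM; apply: ler_wpM2l => //.
by have := sin_lipschitz 0 (angles N th l 0); rewrite !mxE sin0 !subr0.
Qed.

(** On a line with zero admittance both sides vanish, which is why the
    constant may use the total inverse. *)
Lemma angle_sqr_le : exists2 C : R, 0 < C & forall th l (x : R),
  angles N th l 0 ^+ 2 * `|admittance N 0 l * x|
    <= C * spread th ^+ 2 * `|admittance N 0 l * x|.
Proof.
exists (1 + \sum_l (admittance N 0 l)^-1 ^+ 2).
  by rewrite ltr_wpDr ?ltr01 // sumr_ge0 // => l _; rewrite sqr_ge0.
move=> th l x; have [->|a0] := eqVneq (admittance N 0 l) 0.
  by rewrite mul0r normr0 !mulr0.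
apply: ler_wpM2r => //.
have -> : angles N th l 0 ^+ 2 = (admittance N 0 l)^-1 ^+ 2 * `|(B^T *m th) l 0| ^+ 2.
  by rewrite real_normK ?num_real // BT_coord; field.
apply: ler_pM; rewrite ?sqr_ge0 //.
  rewrite (bigD1 l) //= addrCA lerDl addr_ge0 // sumr_ge0 // => i _.
  by rewrite sqr_ge0.
by rewrite lerXn2r ?nnegrE ?enorm_ge0 // enorm_coord.
Qed.

Lemma inflow_linear : exists2 C, 0 < C & forall g th, unit_box g ->
  enorm (inflow N g th - linflow g th) <= C * spread th ^+ 3.
Proof.
have [e e0 eP] := mulmx_bounded E; have [c c0 cP] := angle_sqr_le.
exists (e * c); first exact: mulr_gt0.
move=> g th g1; rewrite inflowE linflowE -mulmxBr -hadBr.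
apply: le_trans (eP _) _; rewrite -mulrA; apply: ler_wpM2l; first exact: ltW.
apply: le_trans (had_unit_le _ g1) _; rewrite exprSr mulrA.
apply: enorm_mono => [|l]; first by rewrite mulr_ge0 ?sqr_ge0 // ltW.
rewrite mxE [X in _ + X]mxE Dmat_coord BT_coord [sin_flow N th l 0]mxE -mulrBr
  -/(angles N th).
set t := angles N th l 0; set a := admittance N 0 l.
apply: le_trans (cP th l t); rewrite -/t -/a !normrM mulrCA; apply: ler_wpM2l => //.
apply: le_trans (sin_sub_id _) _.
by rewrite exprSr -[t ^+ 2]real_normK ?num_real.
Qed.

Lemma thgrad_linear : exists2 C, 0 < C & forall g th, unit_box g ->
  enorm (thgrad g th - linflow g (linflow g th)) <= C * spread th ^+ 3.
Proof.
have [e e0 eP] := mulmx_bounded E; have [c c0 cP] := angle_sqr_le.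
have [b b0 bP] := spread_le; have [f f0 fP] := inflow_le.
have [i i0 iP] := inflow_linear.
exists (e * (c * (b * f) + b * i)); first by rewrite !(mulr_gt0, addr_gt0).
move=> g th g1; set phi := inflow N g th; set s := spread th.
have s0 : 0 <= s by exact: spread_ge0.
have -> : thgrad g th - linflow g (linflow g th) =
    E *m had g (had (cos_flow N th) (B^T *m phi) - B^T *m phi
                + B^T *m (phi - linflow g th)).
  by rewrite [linflow g (linflow g th)]linflowE /thgrad -mulmxBr -hadBr mulmxBr
    -/phi subrKA.
apply: le_trans (eP _) _; rewrite -mulrA; apply: ler_wpM2l; first exact: ltW.
apply: le_trans (had_unit_le _ g1) _; apply: le_trans (enormD _ _) _.
rewrite mulrDl; apply: lerD; last first.
  by apply: le_trans (bP _) _; rewrite -mulrA; apply: ler_wpM2l;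
    [exact: ltW|exact: iP].
apply: (@le_trans _ _ (c * s ^+ 2 * enorm (B^T *m phi))); last first.
  have H := le_trans (bP phi) (ler_wpM2l (ltW b0) (fP _ th g1)).
  apply: le_trans (ler_wpM2l (mulr_ge0 (ltW c0) (sqr_ge0 s)) H) _.
  by rewrite le_eqVlt -/s; apply/orP; left; apply/eqP; ring.
apply: enorm_mono => [|l]; first by rewrite mulr_ge0 ?sqr_ge0 // ltW.
rewrite mxE [X in _ + X]mxE hadE BT_coord [cos_flow N th l 0]mxE.
apply: le_trans (cP th l _); set y := admittance N 0 l * _; set t := angles N th l 0.
rewrite [X in `|X|](_ : _ = (cos t - 1) * y); last by rewrite /t /angles /y; ring.
rewrite normrM; apply: ler_wpM2r => //.
exact: cos_sub1.
Qed.


Definition line_choices : set 'cV[R]_m :=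
  [set g | (forall l, g l 0 = 0 \/ g l 0 = 1) /\ m%:R - \sum_l g l 0 = K%:R].

Definition shed_set : set 'cV[R]_n :=
  [set z | [/\ forall i, 0 <= usubmx z i 0 <= - Pd N i 0,
               forall i, - Pg N i 0 <= dsubmx z i 0 <= 0 & \sum_i z i 0 = 0]].

Definition angle_box : set 'cV[R]_n :=
  [set th | forall l, - (pi / 2) <= angles N th l 0 <= pi / 2].

Definition binary g := forall l, g l 0 = 0 \/ g l 0 = 1.

Definition bool_col (b : {ffun 'I_m -> bool}) : 'cV[R]_m := \col_l (b l)%:R.

Lemma binary_bool_col g : binary g -> exists b, g = bool_col b.
Proof.
move=> bg; exists [ffun l => g l 0 == 1]; apply/matrixP => l j.
rewrite ord1 mxE ffunE; case: (bg l) => ->; last by rewrite eqxx.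
by rewrite eq_sym oner_eq0.
Qed.

Lemma binary_unit_box g : binary g -> unit_box g.
Proof. by move=> bg l; case: (bg l) => ->; rewrite ?normr0 ?normr1. Qed.

Lemma binary_dist g g' : binary g -> binary g' -> g != g' ->
  1 <= enorm (g - g') ^+ 2.
Proof.
move=> bg bg' gg'; have [l gl] : exists l, g l 0 != g' l 0.
  apply: contrapT => H; move/eqP: gg'; apply; apply/matrixP => i j.
  by rewrite ord1; apply/eqP/negPn/negP => Hi; apply: H; exists i.
have := enorm_coord (g - g') l; rewrite !mxE.
suff -> : `|g l 0 - g' l 0| = 1 by move=> H; rewrite exprn_ege1.
case: (bg l) (bg' l) gl => -> [] ->; rewrite ?eqxx // => _.
  by rewrite sub0r normrN1.
by rewrite subr0 normr1.
Qed.

Lemma angle_box_convex : convex_set angle_box.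
Proof.
move=> x y t Hx Hy t01 l.
have := Hx l; have := Hy l; rewrite anglesD /angles -scalemxAr mulmxBr.
rewrite !mxE -!/(_ + _); move: (\sum_j _) (\sum_j _) => a b.
move: t01 => /andP[t0 t1] /andP[a1 a2] /andP[b1 b2].
apply/andP; split; nra.
Qed.

Lemma shed_set_convex : convex_set shed_set.
Proof.
move=> x y t [x1 x2 x3] [y1 y2 y3] /andP[t0 t1]; split.
- move=> i; move: (x1 i) (y1 i); rewrite !mxE => /andP[? ?] /andP[? ?].
  by apply/andP; split; nra.
- move=> i; move: (x2 i) (y2 i); rewrite !mxE => /andP[? ?] /andP[? ?].
  by apply/andP; split; nra.
- under eq_bigr do rewrite !mxE; rewrite big_split /= -mulr_sumr sumrB.
  by rewrite x3 y3 subrr mulr0 addr0.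
Qed.

Lemma full_shed : shed_set (- Pinj N).
Proof.
rewrite /shed_set /= /Pinj opp_col_mx col_mxKu col_mxKd; split => [i|i|].
- by rewrite mxE lexx andbT oppr_ge0 Pd_le0.
- by rewrite mxE lexx oppr_le0 ltW // Pg_gt0.
rewrite -opp_col_mx; under eq_bigr do rewrite mxE.
by rewrite sumrN P_balanced oppr0.
Qed.

Lemma max_singular_value_ge0 p q (M : 'M[R]_(p, q)) : 0 <= max_singular_value M.
Proof.
rewrite /max_singular_value;
  have [[[s Hs] ub]|/sup_out ->] := pselect (has_sup [set s | singular_value M s]).
  by apply: le_trans (ub_le_sup ub Hs); case: Hs.
by [].
Qed.

Definition lines_lipschitz := forall z0 th0,
  lipschitz_with (L1 N rho z0 th0) (fun g' => dH_g N rho g' z0 th0) setT.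
Definition angles_lipschitz := forall g0 z0,
  lipschitz_with (L3 N rho g0 z0) (fun th' => dH_th N rho g0 z0 th') setT.

(** Test the Lipschitz bound of the gradient on the basis vector of the line
    [l]: up to [rho], the squared flow of that line alone is a diagonal entry of
    the Hessian, and a bus at an end of the line sees all of it. *)
Lemma line_le_L1 z th l : 0 < rho -> lines_lipschitz ->
  rho * (admittance N 0 l * sin (angles N th l 0)) ^+ 2 <= L1 N rho z th.
Proof.
move=> rho0 lip; pose e : 'cV[R]_m := delta_mx l 0; pose w := inflow N e th.
have e1 : enorm e = 1.
  apply/eqP; rewrite -(@eqrXn2 _ 2) ?enorm_ge0 // enorm_sqr dot_deltal mxE.
  by rewrite !eqxx expr1n.
have := lip z th e 0 I I; rewrite subr0 e1 mulr1 => H.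
have wl : w (ends N l).1 0 = admittance N 0 l * sin (angles N th l 0).
  rewrite /w inflowE mxE (bigD1 l) //= big1 ?addr0 => [|j jl].
    rewrite hadE Dmat_coord !mxE !eqxx mul1r (negbTE (ends_neq N l)) subr0 mul1r.
    by [].
  by rewrite hadE [e j 0]mxE (negbTE jl) mul0r mulr0.
have dE : dot (dH_g N rho e z th - dH_g N rho 0 z th) e = rho * enorm w ^+ 2.
  rewrite /dH_g -scalerBr dotZl -hadBr -mulmxBr /residual opprB addrA subrK.
  have -> : inflow N 0 th = 0 by rewrite /inflow hadC had0r mulmx0.
  by rewrite subr0 -/w dot_had hadC dotC -(dot_mulmxl B) enorm_sqr.
apply: le_trans (_ : rho * enorm w ^+ 2 <= _); last first.
  by rewrite -dE; apply: le_trans (dot_le _ _) _; rewrite e1 mulr1.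
rewrite ler_pM2l // -wl -[leLHS]real_normK ?num_real //.
by rewrite lerXn2r ?nnegrE ?enorm_ge0 // enorm_coord.
Qed.

(** The step-size constant of the line variables vanishes only together with
    the angle differences on the lines of nonzero admittance. *)
Lemma spread_le_L1 : 0 < rho -> lines_lipschitz -> exists2 C, 0 < C &
  forall z th, angle_box th -> spread th ^+ 2 <= C * L1 N rho z th.
Proof.
move=> rho0 lip; exists (1 + m%:R * (4 / rho)).
  by rewrite ltr_wpDr ?ltr01 // mulr_ge0 // divr_ge0 // ltW.
move=> z th Hth.
have H l : (B^T *m th) l 0 ^+ 2 <= 4 / rho * L1 N rho z th.
  rewrite BT_coord exprMn; have := line_le_L1 z th l rho0 lip.
  have := half_le_sin (Hth l); set t := angles N th l 0; set a := admittance N 0 l.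
  move=> H1 H2; have H3 : (`|t| / 2) ^+ 2 <= `|sin t| ^+ 2.
    by rewrite lerXn2r // nnegrE // divr_ge0.
  move: H3; rewrite exprMn !real_normK ?num_real // => H3.
  have H4 := ler_wpM2l (sqr_ge0 a) H3.
  rewrite [leRHS]mulrAC ler_pdivlMr //.
  have H5 : rho * (a ^+ 2 * (t ^+ 2 * 2^-1 ^+ 2)) <= rho * (a ^+ 2 * sin t ^+ 2).
    by rewrite ler_pM2l.
  by move: H2; rewrite exprMn; lra.
have L0 : 0 <= L1 N rho z th by rewrite mulr_ge0 ?max_singular_value_ge0 // ltW.
apply: le_trans (_ : m%:R * (4 / rho) * L1 N rho z th <= _); last first.
  by apply: ler_wpM2r => //; rewrite lerDr.
rewrite /spread enorm_sqr -mulrA mulr_natl -[X in _ *+ X](card_ord m) -sumr_const.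
by apply: ler_sum => l _; rewrite -expr2.
Qed.

(** Rescaling toward the interior point 0 of the box turns the linear error
    bound into one for the box. *)
Lemma linflow_error_bound (Mb : R) : exists2 C, 0 < C &
  forall g, binary g -> forall th, angle_box th -> enorm th <= Mb ->
  exists q, [/\ angle_box q, linflow g q = 0 &
    enorm (th - q) <= C * enorm (linflow g th)].
Proof.
pose P (b : {ffun 'I_m -> bool}) (C : R) := forall th, angle_box th ->
  enorm th <= Mb ->
  exists q, [/\ angle_box q, linflow (bool_col b) q = 0 &
    enorm (th - q) <= C * enorm (linflow (bool_col b) th)].
suff [C C0 HC] : exists2 C, 0 < C & forall b, P b C.
  by exists C => // g /binary_bool_col[b ->]; exact: HC.
apply: finite_uniform => [b C C' CC' HC th H1 H2|b].
  have [q [? ? H]] := HC th H1 H2; exists q; split => //.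
  by apply: le_trans H _; apply: ler_wpM2r => //; exact: enorm_ge0.
set g := bool_col b.
have [M ME] : exists M, forall u, linflow g u = M *m u.
  exists (B *m diag_mx g^T *m E^T) => u; rewrite /linflow -!mulmxA.
  by rewrite diag_mx_had.
have [X MXM] := generalized_inverse M.
have [x x0 xP] := mulmx_bounded X; have [mu mu0 muP] := mulmx_bounded M;
  have [e e0 eP] := mulmx_bounded E^T.
exists (x * (1 + e * (Mb + x * (mu * Mb)))) => th Hth thMb.
have Mb0 : 0 <= Mb by apply: le_trans thMb; exact: enorm_ge0.
have pi1 := pihalf_ge1 R; have pi0 : 0 < pi / 2 :> R by lra.
pose eta := enorm (X *m (M *m th)); have eta0 : 0 <= eta by exact: enorm_ge0.
have etaM : eta <= x * enorm (M *m th) by exact: xP.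
have etaMb : eta <= x * (mu * Mb).
  apply: le_trans etaM _; apply: ler_wpM2l; first exact: ltW.
  by apply: le_trans (muP _) _; apply: ler_wpM2l => //; exact: ltW.
pose q0 := th - X *m (M *m th); pose s := pi / 2 + e * eta.
have s0 : 0 < s by rewrite ltr_wpDr // mulr_ge0 // ltW.
have Mq0 : M *m q0 = 0 by rewrite /q0 mulmxBr !mulmxA MXM subrr.
have q0n : enorm q0 <= Mb + x * (mu * Mb).
  by apply: le_trans (enormB _ _) _; apply: lerD.
exists ((pi / 2 / s) *: q0); split.
- move=> l; rewrite /angles -scalemxAr mxE -/(angles N q0) -ler_norml normrM.
  rewrite ger0_norm; last by rewrite divr_ge0 ?ltW.
  rewrite mulrAC ler_pdivrMr //; apply: ler_wpM2l; first exact: ltW.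
  rewrite /q0 /angles mulmxBr mxE; apply: le_trans (ler_normD _ _) _.
  rewrite /s; apply: lerD; first by rewrite ler_norml; exact: Hth.
  rewrite mxE normrN; apply: le_trans (enorm_coord _ _) _; exact: eP.
- by rewrite ME -scalemxAr Mq0 scaler0.
rewrite ME; apply: le_trans (enorm_tri q0 _ _) _.
have -> : th - q0 = X *m (M *m th) by rewrite /q0 opprB addrC subrK.
have -> : q0 - (pi / 2 / s) *: q0 = (e * eta / s) *: q0.
  rewrite -[X in X - _]scale1r -scalerBl; congr (_ *: _).
  by rewrite -{1}(divff (_ : s != 0)) ?gt_eqF // -mulrBl /s addrAC subrr add0r.
rewrite enormZ ger0_norm; last by rewrite divr_ge0 ?mulr_ge0 // ltW.
rewrite -/eta mulrAC; apply: (@le_trans _ _ (eta * (1 + e * (Mb + x * (mu * Mb))))).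
  rewrite mulrDr mulr1; apply: lerD => //.
  have s1 : 1 <= s by rewrite /s; have := mulr_ge0 (ltW e0) eta0; lra.
  rewrite ler_pdivrMr // (mulrC e) -mulrA -[leLHS]mulr1; apply: ler_pM => //.
    by rewrite !mulr_ge0 ?enorm_ge0 // ltW.
  apply: ler_wpM2l => //; apply: ler_wpM2l => //; exact: ltW.
rewrite mulrAC; apply: ler_wpM2r => //.
by rewrite addr_ge0 // !(mulr_ge0, addr_ge0) // ltW.
Qed.

(** The step-size constant of the angles when everything is shed, which is the
    least one for the lines [g]. *)
Definition stiffness g := L3 N rho g (- Pinj N).

Lemma stiffness_ge0 g : 0 < rho -> 0 <= stiffness g.
Proof.
move=> rho0; rewrite /stiffness /L3 mulr_ge0 //.
  by rewrite mulr_ge0 ?sqr_ge0 // ltW.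
by rewrite addr_ge0 ?enorm_ge0 // mulr_ge0 // max_singular_value_ge0.
Qed.

Lemma stiffness_le_L3 g z : 0 < rho -> stiffness g <= L3 N rho g z.
Proof.
move=> rho0; rewrite /stiffness /L3 /= subrr mulmx0 enorm0 addr0; apply: ler_wpM2l.
  by rewrite mulr_ge0 ?sqr_ge0 // ltW.
by rewrite lerDl enorm_ge0.
Qed.

(** There are finitely many choices of lines. *)
Lemma stiffness_gap : 0 < rho -> exists2 c, 0 < c &
  forall g, binary g -> stiffness g = 0 \/ c <= stiffness g.
Proof.
move=> rho0; have [|c c0 H] := @finite_gap R _ (fun b => stiffness (bool_col b)).
  by move=> b; exact: stiffness_ge0.
by exists c => // g /binary_bool_col[b ->].
Qed.

Lemma sin_flow0 : sin_flow N 0 = 0.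
Proof. by rewrite /sin_flow mulmx0; apply/matrixP => i j; rewrite !mxE sin0. Qed.

Lemma inflow0 g : inflow N g 0 = 0.
Proof. by rewrite /inflow sin_flow0 had0r mulmx0. Qed.

(** When everything is shed the gradient in the angles is constant, hence zero
    as it vanishes at zero angles; so the flow is zero whatever the angles are,
    and the objective does not depend on the angles for any [z]. *)
Lemma no_stiffness g z th : 0 < rho -> angles_lipschitz -> stiffness g = 0 ->
  dH_th N rho g z th = 0.
Proof.
move=> rho0 lip g0.
have grad0 u : dH_th N rho g (- Pinj N) u = 0.
  have := lip g (- Pinj N) u 0 I I; rewrite -/(stiffness g) g0 mul0r.
  rewrite [dH_th N rho g _ 0]dH_th_shed /thgrad inflow0 mulmx0 !had0r mulmx0
    scaler0 subr0.
  by move=> H; apply: enorm_eq0; apply/eqP; rewrite eq_le H enorm_ge0.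
have flow0 u : inflow N g u = 0.
  have lip0 : lipschitz_with 0 (fun u => dH_th N rho g (- Pinj N) u) setT.
    by move=> a b _ _; rewrite !grad0 subrr enorm0 mul0r.
  have := descent 0 u (expands_th N rho g (- Pinj N)) lip0.
  rewrite grad0 dot0l !mul0r !addr0 !HrhoE /residual inflow0 subrr !subr0 enorm0
    expr0n /= mulr0 addr0.
  rewrite gerDl => H; apply: enorm_eq0; apply/eqP;
    rewrite -sqrf_eq0 eq_le sqr_ge0 andbT.
  by rewrite -(@pmulr_rle0 _ (rho / 2)) // divr_gt0.
rewrite -(expands_grad (expands_th N rho g z th)); apply: expands_grad.
exists 0 => h _; rewrite !HrhoE /residual !flow0 subrr dot0l subrr normr0 mul0r.
by [].
Qed.

(** The Lipschitz bound between 0 and [t u], divided by [t], in the limit of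
    small [t]. *)
Lemma linflow_norm g u : 0 < rho -> angles_lipschitz -> binary g ->
  rho * enorm (linflow g (linflow g u)) <= stiffness g * enorm u.
Proof.
move=> rho0 lip /binary_unit_box g1.
have [C C0 HC] := thgrad_linear; have s0 := spread_ge0 u.
apply/ler_addgt0Pr => e e0.
pose D := rho * (C * spread u ^+ 3); have D0 : 0 <= D.
  by rewrite !mulr_ge0 ?exprn_ge0 // ltW.
pose t := Num.min 1 (e / (D + 1)).
have t0 : 0 < t by rewrite lt_min ltr01 divr_gt0 // ltr_wpDl.
have t1 : t <= 1 by rewrite ge_min lexx.
have te : t * D <= e.
  apply: (@le_trans _ _ (e / (D + 1) * (D + 1)));
    last by rewrite divfK // gt_eqF // ltr_wpDl.
  by apply: ler_pM => //; [exact: ltW|rewrite ge_min lexx orbT|rewrite lerDl].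
have H1 : rho * enorm (thgrad g (t *: u)) <= stiffness g * (t * enorm u).
  have := lip g (- Pinj N) (t *: u) 0 I I; rewrite subr0 -/(stiffness g).
  rewrite [dH_th N rho g _ 0]dH_th_shed /thgrad inflow0 mulmx0 !had0r mulmx0
    scaler0 subr0.
  by rewrite dH_th_shed !enormZ (ger0_norm (ltW rho0)) (ger0_norm (ltW t0)).
have H2 : enorm (thgrad g (t *: u) - t *: linflow g (linflow g u)) <=
  C * (t * spread u) ^+ 3.
  have := HC g (t *: u) g1; rewrite !linflowZ.
  by rewrite [spread _]/spread -scalemxAr enormZ (ger0_norm (ltW t0)).
have H3 := enorm_leD (t *: linflow g (linflow g u)) (thgrad g (t *: u)).
move: H3; rewrite enormC enormZ (ger0_norm (ltW t0)) => H3.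
have H4 : t * (t * D) <= t * e by rewrite (ler_pM2l t0).
have H5 : rho * (C * (t * spread u) ^+ 3) <= t * (t * D).
  rewrite exprMn /D (_ : rho * _ = t ^+ 2 * (rho * (C * spread u ^+ 3)) * t);
    last by ring.
  rewrite (_ : t * (t * _) = t ^+ 2 * (rho * (C * spread u ^+ 3)) * 1); last by ring.
  by apply: ler_wpM2l; rewrite // mulr_ge0 ?sqr_ge0.
rewrite -(ler_pM2l t0).
have H6 := ler_wpM2l (ltW rho0) (le_trans H3 (lerD (lexx _) H2)).
lra.
Qed.

End Linearization.

(** * Steps in the angles and in the shed power *)

Section LocalAnalysis.
Context {R : realType} {m nd ng : nat}.
Let n := (nd + ng)%N.
Variables (N : network R m nd ng) (rho : R).
Implicit Types (g : 'cV[R]_m) (z th u v : 'cV[R]_n).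

Lemma thgrad_le : exists2 C, 0 < C & forall g th, unit_box g ->
  enorm (thgrad N g th) <= C * enorm (inflow N g th).
Proof.
have [e e0 eP] := mulmx_bounded (incidence N).
have [b b0 bP] := mulmx_bounded (incidence N *m Dmat N)^T.
exists (e * b) => [|g th g1]; first exact: mulr_gt0.
apply: le_trans (eP _) _; rewrite -mulrA; apply: ler_wpM2l; first exact: ltW.
apply: le_trans (had_unit_le _ g1) _; apply: le_trans (bP _).
rewrite -[leRHS]mul1r; apply: enorm_had => // l.
by rewrite mxE cos_max.
Qed.

(** When the spread is of the order of the flow, the flow is linear up to cubic
    errors.  The variational inequality of the step, tested with a point [q] of
    zero linear flow at distance of the order of the flow, then shows that the
    step cannot be much shorter than the flow.  The factor [kappa] must not
    depend on the bound [C] on the spread: this is what lets a bound on the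
    spread be propagated backwards in time. *)
Lemma projected_step_error_bound (Mb chi : R) : 0 < rho -> 0 < chi ->
  exists2 kappa, 0 < kappa & forall C : R, exists2 e0 : R, 0 < e0 &
  forall g th th' (c : R), binary g -> angle_box N th -> enorm th <= Mb ->
  0 < c -> c <= chi ->
  (forall y, angle_box N y ->
     dot (rho *: thgrad N g th + c *: (th' - th)) (th' - y) <= 0) ->
  spread N th <= C * enorm (inflow N g th) -> enorm (inflow N g th) <= e0 ->
  kappa * enorm (inflow N g th) <= enorm (th' - th).
Proof.
move=> rho0 chi0; have [c4 c40 H4] := linflow_error_bound N Mb.
have [c5 c50 H5] := inflow_linear N; have [c6 c60 H6] := thgrad_linear N.
have [cg cg0 Hg] := thgrad_le.
have CG : 0 < rho * cg + chi * (2 * c4) by rewrite addr_gt0 // !mulr_gt0.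
exists (rho / 4 / (rho * cg + chi * (2 * c4))); first by rewrite !divr_gt0.
move=> C; pose C3 := `|C| ^+ 3; have C30 : 0 <= C3 by exact: exprn_ge0.
(* [F ^ 2 * D <= 1] keeps the cubic errors below a quarter of the flow *)
pose D := 4 * c5 * C3 + 8 * c4 * c6 * C3 + 1.
have D1 : 0 <= 4 * c5 * C3 by rewrite !mulr_ge0 // ltW.
have D2 : 0 <= 8 * c4 * c6 * C3 by rewrite !mulr_ge0 // ltW.
have D0 : 0 < D by rewrite /D; lra.
exists (Num.min 1 D^-1); first by rewrite lt_min ltr01 invr_gt0.
move=> g th th' c bg Hth thMb c0 cchi VI sC; rewrite le_min => /andP[F1 FD].
have g1 := binary_unit_box bg; move: sC F1 FD.
set F := enorm (inflow N g th) => sC F1 FD; have F0 : 0 <= F by exact: enorm_ge0.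
set s := spread N th in sC; have s0 : 0 <= s by exact: spread_ge0.
have s3 : s ^+ 3 <= C3 * F ^+ 3.
  rewrite -exprMn lerXn2r ?nnegrE ?mulr_ge0 //; apply: le_trans sC _.
  by apply: ler_wpM2r => //; exact: ler_norm.
have FD2 : F ^+ 2 * D <= 1.
  rewrite -(ler_pdivlMr _ _ D0) mul1r; apply: le_trans FD.
  by rewrite expr2 ler_piMr.
have [q [Hq Aq tq]] := H4 g bg th Hth thMb.
set a := linflow N g th in tq; set G := thgrad N g th.
have e5 : enorm (inflow N g th - a) <= F / 4.
  apply: le_trans (H5 g th g1) _; rewrite -/s.
  apply: le_trans (ler_wpM2l (ltW c50) s3) _.
  have : F ^+ 2 * (4 * c5 * C3) <= 1.
    by apply: le_trans FD2; rewrite ler_wpM2l ?sqr_ge0 // /D; lra.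
  by move/(ler_wpM2r F0); rewrite mul1r => H;
    rewrite (_ : F ^+ 3 = F ^+ 2 * F) ?exprSr //; lra.
have aF1 : F <= 4 / 3 * enorm a.
  by have := enorm_leD (inflow N g th) a; rewrite -/F; lra.
have aF2 : enorm a <= 5 / 4 * F.
  by have := enorm_leD a (inflow N g th); rewrite enormC -/F; lra.
have tq2 : enorm (th - q) <= 2 * c4 * F.
  apply: le_trans tq _; rewrite -mulrA mulrCA; apply: ler_wpM2l; first exact: ltW.
  by lra.
have e6 : enorm (th - q) * enorm (G - linflow N g a) <= F ^+ 2 / 4.
  apply: (@le_trans _ _ ((2 * c4 * F) * (c6 * (C3 * F ^+ 3)))).
    apply: ler_pM; rewrite ?enorm_ge0 //; apply: le_trans (H6 g th g1) _.
    by apply: ler_wpM2l => //; exact: ltW.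
  have : F ^+ 2 * (8 * c4 * c6 * C3) <= 1.
    by apply: le_trans FD2; rewrite ler_wpM2l ?sqr_ge0 // /D; lra.
  move/(ler_wpM2r (sqr_ge0 F)); rewrite mul1r => H.
  by rewrite (_ : F ^+ 3 = F ^+ 2 * F) ?exprSr //; lra.
have dG : F ^+ 2 / 4 <= dot G (th - q).
  have -> : G = linflow N g a + (G - linflow N g a) by rewrite addrC subrK.
  rewrite dotDl linflow_sym linflowB Aq subr0 -/a -enorm_sqr.
  have := dot_ge (th - q) (G - linflow N g a); rewrite (dotC (th - q)) => H.
  have H7 : F ^+ 2 <= (4 / 3 * enorm a) ^+ 2.
    by rewrite lerXn2r ?nnegrE // mulr_ge0 ?enorm_ge0.
  by have := sqr_ge0 F; move: H7;
    rewrite exprMn (_ : (4 / 3) ^+ 2 = 16 / 9 :> R); [lra|field].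
have [F00|Fp] := eqVneq F 0; first by rewrite F00 mulr0 enorm_ge0.
have {}Fp : 0 < F by rewrite lt0r Fp.
have := VI q Hq; set p := th' - th.
rewrite (_ : th' - q = (th - q) + p); last by rewrite /p [RHS]addrC subrKA.
rewrite dotDl !(dotDr (th - q) p) !dotZl -/G -enorm_sqr => V.
have H8 := dot_ge G p; have H9 := dot_ge p (th - q); have H10 := Hg g th g1.
have p0 := enorm_ge0 p.
have H11 : rho * (F ^+ 2 / 4) <= enorm p * (rho * (cg * F) + c * (2 * c4 * F)).
  have cp : 0 <= c * enorm p ^+ 2 by rewrite mulr_ge0 ?sqr_ge0 // ltW.
  have I1 : rho * (F ^+ 2 / 4) <= rho * dot G (th - q) by rewrite ler_pM2l.
  have I2 : - (rho * dot G p) <= rho * (cg * F * enorm p).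
    rewrite -mulrN ler_pM2l //; apply: le_trans (ler_wpM2r p0 H10).
    by rewrite lerNl.
  have I3 : - (c * dot p (th - q)) <= c * (enorm p * (2 * c4 * F)).
    rewrite -mulrN ler_pM2l //; apply: le_trans (ler_wpM2l p0 tq2).
    by rewrite lerNl.
  by lra.
have H12 : enorm p * (rho * (cg * F) + c * (2 * c4 * F)) <=
   enorm p * ((rho * cg + chi * (2 * c4)) * F).
  apply: ler_wpM2l => //.
  have : c * (2 * c4 * F) <= chi * (2 * c4 * F)
    by rewrite ler_wpM2r // !mulr_ge0 // ltW.
  by lra.
rewrite mulrAC ler_pdivrMr // -(ler_pM2r Fp).
by have := le_trans H11 H12; lra.
Qed.

(** The loads and the generators balance and have opposite signs, so the loads
    make up half of the sum of absolute values. *)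
Lemma shed_norm z : shed_set N z ->
  enorm (Pinj N + z) <= - 2 * dot (load_ones : 'cV[R]_n) (Pinj N + z).
Proof.
move=> [z1 z2 z3]; apply: le_trans (enorm_le_sum _) _.
have tot : \sum_i (Pinj N + z) i 0 = 0.
  under eq_bigr do rewrite mxE; rewrite big_split /= z3 addr0.
  exact: P_balanced.
move: tot; rewrite !big_split_ord /= -[X in dot _ X](vsubmxK (Pinj N + z)).
rewrite /load_ones dot_col_mx dot0l addr0 => tot.
have -> : dot (const_mx 1) (usubmx (Pinj N + z)) =
  \sum_(i < nd) (Pinj N + z) (lshift ng i) 0.
  by apply: eq_bigr => i _; rewrite !mxE mul1r.
have -> : \sum_(i < nd) `|(Pinj N + z) (lshift ng i) 0| =
    - \sum_(i < nd) (Pinj N + z) (lshift ng i) 0.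
  rewrite -sumrN; apply: eq_bigr => i _; rewrite ler0_norm // mxE /Pinj col_mxEu.
  by have := z1 i; rewrite mxE; lra.
have -> : \sum_(i < ng) `|(Pinj N + z) (rshift nd i) 0| =
    \sum_(i < ng) (Pinj N + z) (rshift nd i) 0.
  apply: eq_bigr => i _; rewrite ger0_norm // mxE /Pinj col_mxEd.
  by have := z2 i; rewrite mxE; lra.
by lra.
Qed.

(** Shedding everything is strictly optimal when no line carries power, and the
    proximal step identifies this vertex exactly. *)
Lemma full_shed_step g z z' th (b : R) : 0 < rho -> shed_set N z' ->
  (forall y, shed_set N y ->
     dot (dH_z N rho g z th + b *: (z' - z)) (z' - y) <= 0) ->
  rho * enorm (inflow N g th) + `|rho - b| * enorm (z' - z) < 1 / 2 ->
  z' = - Pinj N.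
Proof.
move=> rho0 Hz' VI small.
have := VI _ (full_shed N); rewrite opprK (addrC z' (Pinj N)).
set y := Pinj N + z'; have [y0|yn0] := eqVneq y 0.
  by move=> _; apply/eqP; rewrite -addr_eq0 addrC -/y y0.
have yp : 0 < enorm y by rewrite enorm_gt0.
have -> : dH_z N rho g z th + b *: (z' - z) =
    rho *: y - load_ones - rho *: inflow N g th - (rho - b) *: (z' - z).
  rewrite /dH_z /residual /y; apply/matrixP => i j; rewrite !mxE; ring.
move=> H; exfalso.
have := shed_norm Hz'; rewrite -/y => H1.
move: H; rewrite !dotBl !dotZl -enorm_sqr => H.
have H2 := dot_le (inflow N g th) y; have H3 := CauchySchwarz (z' - z) y.
have H4 : (rho - b) * dot (z' - z) y <= `|rho - b| * (enorm (z' - z) * enorm y).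
  by apply: le_trans (ler_norm _) _; rewrite normrM ler_wpM2l.
have H5 : rho * dot (inflow N g th) y <= rho * (enorm (inflow N g th) * enorm y).
  by rewrite ler_pM2l.
have H6 : 0 <= rho * enorm y ^+ 2 by rewrite mulr_ge0 ?sqr_ge0 // ltW.
move: small; rewrite -(ltr_pM2r yp) => H7.
lra.
Qed.

(** Locally a box is a cone around each of its points: a constraint that is inactive at
    [th0] has a positive margin, the least of which determines [eps], and an
    active one is preserved by nonnegative combinations. *)
Lemma angle_box_cone th0 : angle_box N th0 -> exists2 eps : R, 0 < eps &
  forall v v' (a b : R), angle_box N (th0 + v) -> angle_box N (th0 + v') ->
  enorm v <= eps -> enorm v' <= eps -> 0 <= a <= 2 -> 0 <= b <= 2 ->
  angle_box N (th0 + (a *: v + b *: v')).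
Proof.
move=> H0; have [e e0 eP] := mulmx_bounded (incidence N)^T.
have pi1 := pihalf_ge1 R.
have [|c c0 Hc] := @finite_gap R _ (fun l => pi / 2 - `|angles N th0 l 0|).
  by move=> l; rewrite subr_ge0 ler_norml.
exists (Num.min c (pi / 2) / (4 * e)).
  by rewrite divr_gt0 ?mulr_gt0 // lt_min c0; lra.
move=> v v' a b Hv Hv' vs vs' /andP[a0 a2] /andP[b0 b2] l.
have cc : forall w, enorm w <= Num.min c (pi / 2) / (4 * e) ->
    4 * `|angles N w l 0| <= Num.min c (pi / 2).
  move=> w; rewrite ler_pdivlMr ?mulr_gt0 // => H; apply: le_trans H.
  have := le_trans (enorm_coord _ l) (eP w); rewrite -/(angles N w); lra.
move: (cc v vs) (cc v' vs'); rewrite !le_min => /andP[v1 v2] /andP[v1' v2'].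
move: (Hv l) (Hv' l) (H0 l) (Hc l); rewrite !angles_coordD !angles_coordZ.
move: v1 v2 v1' v2'.
move: (angles N th0 l 0) (angles N v l 0) (angles N v' l 0) => x y y' v1 v2 v1' v2'.
have ay : `|a * y| <= 2 * `|y| by rewrite normrM ger0_norm // ler_wpM2r.
have by' : `|b * y'| <= 2 * `|y'| by rewrite normrM ger0_norm // ler_wpM2r.
move=> /andP[x1 x2] /andP[x3 x4] /andP[x5 x6] gap.
move: ay by'; rewrite !ler_norml => /andP[? ?] /andP[? ?].
case: gap => [|gap]; last first.
  by have := ler_norm x; have := ler_norm (- x); rewrite normrN => *; apply/andP;
    split; lra.
case: (leP 0 x) => [x0|x0]; [rewrite ger0_norm //|rewrite ltr0_norm //] => xE.
  have y0 : y <= 0 by lra. have y0' : y' <= 0 by lra.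
  have ay0 : a * y <= 0 by rewrite mulr_ge0_le0.
  have by0 : b * y' <= 0 by rewrite mulr_ge0_le0.
  by apply/andP; split; lra.
have y0 : 0 <= y by lra. have y0' : 0 <= y' by lra.
have ay0 := mulr_ge0 a0 y0; have by0 := mulr_ge0 b0 y0'.
by apply/andP; split; lra.
Qed.

End LocalAnalysis.

(** * The lines cannot switch infinitely often *)

Lemma finite_drops (R : realType) (u : nat -> R) (c : R) (K0 : nat) : 0 < c ->
  (forall k, (K0 <= k)%N -> u k.+1 <= u k) -> (forall k, (K0 <= k)%N -> 0 <= u k) ->
  exists M, forall k, (M <= k)%N -> u k - c < u k.+1.
Proof.
move=> c0 mono pos; apply: contrapT => H.
have drop M : exists2 k, (M <= k)%N & u k.+1 <= u k - c.
  apply: contrapT => HM; apply: H; exists M => k Mk; rewrite ltNge; apply/negP => Hk.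
  by apply: HM; exists k.
have le i j : (K0 <= i)%N -> (i <= j)%N -> u j <= u i.
  move=> K0i /subnK <-; elim: (j - i)%N => [|p IH]; first by rewrite add0n.
  by rewrite addSn; apply: le_trans IH; apply: mono;
    rewrite (leq_trans K0i) // leq_addl.
have many p : exists2 k, (K0 <= k)%N & u k <= u K0 - p%:R * c.
  elim: p => [|p [k K0k uk]]; first by exists K0; rewrite // mul0r subr0.
  have [j kj uj] := drop k; exists j.+1; first exact: leq_trans (leq_trans K0k kj) _.
  by apply: le_trans uj _; have := le _ _ K0k kj; rewrite -natr1; lra.
have [k K0k] := many (Num.truncn (u K0 / c)).+1.
have := pos k K0k; have := real_truncnS_gt (num_real (u K0 / c)).
rewrite ltr_pdivrMr //; lra.
Qed.

(** The situation that infinitely many switches would lead to: everything is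
    shed, and the flow [F] tends to zero.  Here [F'] is the flow after the lines
    are updated and before the angles are. *)
Section FullyShed.
Context {R : realType} {m nd ng : nat}.
Let n := (nd + ng)%N.
Variables (N : network R m nd ng) (rho r3 Mb clo chi cf c8 : R).
Variables (g : nat -> 'cV[R]_m) (th : nat -> 'cV[R]_n) (c : nat -> R).
Local Notation F k := (enorm (inflow N (g k) (th k))).
Local Notation F' k := (enorm (inflow N (g k.+1) (th k))).
Local Notation p k := (enorm (th k.+1 - th k)).
Hypothesis rho0 : 0 < rho.
Hypothesis r31 : 1 < r3.
Hypothesis lip3 : angles_lipschitz N rho.
Hypothesis bg : forall k, binary (g k).
Hypothesis box : forall k, angle_box N (th k).
Hypothesis thMb : forall k, enorm (th k) <= Mb.
Hypothesis clo0 : 0 < clo.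
Hypothesis c_ge : forall k, clo <= c k.
Hypothesis c_le : forall k, c k <= chi.
Hypothesis cE : forall k, c k = r3 * stiffness N rho (g k.+1).
Hypothesis VI : forall k y, angle_box N y ->
  dot (rho *: thgrad N (g k.+1) (th k) + c k *: (th k.+1 - th k)) (th k.+1 - y) <= 0.
Hypothesis cf0 : 0 < cf.
Hypothesis dec_g : forall k, g k.+1 != g k ->
  F k != 0 /\ cf * spread N (th k) ^+ 2 <= F k ^+ 2 - F' k ^+ 2.
Hypothesis c80 : 0 < c8.
Hypothesis dec_th : forall k, c8 * p k ^+ 2 <= F' k ^+ 2 - F k.+1 ^+ 2.
Hypothesis F_small : forall e, 0 < e -> exists M, forall k, (M <= k)%N -> F k <= e.
Hypothesis flips : forall M, exists2 k, (M <= k)%N & g k.+1 != g k.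

Let c_gt0 k : 0 < c k := lt_le_trans clo0 (c_ge k).
Let chi0 : 0 < chi := lt_le_trans (c_gt0 0) (c_le 0).
Let ub k : unit_box (g k) := binary_unit_box (bg k).
Let F0 k : 0 <= F k := enorm_ge0 _.
Let F'0 k : 0 <= F' k := enorm_ge0 _.
Let s0 k : 0 <= spread N (th k) := spread_ge0 _ _.

Let F'F k : F' k <= F k.
Proof.
have [->//|flip] := eqVneq (g k.+1) (g k).
have [_ H] := dec_g flip; rewrite -(@ler_pXn2r _ 2) ?nnegrE //.
by have := mulr_ge0 (ltW cf0) (sqr_ge0 (spread N (th k))); lra.
Qed.

Let FF' k : F k.+1 <= F' k.
Proof.
rewrite -(@ler_pXn2r _ 2) ?nnegrE //.
by have := mulr_ge0 (ltW c80) (sqr_ge0 (p k)); have := dec_th k; lra.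
Qed.

Let F_mono i j : (i <= j)%N -> F j <= F i.
Proof.
move=> /subnK <-; elim: (j - i)%N => [|q IH]; first by rewrite add0n.
by rewrite addSn; apply: le_trans IH; exact: le_trans (FF' _) (F'F _).
Qed.

Let F_gt0 k : 0 < F k.
Proof.
have [j kj flip] := flips k; apply: lt_le_trans (F_mono kj).
by have [H _] := dec_g flip; rewrite lt0r H enorm_ge0.
Qed.

Lemma step_le_flow : exists2 C, 0 < C & forall k, p k <= C * F' k.
Proof.
have [C C0 HC] := thgrad_le N; exists (rho * C / clo);
  first by rewrite divr_gt0 ?mulr_gt0.
move=> k; have := VI k (box k); rewrite dotDl !dotZl -enorm_sqr => H.
have G := HC _ (th k) (ub k.+1); have p0 := enorm_ge0 (th k.+1 - th k).
have := dot_ge (thgrad N (g k.+1) (th k)) (th k.+1 - th k) => D.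
have I1 : c k * p k ^+ 2 <= rho * (C * F' k * p k).
  have : - (rho * dot (thgrad N (g k.+1) (th k)) (th k.+1 - th k)) <=
    rho * (C * F' k * p k).
    rewrite -mulrN ler_pM2l //; apply: le_trans (ler_wpM2r p0 G).
    by rewrite lerNl.
  by lra.
have [->|pn] := eqVneq (p k) 0.
  by rewrite !mulr_ge0 ?invr_ge0 // ltW.
have pp : 0 < p k by rewrite lt0r pn.
rewrite mulrAC ler_pdivlMr // mulrC -(ler_pM2r pp).
apply: le_trans (_ : c k * p k ^+ 2 <= _); last by apply: le_trans I1 _; lra.
by rewrite -mulrA -expr2 ler_wpM2r ?sqr_ge0.
Qed.

Lemma spread_lipschitz : exists2 C, 0 < C & forall u v,
  spread N u <= spread N v + C * enorm (u - v).
Proof.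
have [C C0 HC] := spread_le N; exists C => // u v.
rewrite /spread; apply: le_trans (enorm_leD _ ((incidence N *m Dmat N)^T *m v)) _.
by rewrite lerD2l -mulmxBr; exact: HC.
Qed.

(** At a switch the decrease of the flow dominates the spread.  From there the
    bound on the spread goes backwards in time: one step back it holds with a
    worse constant [c3], which the error bound tolerates; the error bound makes
    the step at most a multiple of the decrease of the flow, and this telescopes
    to the bound with the original constant [c2]. *)
Lemma eventually_geometric : exists (C : R) (M : nat), 0 < C /\
  forall k, (M <= k)%N ->
  [/\ spread N (th k) <= C * F k, p k <= C * (F k - F k.+1)
    & F k <= C * (F k - F k.+1)].
Proof.
have [kap kap0 EB] := projected_step_error_bound N Mb rho0 chi0.
have [c7 c70 H7] := step_le_flow; have [cs cs0 Hs] := spread_lipschitz.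
have [ci ci0 Hi] := inflow_le N.
(* [c1] comes from the decrease [c8] and the error bound; [cf^-1] serves at the
   switch and [cs * c1] on the way back *)
pose c1 := 2 / (c8 * kap); have c10 : 0 < c1 by rewrite divr_gt0 ?mulr_gt0.
pose c2 := 1 + cf^-1 + cs * c1.
have cfi : 0 < cf^-1 by rewrite invr_gt0.
have csc : 0 < cs * c1 by rewrite mulr_gt0.
have c20 : 0 < c2 by rewrite /c2; lra.
pose c3 := c2 + cs * c7; have c30 : 0 < c3 by rewrite addr_gt0 ?mulr_gt0.
have [e0 e00 {}EB] := EB c3; have [M FM] := F_small e00.
have at_flip k : g k.+1 != g k -> spread N (th k) <= c2 * F k.
  move=> flip; have [_ H] := dec_g flip.
  rewrite -(@ler_pXn2r _ 2) ?nnegrE ?mulr_ge0 ?F0 ?(ltW c20) //.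
  have H1 : spread N (th k) ^+ 2 <= cf^-1 * F k ^+ 2.
    rewrite mulrC ler_pdivlMr // mulrC.
    by have := sqr_ge0 (F' k); lra.
  apply: le_trans H1 _; rewrite exprMn ler_wpM2r ?sqr_ge0 //.
  by rewrite /c2; nra.
have local k : (M <= k)%N -> spread N (th k.+1) <= c2 * F k.+1 ->
    [/\ spread N (th k) <= c3 * F' k, kap * F' k <= p k &
        p k <= c1 * (F' k - F k.+1)].
  move=> Mk sk1.
  have s3 : spread N (th k) <= c3 * F' k.
    apply: le_trans (Hs _ (th k.+1)) _; rewrite enormC mulrDl -mulrA; apply: lerD.
      by apply: le_trans sk1 _; rewrite ler_pM2l.
    by rewrite ler_pM2l.
  have kp : kap * F' k <= p k.
    apply: (EB _ _ _ (c k)) => //; first exact: VI.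
    exact: le_trans (F'F k) (FM k Mk).
  split => //; have p0 := enorm_ge0 (th k.+1 - th k).
  have dF : 0 <= F' k - F k.+1 by rewrite subr_ge0.
  have [->|pn] := eqVneq (p k) 0; first by rewrite mulr_ge0 // ltW.
  have pp : 0 < p k by rewrite lt0r pn.
  rewrite /c1 mulrAC ler_pdivlMr ?mulr_gt0 // -(ler_pM2r pp).
  have I1 : c8 * p k ^+ 2 <= 2 * F' k * (F' k - F k.+1).
    apply: le_trans (dec_th k) _; rewrite subr_sqr mulrC ler_wpM2r //.
    by have := FF' k; lra.
  have I2 := ler_wpM2l (ltW kap0) I1.
  have I3 := ler_wpM2r dF kp.
  by lra.
have back j k : (M <= k)%N -> g (k + j).+1 != g (k + j) ->
  spread N (th k) <= c2 * F k.
  elim: j k => [|j IH] k Mk; first by rewrite addn0; exact: at_flip.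
  rewrite -addSnnS => /(IH _ (leqW Mk)) sk1.
  have [_ _ H] := local k Mk sk1.
  apply: le_trans (Hs _ (th k.+1)) _; rewrite enormC.
  have I1 := ler_wpM2l (ltW cs0) H.
  have I2 : cs * c1 * (F' k - F k.+1) <= c2 * (F' k - F k.+1).
    by apply: ler_wpM2r; rewrite ?subr_ge0 // /c2; lra.
  have I3 : c2 * F' k <= c2 * F k by rewrite ler_pM2l.
  by lra.
have all k : (M <= k)%N -> spread N (th k) <= c2 * F k.
  move=> Mk; have [j kj flip] := flips k.
  by apply: (back (j - k)%N) => //; rewrite subnKC.
pose c9 := ci * c3 * (c1 / kap); have c90 : 0 < c9.
  by rewrite /c9 (mulr_gt0 (mulr_gt0 ci0 c30)) // divr_gt0.
exists (c2 + c1 + c9), M; split; first by rewrite !addr_gt0.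
move=> k Mk; have [s3 kp pF] := local k Mk (all _ (leqW Mk)).
have d0 : 0 <= F k - F k.+1 by rewrite subr_ge0 F_mono.
have dd : F' k - F k.+1 <= F k - F k.+1 by rewrite lerD2r.
have c1d : 0 <= c1 * (F k - F k.+1) by rewrite mulr_ge0 // ltW.
have c2d : 0 <= c2 * (F k - F k.+1) by rewrite mulr_ge0 // ltW.
have c9d : 0 <= c9 * (F k - F k.+1) by rewrite mulr_ge0 // ltW.
split.
- have := all k Mk; have := mulr_ge0 (ltW c10) (F0 k);
    have := mulr_ge0 (ltW c90) (F0 k).
  by lra.
- have := ler_wpM2l (ltW c10) dd; lra.
have I1 : F' k <= c1 / kap * (F k - F k.+1).
  rewrite mulrAC ler_pdivlMr // mulrC; apply: le_trans kp _; apply: le_trans pF _.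
  by rewrite ler_pM2l.
have I2 : F k <= ci * (c3 * F' k).
  by apply: le_trans (Hi _ _ (ub k)) _; rewrite ler_pM2l.
have I3 : ci * (c3 * F' k) <= ci * (c3 * (c1 / kap * (F k - F k.+1))).
  by rewrite !ler_pM2l.
have I4 : ci * (c3 * (c1 / kap * (F k - F k.+1))) = c9 * (F k - F k.+1).
  by rewrite /c9 !mulrA.
by lra.
Qed.

(** The lengths of the steps telescope with the flow, so the angles converge, and
    the distance to the limit is at most a multiple of the flow. *)
Lemma limit_angles : exists (C : R) (M : nat) (ths : 'cV[R]_n),
  [/\ 0 < C, angle_box N ths, (incidence N *m Dmat N)^T *m ths = 0
    & forall k, (M <= k)%N -> enorm (th k - ths) <= C * F k].
Proof.
have [C [M [C0 H]]] := eventually_geometric.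
have tele k j : (M <= k)%N -> enorm (th (k + j)%N - th k) <= C * (F k - F (k + j)%N).
  move=> Mk; elim: j => [|j IH]; first by rewrite addn0 !subrr enorm0 mulr0.
  have [_ Hp _] := H (k + j)%N (leq_trans Mk (leq_addr _ _)).
  rewrite addnS; apply: le_trans (enorm_tri (th (k + j)%N) _ _) _.
  by lra.
have [ths Hths] := bounded_cluster thMb.
have close k : (M <= k)%N -> enorm (th k - ths) <= C * F k.
  move=> Mk; apply/ler_addgt0Pr => e e0; have [j kj Hj] := Hths e e0 k.
  apply: le_trans (enorm_tri (th j) _ _) _; rewrite enormC.
  have := tele k (j - k)%N Mk; rewrite subnKC // => T.
  by have := mulr_ge0 (ltW C0) (F0 j); lra.
exists C, M, ths; split => //.
- move=> l; rewrite -ler_norml; apply/ler_addgt0Pr => e e0.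
  have [b b0 bP] := mulmx_bounded (incidence N)^T.
  have [j _ Hj] := Hths (e / b) (divr_gt0 e0 b0) 0%N.
  rewrite -[ths](subrK (th j)) addrC angles_coordD; apply: le_trans (ler_normD _ _) _.
  apply: lerD; first by rewrite ler_norml; exact: box.
  apply: le_trans (enorm_coord _ _) _; apply: le_trans (bP _) _.
  by rewrite enormC mulrC -ler_pdivlMr // ltW.
apply: enorm_eq0; apply/eqP; rewrite eq_le enorm_ge0 andbT.
have [cs cs0 Hs] := spread_lipschitz.
apply/ler_addgt0Pr => e e0; rewrite add0r.
have D0 : 0 < C + cs * C by rewrite addr_gt0 ?mulr_gt0.
have [M' HM'] := F_small (divr_gt0 e0 D0).
pose k := maxn M M'; have [Hk _ _] := H k (leq_maxl _ _).
apply: le_trans (Hs _ (th k)) _; rewrite enormC.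
apply: (@le_trans _ _ ((C + cs * C) * F k)).
  by rewrite mulrDl -mulrA; apply: lerD => //; rewrite ler_pM2l // close // leq_maxl.
by rewrite mulrC -ler_pdivlMr // HM' // leq_maxr.
Qed.


(** Let [v] be the distance vector to the limit angles.  Around the limit the
    angle box is a cone with apex at the limit, so the Rayleigh quotient at [v]
    of the linearized flow cannot increase along a step in the angles, up to an
    error of order [|v| ^ 2]; a switch decreases it by a fixed amount [a], up to
    such an error.  The errors are summable because [|v| ^ 2] is at most a
    multiple of the decrease of the flow. *)
Lemma no_infinite_switching : False.
Proof.
have [C [M1 [C0 geo]]] := eventually_geometric.
have [D [M2 [ths [D0 hbox hB hclose]]]] := limit_angles.
have [ci ci0 Hi] := inflow_le N; have [cl cl0 Hl] := linflow_le N.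
have [c5 c50 H5] := inflow_linear N; have [c6 c60 H6] := thgrad_linear N.
have [cs cs0 Hs] := spread_le N.
pose v k := th k - ths.
have sv k : spread N (th k) = spread N (v k) by rewrite /spread mulmxBr hB subr0.
have lths g0 : linflow N g0 ths = 0 by rewrite linflowE hB had0r mulmx0.
have lv g0 k : linflow N g0 (v k) = linflow N g0 (th k)
  by rewrite linflowB lths subr0.
have Fs k : F k <= ci * spread N (th k) by exact: Hi.
have vs k : spread N (th k) <= cs * enorm (v k) by rewrite sv; exact: Hs.
have v_gt0 k : 0 < enorm (v k).
  by rewrite -(pmulr_rgt0 _ cs0) (lt_le_trans _ (vs k)) // -(pmulr_rgt0 _ ci0)
    (lt_le_trans (F_gt0 k)).
have v0 k : v k != 0 by rewrite -enorm_gt0.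
have v2 k : 0 < enorm (v k) ^+ 2 by rewrite exprn_gt0.
pose rq g0 k := enorm (linflow N g0 (v k)) ^+ 2 / enorm (v k) ^+ 2.
pose a := cf / (ci * D) ^+ 2.
have a0 : 0 < a by rewrite divr_gt0 // exprn_gt0 // mulr_gt0.
pose Dq := c5 * (ci + cl).
have Dq0 : 0 <= Dq by rewrite mulr_ge0 ?addr_ge0 // ltW.
have quart g0 k : unit_box g0 ->
    `|enorm (linflow N g0 (th k)) ^+ 2 - enorm (inflow N g0 (th k)) ^+ 2|
      <= Dq * spread N (th k) ^+ 4.
  move=> u0; rewrite subr_sqr normrM.
  have E1 : `|enorm (linflow N g0 (th k)) - enorm (inflow N g0 (th k))| <=
    c5 * spread N (th k) ^+ 3.
    apply: le_trans (H5 g0 (th k) u0); rewrite ler_norml.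
    have := enorm_leD (linflow N g0 (th k)) (inflow N g0 (th k)).
    have := enorm_leD (inflow N g0 (th k)) (linflow N g0 (th k)).
    by rewrite (enormC (linflow _ _ _)) => *; apply/andP; split; lra.
  have E2 : `|enorm (linflow N g0 (th k)) + enorm (inflow N g0 (th k))| <=
    (ci + cl) * spread N (th k).
    rewrite ger0_norm ?addr_ge0 ?enorm_ge0 //.
    by have := Hi _ (th k) u0; have := Hl _ (th k) u0; lra.
  have := ler_pM (normr_ge0 _) (normr_ge0 _) E1 E2.
  rewrite (_ : _ * _ * (_ * spread _ _) = Dq * spread N (th k) ^+ 4) //.
  by rewrite /Dq; ring.
pose b := 2 * Dq * cs ^+ 4.
have b0 : 0 <= b.
  exact: mulr_ge0 (mulr_ge0 (ler0n R 2) Dq0) (exprn_ge0 _ (ltW cs0)).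
have switch k : (M2 <= k)%N -> g k.+1 != g k ->
    rq (g k.+1) k <= rq (g k) k - a + b * enorm (v k) ^+ 2.
  move=> Mk flip; have [_ dec] := dec_g flip.
  rewrite /rq -(ler_pM2r (v2 k)) mulrDl mulrBl !divfK ?gt_eqF // !lv.
  have Q1 := quart _ k (ub k); have Q2 := quart _ k (ub k.+1).
  move: Q1 Q2; rewrite !ler_norml => /andP[q1 _] /andP[_ q2].
  have S4 : 2 * Dq * spread N (th k) ^+ 4 <= b * enorm (v k) ^+ 2 * enorm (v k) ^+ 2.
    rewrite (_ : _ * _ * enorm (v k) ^+ 2 = 2 * Dq * (cs * enorm (v k)) ^+ 4);
      last first.
      by rewrite /b; ring.
    apply: ler_wpM2l; first exact: mulr_ge0.
    by rewrite lerXn2r ?nnegrE ?mulr_ge0 ?enorm_ge0 // ltW.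
  have S2 : a * enorm (v k) ^+ 2 <= cf * spread N (th k) ^+ 2.
    rewrite /a mulrAC ler_pdivrMr ?exprn_gt0 ?mulr_gt0 // -mulrA ler_pM2l //.
    rewrite -exprMn lerXn2r ?nnegrE ?mulr_ge0 ?enorm_ge0 ?(ltW ci0) ?(ltW D0) //.
    by apply: le_trans (hclose k Mk) _; have := ler_wpM2l (ltW D0) (Fs k); lra.
  lra.
have [eps eps0 cone] := angle_box_cone hbox.
have mu1 : r3^-1 < 1 by rewrite invf_lt1 // (lt_trans ltr01).
pose De := rho / clo * c6 * cs ^+ 3.
have De0 : 0 < De by rewrite /De !(mulr_gt0, exprn_gt0, invr_gt0).
pose b' := 2 * De * (chi / rho).
have b'0 : 0 <= b'.
  exact: mulr_ge0 (mulr_ge0 (ler0n R 2) (ltW De0)) (divr_ge0 (ltW chi0) (ltW rho0)).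
pose eta := Num.min eps (Num.min 1 ((1 - r3^-1) / 2 / De)).
have eta0 : 0 < eta.
  rewrite !lt_min eps0 ltr01 /= !divr_gt0 // subr_gt0.
  by [].
have [M3 small] := F_small (divr_gt0 eta0 D0).
have vsmall k : (M2 <= k)%N -> (M3 <= k)%N -> enorm (v k) <= eta.
  move=> k2 k3; apply: le_trans (hclose k k2) _.
  by rewrite mulrC -ler_pdivlMr // small.
have angle_step k : (M2 <= k)%N -> (M3 <= k)%N ->
    rq (g k.+1) k.+1 <= rq (g k.+1) k + b' * enorm (v k) ^+ 2.
  move=> k2 k3; have := vsmall _ (leqW k2) (leqW k3); have := vsmall k k2 k3.
  rewrite /eta !le_min => /and3P[ve v1 vDe] /and3P[ve' _ _].
  set G := g k.+1; pose t := rho / c k; have t0 : 0 < t by rewrite divr_gt0.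
  have [L LE] : exists L : 'M[R]_n, forall u, linflow N G u = L *m u.
    exists (incidence N *m Dmat N *m diag_mx G^T *m (incidence N)^T) => u.
    by rewrite /linflow -!mulmxA diag_mx_had.
  pose S := t *: (L *m L).
  have SE u : S *m u = t *: linflow N G (linflow N G u).
    by rewrite /S -scalemxAl -mulmxA !LE.
  have Ssym u w : dot (S *m u) w = dot u (S *m w).
    by rewrite !SE dotZl dotZr !linflow_sym.
  have Smu u : enorm (S *m u) <= r3^-1 * enorm u.
    rewrite SE enormZ (ger0_norm (ltW t0)) /t mulrAC ler_pdivrMr //.
    apply: le_trans (linflow_norm u rho0 lip3 (bg k.+1)) _.
    rewrite cE (_ : _ * _ * (r3 * _) = stiffness N rho (g k.+1) * enorm u) //.
    by field; rewrite gt_eqF // (lt_trans ltr01).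
  pose gr := t *: thgrad N G (th k).
  have Serr : enorm (gr - S *m v k) <= (De * enorm (v k) ^+ 2) * enorm (v k).
    rewrite SE lv /gr -scalerBr enormZ (ger0_norm (ltW t0)).
    rewrite (_ : _ * enorm (v k) = rho / clo * (c6 * (cs * enorm (v k)) ^+ 3));
      last first.
      by rewrite /De; ring.
    apply: ler_pM; rewrite ?enorm_ge0 ?(ltW t0) //.
      by rewrite /t ler_pM2l // lef_pV2 ?posrE.
    apply: le_trans (H6 _ _ (ub k.+1)) _; rewrite ler_pM2l //.
    by rewrite lerXn2r ?nnegrE ?mulr_ge0 ?enorm_ge0 // ltW.
  pose w := v k - gr - v k.+1.
  have VIw y : angle_box N y -> 0 <= dot w (th k.+1 - y).
    move=> /(VI k); rewrite (_ : _ + _ = - c k *: w).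
      by rewrite dotZl mulNr oppr_le0 pmulr_rge0.
    rewrite /w /v /gr /t; apply/matrixP => i j; rewrite !mxE; field.
    by rewrite gt_eqF.
  have thE : th k.+1 = ths + v k.+1 by rewrite addrC subrK.
  have incone a1 b1 : 0 <= a1 <= 2 -> 0 <= b1 <= 2 ->
      angle_box N (ths + (a1 *: v k + b1 *: v k.+1)).
    by apply: cone => //; rewrite addrC subrK; exact: box.
  have two : 0 <= (2 : R) <= 2 by rewrite lexx andbT.
  have one : 0 <= (1 : R) <= 2 by rewrite ler01 ler1n.
  have zero : 0 <= (0 : R) <= 2 by rewrite lexx ler0n.
  have W1 : 0 <= dot (v k.+1) w.
    have := VIw _ (incone 0 0 zero zero); rewrite !scale0r !addr0 -/(v k.+1).
    by rewrite dotC.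
  have W2 : dot (v k.+1) w <= 0.
    have := VIw _ (incone 0 2 zero two);
      rewrite scale0r add0r {1}thE opprD addrACA subrr.
    by rewrite add0r -{1}[v k.+1]scale1r -scalerBl dotZr dotC; lra.
  have W3 : dot (v k) w <= 0.
    have := VIw _ (incone 1 1 one one); rewrite !scale1r {1}thE opprD addrACA subrr.
    by rewrite add0r opprD addrCA subrr addr0 dotNr dotC oppr_ge0.
  have e1 : De * enorm (v k) ^+ 2 <= (1 - r3^-1) / 2.
    rewrite mulrC -ler_pdivlMr //; apply: le_trans vDe.
    by rewrite expr2 ler_piMl ?enorm_ge0.
  have W12 : dot (v k.+1) w = 0 by apply/eqP; rewrite eq_le W1 W2.
  have [_] := rayleigh_step Ssym Smu mu1 (v0 k) Serr e1 W12 W3.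
  have dS u : dot u (S *m u) = t * enorm (linflow N G u) ^+ 2.
    by rewrite SE dotZr -linflow_sym enorm_sqr.
  rewrite !dS -2!(mulrA t) -!/(rq G _) => Hray.
  rewrite /b' -(ler_pM2l t0); apply: le_trans Hray _; rewrite mulrDr lerD2l.
  have tc : 1 <= t * (chi / rho).
    rewrite (_ : t * _ = chi / c k); first by rewrite ler_pdivlMr // mul1r.
    by rewrite /t; field; rewrite !gt_eqF.
  have De2 : 0 <= 2 * (De * enorm (v k) ^+ 2).
    by rewrite mulr_ge0 // mulr_ge0 ?sqr_ge0 // ltW.
  by have := ler_wpM2r De2 tc; lra.
pose M := maxn M1 (maxn M2 M3).
have MM k : (M <= k)%N -> [/\ (M1 <= k)%N, (M2 <= k)%N & (M3 <= k)%N].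
  by rewrite !geq_max => /and3P[].
pose lam := (b + b') * (D * C).
have vF k : (M <= k)%N -> (b + b') * enorm (v k) ^+ 2 <= lam * (F k - F k.+1).
  move=> /MM[k1 k2 k3]; rewrite /lam -mulrA; apply: ler_wpM2l; first exact: addr_ge0.
  have v1 : enorm (v k) <= 1.
    by apply: le_trans (vsmall k k2 k3) _; rewrite /eta !ge_min lexx orbT.
  have [_ _ FC] := geo k k1; have vD := hclose k k2.
  have I1 : enorm (v k) ^+ 2 <= enorm (v k) by rewrite expr2 ler_piMl ?enorm_ge0.
  apply: le_trans I1 _; apply: le_trans vD _.
  by rewrite -mulrA ler_pM2l.
(* the quotient with the remaining sum of errors added *)
pose Lam k := rq (g k) k + lam * F k.
have rq_ge0 g0 k : 0 <= rq g0 k by rewrite divr_ge0 ?sqr_ge0.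
have lam0 : 0 <= lam by exact: mulr_ge0 (addr_ge0 b0 b'0)
  (mulr_ge0 (ltW D0) (ltW C0)).
have split_err k : (M <= k)%N ->
    b * enorm (v k) ^+ 2 + b' * enorm (v k) ^+ 2 <= lam * (F k - F k.+1).
  by move=> Mk; rewrite -mulrDl; exact: vF.
have LamS k : (M <= k)%N -> Lam k.+1 <= Lam k.
  move=> Mk; have [k1 k2 k3] := MM k Mk; have := split_err k Mk.
  have := angle_step k k2 k3; rewrite /Lam.
  have bv : 0 <= b * enorm (v k) ^+ 2 by rewrite mulr_ge0 ?sqr_ge0.
  have [->|flip] := eqVneq (g k.+1) (g k); first by lra.
  by have := switch k k2 flip; lra.
have [M' drop] := finite_drops a0 LamS
  (fun k _ => addr_ge0 (rq_ge0 _ _) (mulr_ge0 lam0 (F0 k))).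
have [k] := flips (maxn M M'); rewrite geq_max => /andP[Mk M'k] flip.
have [k1 k2 k3] := MM k Mk; have := drop k M'k; have := split_err k Mk.
have := angle_step k k2 k3; have := switch k k2 flip; rewrite /Lam.
by lra.
Qed.

End FullyShed.

(** * One iteration of the algorithm *)

Section Iteration.
Context {R : realType} {m nd ng : nat}.
Let n := (nd + ng)%N.
Variables (N : network R m nd ng) (K : nat) (rho r1 r2 r3 s3 Mb : R).
Variables (g : nat -> 'cV[R]_m) (z th : nat -> 'cV[R]_n).
Hypothesis rho0 : 0 < rho.
Hypothesis r11 : 1 < r1.
Hypothesis r21 : 1 < r2.
Hypothesis r31 : 1 < r3.
Hypothesis choices : line_choices (R := R) (m := m) K !=set0.
Hypothesis lip1 : lines_lipschitz N rho.
Hypothesis lip2 : forall g0 th0,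
  lipschitz_with rho (fun z' => dH_z N rho g0 z' th0) setT.
Hypothesis lip3 : angles_lipschitz N rho.
Hypothesis L3_le : forall k, L3 N rho (g k) (z k) <= s3.
Hypothesis thMb : forall k, enorm (th k) <= Mb.
Hypothesis palm : PALM N K rho r1 r2 r3 g z th.

Local Notation H := (Hrho N rho).
Local Notation a k := (r1 * L1 N rho (z k) (th k)).
Local Notation b := (r2 * rho).
Local Notation c k := (r3 * L3 N rho (g k.+1) (z k.+1)).

Lemma step_size_gt0 k : [/\ 0 < a k, 0 < b & 0 < c k].
Proof. by have [] := palm k. Qed.

Lemma g_step k : line_choices K (g k.+1) /\ forall y, line_choices K y ->
  dot (dH_g N rho (g k) (z k) (th k)) (g k.+1 - y)
    + a k / 2 * (enorm (g k.+1 - g k) ^+ 2 - enorm (y - g k) ^+ 2) <= 0.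
Proof.
have [[a0 _ _] pg _ _] := palm k; apply: (prox_indicator a0 choices).
by move: pg; rewrite /grad_g (expands_grad (expands_g N rho _ _ _)).
Qed.

Lemma z_step k : shed_set N (z k.+1) /\ forall y, shed_set N y ->
  dot (dH_z N rho (g k.+1) (z k) (th k)) (z k.+1 - y)
    + b / 2 * (enorm (z k.+1 - z k) ^+ 2 - enorm (y - z k) ^+ 2) <= 0.
Proof.
have [[_ b0 _] _ pz _] := palm k.
apply: (prox_indicator b0); first by exists (- Pinj N); exact: full_shed.
by move: pz; rewrite /grad_z (expands_grad (expands_z N rho _ _ _)).
Qed.

Lemma zero_angle_box : angle_box N 0.
Proof.
move=> l; rewrite /angles mulmx0 mxE oppr_le0.
by have := pihalf_ge1 R; move=> ?; apply/andP; split; lra.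
Qed.

Lemma th_step k : angle_box N (th k.+1) /\ forall y, angle_box N y ->
  dot (dH_th N rho (g k.+1) (z k.+1) (th k)) (th k.+1 - y)
    + c k / 2 * (enorm (th k.+1 - th k) ^+ 2 - enorm (y - th k) ^+ 2) <= 0.
Proof.
have [[_ _ c0] _ _ pth] := palm k.
apply: (prox_indicator c0); first by exists 0; exact: zero_angle_box.
by move: pth; rewrite /grad_th (expands_grad (expands_th N rho _ _ _)).
Qed.

Lemma g_binary k : binary (g k.+1).
Proof. by have [[]] := g_step k. Qed.

Lemma L1_gt0 k : 0 < L1 N rho (z k) (th k).
Proof.
by have [] := step_size_gt0 k; rewrite pmulr_rgt0 // (lt_trans ltr01).
Qed.

Lemma L3_gt0 k : 0 < L3 N rho (g k.+1) (z k.+1).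
Proof.
by have [_ _] := step_size_gt0 k; rewrite pmulr_rgt0 // (lt_trans ltr01).
Qed.

Lemma g_decrease k : line_choices K (g k) ->
  (r1 - 1) / 2 * L1 N rho (z k) (th k) * enorm (g k.+1 - g k) ^+ 2
    <= H (g k) (z k) (th k) - H (g k.+1) (z k) (th k).
Proof.
move=> gk; have [_ S] := g_step k.
exact: (prox_decrease (fun u => expands_g N rho u (z k) (th k)) (lip1 _ _) gk S).
Qed.

Lemma z_decrease k : shed_set N (z k) ->
  (r2 - 1) / 2 * rho * enorm (z k.+1 - z k) ^+ 2
    <= H (g k.+1) (z k) (th k) - H (g k.+1) (z k.+1) (th k).
Proof.
move=> zk; have [_ S] := z_step k.
exact: (prox_decrease (fun u => expands_z N rho (g k.+1) u (th k)) (lip2 _ _) zk S).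
Qed.

Lemma th_decrease k : angle_box N (th k) ->
  (r3 - 1) / 2 * L3 N rho (g k.+1) (z k.+1) * enorm (th k.+1 - th k) ^+ 2
    <= H (g k.+1) (z k.+1) (th k) - H (g k.+1) (z k.+1) (th k.+1).
Proof.
move=> thk; have [_ S] := th_step k.
exact: (prox_decrease (fun u => expands_th N rho (g k.+1) (z k.+1) u) (lip3 _ _)
  thk S).
Qed.

(** A uniform version of the decrease in the angles: where the step size is
    not bounded below, the gradient and hence the step are zero. *)
Lemma th_decrease_uniform : exists2 d, 0 < d & forall k, angle_box N (th k) ->
  d * enorm (th k.+1 - th k) ^+ 2
    <= H (g k.+1) (z k.+1) (th k) - H (g k.+1) (z k.+1) (th k.+1).
Proof.
have [e e0 He] := stiffness_gap N rho0;
  have r3p : 0 < (r3 - 1) / 2 by rewrite divr_gt0 ?subr_gt0.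
exists ((r3 - 1) / 2 * e) => [|k thk]; first exact: mulr_gt0.
apply: le_trans (th_decrease thk).
case: (He _ (g_binary k)) => [st0|st].
  have [_ /(_ _ thk)] := th_step k.
  rewrite (no_stiffness _ _ rho0 lip3 st0) dot0l add0r subrr enorm0 expr0n /= subr0.
  have [_ _ c0] := step_size_gt0 k; rewrite pmulr_rle0; last by lra.
  move=> D0; have -> : enorm (th k.+1 - th k) ^+ 2 = 0.
    by apply/eqP; rewrite eq_le D0 sqr_ge0.
  by rewrite !mulr0.
apply: ler_wpM2r; first exact: sqr_ge0.
rewrite ler_pM2l //; apply: le_trans st _; exact: stiffness_le_L3.
Qed.

(** The least value of the objective: everything is shed and no power flows. *)
Definition shed_optimum : R := dot (load_ones : 'cV[R]_n) (Pinj N).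

Definition excess g0 z0 th0 := H g0 z0 th0 - shed_optimum.

Lemma excessE g0 z0 th0 : excess g0 z0 th0 =
  - dot (load_ones : 'cV[R]_n) (Pinj N + z0) +
      rho / 2 * enorm (residual N g0 z0 th0) ^+ 2.
Proof. by rewrite /excess HrhoE dotDr /shed_optimum; ring. Qed.

Lemma excess_shed g0 th0 :
  excess g0 (- Pinj N) th0 = rho / 2 * enorm (inflow N g0 th0) ^+ 2.
Proof. by rewrite excessE /residual subrr dot0r oppr0 add0r subr0. Qed.

Lemma excess_ge0 g0 z0 th0 : shed_set N z0 -> 0 <= excess g0 z0 th0.
Proof.
move=> /shed_norm Hz; rewrite excessE.
have := enorm_ge0 (Pinj N + z0).
have : 0 <= rho / 2 * enorm (residual N g0 z0 th0) ^+ 2.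
  by rewrite mulr_ge0 ?sqr_ge0 // divr_ge0 // ltW.
lra.
Qed.

(** Near the optimal value both the power that is not shed and the residual are
    small. *)
Lemma excess_small (eta : R) : 0 < eta -> exists2 e, 0 < e &
  forall g0 z0 th0, shed_set N z0 -> excess g0 z0 th0 <= e ->
  enorm (inflow N g0 th0) <= eta.
Proof.
move=> eta0; pose e := Num.min (eta / 4) (rho * eta ^+ 2 / 8).
exists e; first by rewrite lt_min !divr_gt0 // mulr_gt0 // exprn_gt0.
move=> g0 z0 th0 /shed_norm Hz; rewrite excessE /e le_min => /andP[E1 E2].
have y0 := enorm_ge0 (Pinj N + z0).
have r0 : 0 <= rho / 2 * enorm (residual N g0 z0 th0) ^+ 2.
  by rewrite mulr_ge0 ?sqr_ge0 // divr_ge0 // ltW.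
have R2 : enorm (residual N g0 z0 th0) <= eta / 2.
  rewrite -(@ler_pXn2r _ 2) ?nnegrE ?enorm_ge0 //; last by lra.
  have rho2 : 0 < rho / 2 by rewrite divr_gt0.
  rewrite -(ler_pM2l rho2) (_ : _ * (eta / 2) ^+ 2 = rho * eta ^+ 2 / 8);
    last by field.
  lra.
have := enorm_leD (inflow N g0 th0) (Pinj N + z0); rewrite -/(residual N g0 z0 th0).
lra.
Qed.

Local Notation h k := (excess (g k) (z k) (th k)).

Lemma intermediate_excess k : (0 < k)%N ->
  [/\ (r1 - 1) / 2 * L1 N rho (z k) (th k) * enorm (g k.+1 - g k) ^+ 2 <=
    h k - h k.+1,
      (r2 - 1) / 2 * rho * enorm (z k.+1 - z k) ^+ 2 <= h k - h k.+1,
      excess (g k.+1) (z k) (th k) <= h k,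
      h k.+1 <= excess (g k.+1) (z k.+1) (th k) & h k.+1 <= h k].
Proof.
case: k => // k _.
have dg := g_decrease (g_step k).1; have dz := z_decrease (z_step k).1.
have dth := th_decrease (th_step k).1.
have g0 : 0 <= (r1 - 1) / 2 * L1 N rho (z k.+1) (th k.+1) * enorm
  (g k.+2 - g k.+1) ^+ 2.
  by rewrite mulr_ge0 ?sqr_ge0 // mulr_ge0 ?(ltW (L1_gt0 _)) // divr_ge0 //
    subr_ge0 ltW.
have z0 : 0 <= (r2 - 1) / 2 * rho * enorm (z k.+2 - z k.+1) ^+ 2.
  by rewrite mulr_ge0 ?sqr_ge0 // mulr_ge0 ?(ltW rho0) // divr_ge0 // subr_ge0 ltW.
have th0 : 0 <= (r3 - 1) / 2 * L3 N rho (g k.+2) (z k.+2) * enorm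
  (th k.+2 - th k.+1) ^+ 2.
  by rewrite mulr_ge0 ?sqr_ge0 // mulr_ge0 ?(ltW (L3_gt0 _)) // divr_ge0 //
    subr_ge0 ltW.
move: dg dz dth g0 z0 th0; rewrite /excess.
move: ((r1 - 1) / 2 * _ * _) ((r2 - 1) / 2 * _ * _) ((r3 - 1) / 2 * _ * _) => A B C.
by move: (H _ _ _) (H _ _ _) (H _ _ _) (H _ _ _) => h1 h2 h3 h4 *; split; lra.
Qed.

Section InfinitelyManySwitches.
Hypothesis flips : forall M, exists2 k, (M <= k)%N & g k.+1 != g k.

Lemma h_ge0 k : 0 <= h k.+1.
Proof. by apply: excess_ge0; case: (z_step k). Qed.

Lemma h_mono i j : (0 < i)%N -> (i <= j)%N -> h j <= h i.
Proof.
move=> i0 /subnK <-; elim: (j - i)%N => [|q IH]; first by rewrite add0n.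
rewrite addSn; apply: le_trans IH.
by have [] := @intermediate_excess (q + i)%N (ltn_addl _ i0).
Qed.

Lemma h_increment e : 0 < e -> exists M, forall k, (M <= k)%N -> h k - h k.+1 <= e.
Proof.
move=> e0; have [||M HM] := @finite_drops R (fun k => h k) e 1 e0.
- by move=> k k0; have [] := intermediate_excess k0.
- by case=> // k _; exact: h_ge0.
by exists M => k /HM; lra.
Qed.

Lemma z_increment e : 0 < e -> exists M, forall k, (M <= k)%N ->
  enorm (z k.+1 - z k) <= e.
Proof.
move=> e0; have q0 : 0 < (r2 - 1) / 2 * rho by rewrite mulr_gt0 // divr_gt0 ?subr_gt0.
have [M HM] := h_increment (mulr_gt0 q0 (exprn_gt0 2 e0)).
exists (maxn 1 M) => k; rewrite geq_max => /andP[k0 /HM Hk].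
have [_ dz _ _ _] := intermediate_excess k0.
rewrite -(@ler_pXn2r _ 2) ?nnegrE ?enorm_ge0 ?(ltW e0) // -(ler_pM2l q0).
exact: le_trans dz Hk.
Qed.

Lemma full_shed_next : exists2 eta, 0 < eta & exists M, forall k, (M <= k)%N ->
  enorm (inflow N (g k.+1) (th k)) <= eta -> z k.+1 = - Pinj N.
Proof.
exists (1 / 8 / rho); first by rewrite !divr_gt0.
have rb : 0 < 8 * (`|rho - b| + 1) by rewrite mulr_gt0 // ltr_wpDl.
have [M HM] := z_increment (divr_gt0 ltr01 rb).
exists M => k /HM dz phi; have [zk S] := z_step k.
have [_ b0 _] := step_size_gt0 k.
apply: (full_shed_step rho0 zk (prox_convex b0 (shed_set_convex (N := N)) zk S)).
have A1 : rho * enorm (inflow N (g k.+1) (th k)) <= 1 / 8.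
  by rewrite mulrC -ler_pdivlMr.
have A2 : `|rho - b| * enorm (z k.+1 - z k) <= 1 / 8.
  apply: (@le_trans _ _ ((`|rho - b| + 1) * (1 / (8 * (`|rho - b| + 1))))).
    by apply: ler_pM; rewrite ?enorm_ge0 // lerDl.
  have : 0 < `|rho - b| + 1 by rewrite ltr_wpDl.
  move: (`|rho - b| + 1) => x x0; rewrite le_eqVlt; apply/orP; left; apply/eqP.
  by field; rewrite gt_eqF.
lra.
Qed.

(** A switch moves the lines by at least 1, so at a late switch the step-size
    constant is small, and with it the spread and the flow.  Everything is then
    shed in one step, and the objective is close to its least value, where it
    stays because it decreases. *)
Lemma excess_vanishes e : 0 < e -> exists M, forall k, (M <= k)%N -> h k <= e.
Proof.
move=> e0; have [eta eta0 [M1 HM1]] := full_shed_next.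
have [Cs Cs0 Hs] := spread_le_L1 rho0 lip1; have [ci ci0 Hi] := inflow_le N.
pose eta' := Num.min eta (Num.min 1 (2 * e / rho)).
have eta'0 : 0 < eta' by rewrite !lt_min eta0 ltr01 /= divr_gt0 // mulr_gt0.
have q0 : 0 < (r1 - 1) / 2 by rewrite divr_gt0 ?subr_gt0.
have w0 : 0 < (r1 - 1) / 2 / Cs / ci ^+ 2 * eta' ^+ 2.
  exact: mulr_gt0 (divr_gt0 (divr_gt0 q0 Cs0) (exprn_gt0 2 ci0)) (exprn_gt0 2 eta'0).
have [M2 HM2] := h_increment w0.
have [k] := flips (maxn 2 (maxn M1 M2));
  rewrite !geq_max => /and3P[k2 k1 /HM2 dh] flip.
have k0 : (0 < k)%N by apply: leq_trans k2.
exists k.+1 => j kj; apply: le_trans (h_mono _ kj) _ => //.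
have [dg _ _ hk _] := intermediate_excess k0; apply: le_trans hk _.
have [bk thk] : binary (g k) /\ angle_box N (th k).
  by rewrite -(prednK k0); split; [exact: g_binary|case: (th_step k.-1)].
have jump := binary_dist (g_binary k) bk flip.
have small : enorm (inflow N (g k.+1) (th k)) <= eta'.
  apply: le_trans (Hi _ _ (binary_unit_box (g_binary k))) _.
  rewrite mulrC -ler_pdivlMr // -(@ler_pXn2r _ 2) ?nnegrE ?spread_ge0 ?divr_ge0
    ?(ltW eta'0) ?(ltW ci0) //.
  apply: le_trans (Hs (z k) _ thk) _.
  have L0 := L1_gt0 k; have qL :
    0 < (r1 - 1) / 2 * L1 N rho (z k) (th k) by rewrite mulr_gt0.
  have A : (r1 - 1) / 2 * L1 N rho (z k) (th k) <=
    (r1 - 1) / 2 / Cs / ci ^+ 2 * eta' ^+ 2.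
    apply: le_trans dh; apply: le_trans dg; rewrite -[leLHS]mulr1.
    by rewrite ler_pM2l.
  rewrite -(ler_pM2l q0) mulrCA; apply: le_trans (ler_wpM2l (ltW Cs0) A) _.
  rewrite le_eqVlt; apply/orP; left; apply/eqP; field.
  by rewrite !gt_eqF.
have zk1 : z k.+1 = - Pinj N.
  by apply: HM1 => //; apply: le_trans small _; rewrite ge_min lexx.
rewrite zk1 excess_shed.
have F2 : enorm (inflow N (g k.+1) (th k)) ^+ 2 <= 2 * e / rho.
  apply: (@le_trans _ _ (enorm (inflow N (g k.+1) (th k)))).
    rewrite expr2 ler_piMl ?enorm_ge0 //; apply: le_trans small _.
    by rewrite /eta' !ge_min lexx orbT.
  by apply: le_trans small _; rewrite /eta' !ge_min lexx !orbT.
have rho2 : 0 < rho / 2 by rewrite divr_gt0.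
rewrite -(ler_pM2l rho2) in F2; apply: le_trans F2 _.
by rewrite le_eqVlt; apply/orP; left; apply/eqP; field; rewrite gt_eqF.
Qed.

Lemma eventually_fully_shed : exists M, forall k, (M <= k)%N -> z k = - Pinj N.
Proof.
have [eta eta0 [M1 HM1]] := full_shed_next; have [e e0 He] := excess_small eta0.
have [M2 HM2] := excess_vanishes e0.
exists (maxn 2 (maxn M1 M2).+1) => k; rewrite geq_max => /andP[].
case: k => [|[|k]] // _; rewrite ltnS geq_max => /andP[k1 k2].
apply: HM1 => //; apply: (He _ (z k.+1)); first by case: (z_step k).
have [_ _ E _ _] := @intermediate_excess k.+1 isT; apply: le_trans E _.
exact: HM2.
Qed.

(** Start the sequence when everything is shed. *)
Lemma infinitely_many_switches_absurd : False.
Proof.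
have [M0 HM0] := eventually_fully_shed.
pose M := maxn 1 M0.
have zM k : z (M + k) = - Pinj N by apply: HM0;
  rewrite (leq_trans (leq_maxr 1 M0)) // leq_addr.
have Mpos k : exists j, (M + k)%N = j.+1.
  by exists (M + k).-1; rewrite prednK // ltn_addr // leq_maxl.
have [st st0 Hst] := stiffness_gap N rho0; have [d d0 Hd] := th_decrease_uniform.
have [Cs Cs0 Hs] := spread_le_L1 rho0 lip1.
have q0 : 0 < (r1 - 1) / 2 by rewrite divr_gt0 ?subr_gt0.
have rho2 : 0 < rho / 2 by rewrite divr_gt0.
have r30 : 0 < r3 by exact: lt_trans r31.
have bM k : binary (g (M + k)) by have [j ->] := Mpos k; exact: g_binary.
have boxM k : angle_box N (th (M + k)) by have [j ->] := Mpos k; case: (th_step j).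
have gM k : line_choices K (g (M + k)) by have [j ->] := Mpos k; case: (g_step j).
pose cc k := r3 * stiffness N rho (g (M + k.+1)).
have ccE k : cc k = c (M + k) by rewrite /cc addnS /stiffness -(zM k.+1) addnS.
have stp k : st <= stiffness N rho (g (M + k.+1)).
  case: (Hst _ (bM k.+1)) => // E; have [_ _] := step_size_gt0 (M + k).
  by rewrite -ccE /cc E mulr0 ltxx.
apply: (@no_infinite_switching R m nd ng N rho r3 Mb (r3 * st) (r3 * s3)
  ((r1 - 1) / 2 / Cs * (2 / rho)) (2 / rho * d)
  (fun k => g (M + k)) (fun k => th (M + k)) cc) => //.
- exact: mulr_gt0.
- by move=> k; rewrite /cc ler_pM2l.
- by move=> k; rewrite ccE ler_pM2l.
- move=> k y Hy; rewrite !addnS ccE; have [thk S] := th_step (M + k).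
  have [_ _ c0] := step_size_gt0 (M + k).
  have := prox_convex c0 (angle_box_convex (N := N)) thk S Hy.
  by rewrite -[in z _]addnS zM dH_th_shed.
- exact: mulr_gt0 (divr_gt0 q0 Cs0) (divr_gt0 (ltr0Sn R 1) rho0).
- move=> k; rewrite addnS => flip.
  have := g_decrease (gM k); rewrite zM => dec.
  have jump := binary_dist (g_binary _) (bM k) flip.
  have L0 := L1_gt0 (M + k); rewrite zM in L0.
  have spr := Hs (- Pinj N) _ (boxM k).
  have E : H (g (M + k)) (- Pinj N) (th (M + k)) - H (g (M + k).+1) (- Pinj N)
    (th (M + k))
     = rho / 2 * (enorm (inflow N (g (M + k)) (th (M + k))) ^+ 2
        - enorm (inflow N (g (M + k).+1) (th (M + k))) ^+ 2).
    by rewrite mulrBr -!excess_shed /excess; ring.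
  split.
    apply/negP => /eqP F0; move/negP: flip; apply.
    have [_ /(_ _ (gM k))] := g_step (M + k).
    rewrite zM /dH_g /residual subrr subr0 (enorm_eq0 F0) mulmx0 had0r scaler0
      dot0l add0r.
    rewrite subrr enorm0 expr0n /= subr0 pmulr_rle0; last first.
      by rewrite divr_gt0 // mulr_gt0 // (lt_trans ltr01).
    by move=> H0; rewrite -subr_eq0; apply/eqP/enorm_eq0/eqP;
      rewrite -sqrf_eq0 eq_le H0 sqr_ge0.
  rewrite -(ler_pM2l rho2) -E; apply: le_trans dec.
  apply: (@le_trans _ _ ((r1 - 1) / 2 * L1 N rho (- Pinj N) (th (M + k))));
    last first.
    by rewrite -[leLHS]mulr1 ler_pM2l // mulr_gt0.
  rewrite (_ : _ * (_ * spread _ _ ^+ 2) =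
    (r1 - 1) / 2 * (spread N (th (M + k)) ^+ 2 / Cs)).
    by rewrite ler_pM2l // ler_pdivrMr // mulrC.
  by field; rewrite !gt_eqF.
- exact: mulr_gt0 (divr_gt0 (ltr0Sn R 1) rho0) d0.
- move=> k; rewrite addnS; have := Hd _ (boxM k); rewrite -[in z _]addnS zM => dec.
  rewrite -(ler_pM2l rho2).
  rewrite (_ : rho / 2 * (_ * _) = d * enorm (th (M + k).+1 - th (M + k)) ^+ 2);
    last first.
    by field; rewrite gt_eqF.
  apply: le_trans dec _; rewrite mulrBr -!excess_shed /excess; lra.
- move=> e e0; have [e' e'0 He] := excess_small e0.
  have [M1 HM1] := excess_vanishes e'0; exists M1 => k Mk.
  apply: (He _ (- Pinj N)); first exact: full_shed.
  by rewrite -(zM k); apply: HM1; rewrite (leq_trans Mk) // leq_addl.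
- move=> L; have [k Lk flip] := flips (M + L).
  exists (k - M)%N; first by rewrite leq_subRL ?(leq_trans (leq_addr _ _) Lk).
  by rewrite addnS subnKC // (leq_trans (leq_addr _ _) Lk).
Qed.

End InfinitelyManySwitches.

Lemma lines_eventually_constant : exists M, forall k, (M <= k)%N -> g k.+1 = g k.
Proof.
apply: contrapT => Hn; apply: infinitely_many_switches_absurd => M.
apply: contrapT => HM; apply: Hn; exists M => k Mk; apply/eqP/negPn/negP => Hk.
by apply: HM; exists k.
Qed.

End Iteration.

(** * Convergence from the Kurdyka-Lojasiewicz inequality *)

Section Desingularizing.
Context {R : realType}.
Implicit Types (psi : R -> R).

Lemma concave_tangent psi (I : set R) (s t : R) :
  (forall s t l : R, I s -> I t -> 0 <= l <= 1 ->
     l * psi s + (1 - l) * psi t <= psi (l * s + (1 - l) * t)) ->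
  I s -> I t -> s < t -> derivable psi t 1 ->
  derive1 psi t * (t - s) <= psi t - psi s.
Proof.
move=> conc Is It st dpsi.
have ts : 0 < t - s by rewrite subr_gt0.
rewrite -ler_pdivlMr //; apply/ler_addgt0Pr => e e0.
have cv : (fun h : R => h^-1 *: ((psi \o shift t) (h *: (1 : R)) - psi t)) @ 0^'
  --> derive1 psi t.
  by rewrite derive1E /derive; apply: dpsi.
move/cvgrPdist_le : cv => /(_ e e0) /nbhs_ballP[del /= del0 Hdel].
pose l := Num.min 1 (del / 2 / (t - s)).
have l0 : 0 < l by rewrite lt_min ltr01 !divr_gt0.
have l1 : l <= 1 by rewrite ge_min lexx.
have ld : l * (t - s) <= del / 2.
  by rewrite -ler_pdivlMr // ge_min lexx orbT.
have h0 : 0 < l * (t - s) by rewrite mulr_gt0.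
have := Hdel (- (l * (t - s))); rewrite -ball_normE /= sub0r opprK gtr0_norm //.
have ltd : l * (t - s) < del by lra.
move=> /(_ ltd); rewrite oppr_eq0 gt_eqF // => /(_ isT).
rewrite /shift /= [_ *: 1]mulr1 ler_norml => /andP[_].
have := conc s t l Is It; rewrite (ltW l0) l1 => /(_ isT).
rewrite (_ : l * s + (1 - l) * t = - (l * (t - s)) + t); last by ring.
move: (psi (- _ + t)) => y Hy; rewrite lerBlDr => H.
apply: le_trans H _; rewrite addrC lerD2r
  [_ *: _](_ : _ = (psi t - y) / (l * (t - s))).
  rewrite ler_pdivrMr // (_ : _ / _ * _ = l * (psi t - psi s)); first by lra.
  by field; rewrite gt_eqF.
rewrite [in LHS]/GRing.scale /=; field.
by rewrite !gt_eqF.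
Qed.

End Desingularizing.

Lemma ereal_gap (R : realType) (eta : \bar R) : (0 < eta)%E ->
  exists2 r : R, 0 < r & forall t, t < r -> (t%:E < eta)%E.
Proof.
case: eta => [r| |] //; last by exists 1 => // t _; rewrite ltry.
by rewrite lte_fin => r0; exists r => // t; rewrite lte_fin.
Qed.

(** The continuity of [f] is asked for only along the sequence, which lets [f] be
    infinite arbitrarily near a cluster point. *)
Section KLConvergence.
Context {R : realType} {d : nat}.
Variables (f : 'cV[R]_d -> \bar R) (x : nat -> 'cV[R]_d) (al be Mb : R).
Local Notation v k := (fine (f (x k))).
Local Notation dx k := (enorm (x k.+1 - x k)).
Hypothesis al0 : 0 < al.
Hypothesis be0 : 0 < be.
Hypothesis f_fin : forall k, f (x k) \is a fin_num.
Hypothesis decrease : forall k, al * dx k ^+ 2 <= v k - v k.+1.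
Hypothesis subgradient : forall k, exists2 w, regular_subdiff f (x k.+1) w &
  enorm w <= be * dx k.
Hypothesis xMb : forall k, enorm (x k) <= Mb.
Hypothesis f_cont : forall xb,
  (forall e : R, 0 < e -> forall M, exists2 k, (M <= k)%N & enorm (x k - xb) < e) ->
  f xb \is a fin_num /\ forall e : R, 0 < e -> exists2 del : R, 0 < del &
    forall k, enorm (x k - xb) < del -> `|v k - fine (f xb)| < e.
Hypothesis KL : forall u, limiting_subdiff f u !=set0 -> KL_at f u.

Lemma cvg_fine_eps (u : nat -> 'cV[R]_d) (y : 'cV[R]_d) :
  (forall k, f (u k) \is a fin_num) -> f y \is a fin_num ->
  (forall e : R, 0 < e -> exists M, forall k, (M <= k)%N ->
     `|fine (f (u k)) - fine (f y)| < e) ->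
  f (u k) @[k --> \oo] --> f y.
Proof.
move=> uf yf H.
have -> : (fun k => f (u k)) = (fun k => (fine (f (u k)))%:E).
  by apply/funext => k; rewrite fineK.
rewrite -(fineK yf); apply: cvg_EFin; first by near=> k; [].
apply/cvgrPdist_lt => e e0; have [M HM] := H e e0.
by exists M => // k /= /HM; rewrite distrC.
Unshelve. all: by end_near. Qed.

Lemma regular_limiting u w : regular_subdiff f u w -> limiting_subdiff f u w.
Proof.
move=> [uf Hw]; split => //; exists (fun=> u), (fun=> w); split => //; exact: cvg_cst.
Qed.

Lemma v_mono i j : (i <= j)%N -> v j <= v i.
Proof.
move=> /subnK <-; elim: (j - i)%N => [|q IH]; first by rewrite add0n.
rewrite addSn; apply: le_trans IH; have := decrease (q + i).
by have := mulr_ge0 (ltW al0) (sqr_ge0 (dx (q + i))); lra.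
Qed.

Definition clusters xb := forall e : R, 0 < e -> forall M,
  exists2 k, (M <= k)%N & enorm (x k - xb) < e.

Section AtClusterPoint.
Variable xb : 'cV[R]_d.
Hypothesis xbP : clusters xb.
Local Notation vb := (fine (f xb)).

Lemma v_ge k : vb <= v k.
Proof.
apply/ler_addgt0Pr => e e0; have [_ C] := f_cont xbP.
have [del del0 Hdel] := C e e0; have [j kj xj] := xbP del0 k.
have := Hdel j xj; rewrite ltr_norml => /andP[H1 H2].
by have := v_mono kj; lra.
Qed.

Lemma v_cvg e : 0 < e -> exists M, forall k, (M <= k)%N -> v k < vb + e.
Proof.
move=> e0; have [_ C] := f_cont xbP.
have [del del0 Hdel] := C e e0; have [j _ xj] := xbP del0 0%N.
exists j => k jk; have := Hdel j xj; rewrite ltr_norml => /andP[H1 H2].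
by have := v_mono jk; lra.
Qed.

Lemma dx_cvg e : 0 < e -> exists M, forall k, (M <= k)%N -> dx k < e.
Proof.
move=> e0; have [M HM] := v_cvg (mulr_gt0 al0 (exprn_gt0 2 e0)).
exists M => k /HM vk; rewrite -(@ltr_pXn2r _ 2) ?nnegrE ?enorm_ge0 ?(ltW e0) //.
rewrite -(ltr_pM2l al0); apply: le_lt_trans (decrease k) _.
by have := v_ge k.+1; lra.
Qed.

(** The steps tend to zero, hence so do the subgradients. *)
Lemma cluster_critical : critical_point f xb.
Proof.
have [xbf C] := f_cont xbP; split => //.
have /choice[s Hs] : forall j : nat, exists k,
    (j <= k)%N /\ enorm (x k.+1 - xb) < j.+1%:R^-1.
  move=> j; have [|[|k] // jk xk] := xbP (e := j.+1%:R^-1) _ j.+1.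
    by rewrite invr_gt0.
  by exists k.
have /choice[w Hw] : forall k, exists w, regular_subdiff f (x k.+1) w /\
  enorm w <= be * dx k.
  by move=> k; have [w ? ?] := subgradient k; exists w.
have eventually_small (e : R) : 0 < e -> exists M : nat, forall k, (M <= k)%N ->
  k.+1%:R^-1 < e.
  move=> e0; exists (Num.truncn e^-1) => k Mk.
  rewrite invf_plt ?posrE //; apply: lt_le_trans (real_truncnS_gt (num_real _)) _.
  by rewrite ler_nat ltnS.
exists (fun j => x (s j).+1), (fun j => w (s j)); split.
- apply/cvg_enormP => e e0; have [M HM] := eventually_small e e0.
  by exists M => k /HM; apply: lt_trans; have [] := Hs k.
- apply: cvg_fine_eps => // e e0; have [del del0 Hdel] := C e e0.
  have [M HM] := eventually_small del del0; exists M => k /HM Mk.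
  by apply: Hdel; apply: lt_trans Mk; have [] := Hs k.
- by move=> j; have [] := Hw (s j).
apply/cvg_enormP => e e0; have [M HM] := dx_cvg (divr_gt0 e0 be0).
exists M => k Mk; rewrite subr0; have [_ Hwk] := Hw (s k).
apply: le_lt_trans Hwk _; rewrite mulrC -ltr_pdivlMr //; apply: HM.
by apply: leq_trans Mk _; have [] := Hs k.
Qed.

(** Once the iterates are near the cluster point and the value is close, the
    desingularized value bounds the remaining length, so the iterates never
    leave the neighbourhood. *)
Lemma tail_stays_near (e : R) : 0 < e -> exists M, forall j,
  \sum_(i < j) dx (M + i) <= e /\ enorm (x (M + j) - xb) < e.
Proof.
move=> e0; have [[k0 vk0]|/forallNP nv] := pselect (exists k0, v k0 = vb).
  have still k : (k0 <= k)%N -> dx k = 0.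
    move=> kk; have := decrease k; have := v_ge k.+1; have := v_mono kk.
    rewrite vk0 => H1 H2 H3; apply/eqP; rewrite -sqrf_eq0 eq_le sqr_ge0 andbT.
    by rewrite -(pmulr_rle0 _ al0); lra.
  have stay j : x (k0 + j) = x k0.
    elim: j => [|j IH]; first by rewrite addn0.
    by rewrite addnS -IH; apply/eqP; rewrite -subr_eq0;
      apply/eqP/enorm_eq0/still/leq_addr.
  have [k kk xk] := xbP e0 k0.
  exists k0 => j; rewrite stay big1 => [|i _]; last by rewrite still // leq_addr.
  by split; [exact: ltW|rewrite -(stay (k - k0)%N) subnKC].
have vpos k : 0 < v k - vb by rewrite subr_gt0 lt_neqAle v_ge eq_sym andbT; apply/eqP.
have xb0 : limiting_subdiff f xb !=set0 by exists 0; exact: cluster_critical.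
have [eta [Nb [psi [eta0 /nbhs_enormP[ep ep0 HNb] [[psi0 psi_ge0] psic conc dpsi]
  KLi]]]] := KL xb0.
have [r r0 Hr] := ereal_gap eta0.
set I := [set t : R | (0 <= t)%R /\ (t%:E < eta)%E] in psi_ge0 psic conc.
have [xbf C] := f_cont xbP.
pose q := be / al; have q0 : 0 < q by rewrite divr_gt0.
pose e' := Num.min e ep / 4.
have e'0 : 0 < e' by rewrite divr_gt0 // lt_min e0 ep0.
have [e'e e'ep] : 4 * e' <= e /\ 4 * e' <= ep.
  have -> : 4 * e' = Num.min e ep by rewrite /e'; field.
  by rewrite !ge_min !lexx orbT.
have [del del0 Hdel] : exists2 del : R, 0 < del & forall t, I t -> `|t| < del ->
  q * psi t < e'.
  have I0 : I 0 by split.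
  have /subspace_continuousP/(_ 0 I0)/cvgrPdist_lt := psic.
  move=> /(_ (e' / q) (divr_gt0 e'0 q0)).
  rewrite /within /= => /nbhs_ballP[del del0 Hdel]; exists del => // t It td.
  have Ht : `|psi 0 - psi t| < e' / q.
    by apply: Hdel => //; rewrite -ball_normE /= sub0r normrN.
  move: Ht; rewrite psi0 sub0r normrN => Ht; rewrite mulrC -ltr_pdivlMr //.
  exact: le_lt_trans (ler_norm _) Ht.
have rd0 : 0 < Num.min r del by rewrite lt_min r0 del0.
have [M1 HM1] := v_cvg rd0; have [M2 HM2] := dx_cvg e'0.
pose D k := v k - vb; pose W k := q * psi (D k).
have ID k : (M1 <= k)%N -> I (D k).
  move=> /HM1; rewrite -ltrBlDl lt_min => /andP[kr _]; split;
    first exact: (ltW (vpos k)).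
  exact: Hr.
have W0 k : (M1 <= k)%N -> 0 <= W k.
  by move=> Mk; apply: mulr_ge0 (ltW q0) (psi_ge0 _ (ID k Mk)).
(* the tangent inequality of [psi], the subgradient bound and the decrease
   combined; the square root is taken by the arithmetic-geometric mean *)
have key k : (M1 <= k)%N -> enorm (x k.+1 - xb) < ep ->
    2 * dx k.+1 <= dx k + (W k.+1 - W k.+2).
  move=> Mk xk; have M1k := leqW Mk; have M2k := leqW M1k.
  have [w Hw wdx] := subgradient k.
  have fu : f (x k.+1) = (v k.+1)%:E by rewrite fineK.
  have fb : f xb = vb%:E by rewrite fineK.
  have := KLi (x k.+1) (HNb _ xk).
  have dist_le : (dist0 (limiting_subdiff f (x k.+1)) <= (be * dx k)%:E)%E.
    apply: (@le_trans _ _ (enorm w)%:E); last by rewrite lee_fin.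
    by apply: ereal_inf_lbound; exists w => //; exact: regular_limiting.
  have [_ Deta] := ID _ M1k.
  have Dp : 0 < D k.+1 by exact: vpos.
  have [dpsi1 _ dpsi_gt0] := dpsi (D k.+1) Dp Deta.
  move: dist_le; set dd := dist0 _ => dist_le; rewrite {}fu {}fb => KLk.
  have slope : 1 <= derive1 psi (D k.+1) * (be * dx k).
    rewrite -lee_fin EFinM; apply: le_trans (lee_wpmul2l _ dist_le); last first.
      by rewrite lee_fin ltW.
    apply: KLk; first by rewrite lte_fin -subr_gt0.
    by rewrite -lteBlDl.
  have tang : derive1 psi (D k.+1) * (D k.+1 - D k.+2) <= psi (D k.+1) - psi (D k.+2).
    have [->|DD] := eqVneq (D k.+2) (D k.+1); first by rewrite !subrr mulr0.
    apply: concave_tangent conc (ID _ M2k) (ID _ M1k) _ dpsi1.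
    by rewrite lt_neqAle DD lerD2r v_mono.
  have dx0 : 0 <= dx k by exact: enorm_ge0.
  have dx1 : 0 <= dx k.+1 by exact: enorm_ge0.
  have sq : dx k.+1 ^+ 2 <= dx k * (W k.+1 - W k.+2).
    have A1 : al * dx k.+1 ^+ 2 <= D k.+1 - D k.+2.
      by have := decrease k.+1; rewrite /D; lra.
    have A2 : derive1 psi (D k.+1) * (al * dx k.+1 ^+ 2) <=
      psi (D k.+1) - psi (D k.+2).
      by apply: le_trans tang; rewrite ler_pM2l.
    have A3 : 0 <= al * dx k.+1 ^+ 2 by rewrite mulr_ge0 ?sqr_ge0 // ltW.
    have A4 := ler_wpM2r A3 slope; rewrite mul1r in A4.
    have A5 := ler_wpM2l (mulr_ge0 (ltW be0) dx0) A2.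
    rewrite -(ler_pM2l al0).
    have -> : al * (dx k * (W k.+1 - W k.+2)) =
      be * dx k * (psi (D k.+1) - psi (D k.+2)).
      by rewrite /W /q; field; rewrite gt_eqF.
    by lra.
  have W12 : 0 <= W k.+1 - W k.+2.
    rewrite /W -mulrBr mulr_ge0 ?(ltW q0) //; apply: le_trans tang.
    by rewrite mulr_ge0 ?(ltW dpsi_gt0) // subr_ge0 lerD2r v_mono.
  rewrite -(@ler_pXn2r _ 2) ?nnegrE ?(addr_ge0 dx0 W12) ?mulr_ge0 //.
  have := sqr_ge0 (dx k - (W k.+1 - W k.+2)).
  move: (dx k) (dx k.+1) (W k.+1 - W k.+2) sq => X Y Z.
  by lra.
have [[//|k]] := xbP e'0 (maxn M1 M2).+1; rewrite ltnS geq_max => /andP[k1 k2] xk.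
have Wk : W k.+1 < e'.
  apply: Hdel; first exact/ID/leqW.
  have := HM1 _ (leqW k1); rewrite -ltrBlDl lt_min => /andP[_].
  by rewrite ger0_norm // (ltW (vpos _)).
have dk := HM2 k k2.
(* the induction that keeps the iterates within [ep] of the cluster point *)
have claim j : \sum_(i < j) dx (k.+1 + i) + dx (k + j) <= dx k +
  (W k.+1 - W (k.+1 + j)%N).
  elim: j => [|j IH]; first by rewrite big_ord0 !addn0 subrr add0r addr0.
  have near_xb : enorm (x (k + j).+1 - xb) < ep.
    have tele : enorm (x (k.+1 + j)%N - x k.+1) <= \sum_(i < j) dx (k.+1 + i).
      elim: (j) => [|i IHi]; first by rewrite addn0 subrr enorm0 big_ord0.
      rewrite big_ord_recr /= addnS;
        apply: le_trans (enorm_tri (x (k.+1 + i)%N) _ _) _.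
      by lra.
    rewrite -addSn; apply: le_lt_trans (enorm_tri (x k.+1) _ _) _.
    have := W0 (k.+1 + j)%N (leq_trans (leqW k1) (leq_addr _ _)).
    by have := enorm_ge0 (x (k + j).+1 - x (k + j)); lra.
  have := key _ (leq_trans k1 (leq_addr _ _)) near_xb.
  by rewrite big_ord_recr /= !addnS !addSn; lra.
exists k.+1 => j.
have Sj : \sum_(i < j) dx (k.+1 + i) <= 2 * e'.
  have := claim j; have := W0 (k.+1 + j)%N (leq_trans (leqW k1) (leq_addr _ _)).
  by have := enorm_ge0 (x (k + j).+1 - x (k + j)); lra.
have tele : enorm (x (k.+1 + j)%N - x k.+1) <= \sum_(i < j) dx (k.+1 + i).
  elim: (j) => [|i IHi]; first by rewrite addn0 subrr enorm0 big_ord0.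
  rewrite big_ord_recr /= addnS; apply: le_trans (enorm_tri (x (k.+1 + i)%N) _ _) _.
  by lra.
split; first by lra.
by apply: le_lt_trans (enorm_tri (x k.+1) _ _) _; lra.
Qed.

End AtClusterPoint.

Theorem KL_convergence :
  (exists S, forall j, \sum_(i < j) dx i <= S) /\
  (exists xb, x @ \oo --> xb /\ critical_point f xb).
Proof.
have [xb xbP] := bounded_cluster xMb.
split.
  have [M HM] := tail_stays_near xbP ltr01.
  have sum_mono i j : (i <= j)%N -> \sum_(l < i) dx l <= \sum_(l < j) dx l.
    move=> ij; rewrite -(subnKC ij) big_split_ord /= lerDl sumr_ge0 // => l _.
    exact: enorm_ge0.
  exists (\sum_(i < M) dx i + 1) => j.
  apply: le_trans (sum_mono j (M + j)%N (leq_addl _ _)) _.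
  by rewrite big_split_ord lerD2l; have [] := HM j.
exists xb; split; last exact: cluster_critical.
apply/cvg_enormP => e e0; have [M HM] := tail_stays_near xbP e0.
by exists M => k Mk; have [_] := HM (k - M)%N; rewrite subnKC.
Qed.

End KLConvergence.

(** * Regular subgradients of the objective *)

Section Objective.
Context {R : realType} {m nd ng : nat}.
Let n := (nd + ng)%N.
Variables (N : network R m nd ng) (K : nat) (rho : R).
Implicit Types (g : 'cV[R]_m) (z th : 'cV[R]_n) (x y : 'cV[R]_(m + (n + n))).

Definition feasible x : Prop :=
  on_triple (fun g z th => [/\ line_choices K g, shed_set N z & angle_box N th]) x.

Lemma Phi_feasible x : feasible x -> Phi N K rho x = (Hjoint N rho x)%:E.
Proof.
rewrite /feasible /Phi /Hjoint /on_triple => -[xg xz xt].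
by rewrite /phi1 /phi2 /phi3 !indicator0_in // !add0e.
Qed.

Lemma indicator0_ge0 d (A : set 'cV[R]_d) u : (0 <= indicator0 A u)%E.
Proof. by rewrite /indicator0; case: ifP. Qed.

Lemma Phi_infeasible x : ~ feasible x -> Phi N K rho x = +oo%E.
Proof.
rewrite /feasible /Phi /on_triple => nf.
have [xg|xg] := pselect (line_choices K (usubmx x)); last first.
  rewrite /phi1 (indicator0_notin xg) !addye //.
  - by rewrite -ltNye (lt_le_trans _ (indicator0_ge0 _ _)).
  - by rewrite -ltNye (lt_le_trans _ (indicator0_ge0 _ _)).
rewrite /phi1 (indicator0_in xg) add0e.
have [xz|xz] := pselect (shed_set N (usubmx (dsubmx x))); last first.
  rewrite /phi2 (indicator0_notin xz) !addye //.
  by rewrite -ltNye (lt_le_trans _ (indicator0_ge0 _ _)).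
rewrite /phi2 (indicator0_in xz) add0e.
have [xt|xt] := pselect (angle_box N (dsubmx (dsubmx x))); first by exfalso;
  apply: nf.
by rewrite /phi3 (indicator0_notin xt) addye.
Qed.

Lemma Phi_fin_feasible x : (Phi N K rho x < +oo)%E -> feasible x.
Proof. by move=> fx; apply: contrapT => /Phi_infeasible E; rewrite E ltxx in fx. Qed.

Lemma grad_Hjoint : grad (Hjoint N rho) = dH N rho.
Proof. by apply/funext => x; apply: expands_grad; exact: Hjoint_expands. Qed.

Lemma Hjoint_continuous x (e : R) : 0 < e -> exists2 del : R, 0 < del &
  forall y, enorm (y - x) < del -> `|Hjoint N rho y - Hjoint N rho x| < e.
Proof.
move=> e0; have [C HC] := @Hjoint_expands R m nd ng N rho x.
pose D := enorm (dH N rho x) + `|C| + 1.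
have D0 : 0 < D by rewrite ltr_wpDl // addr_ge0 ?enorm_ge0.
exists (Num.min 1 (e / D)); first by rewrite lt_min ltr01 divr_gt0.
move=> y; rewrite lt_min => /andP[y1 yD].
have := HC (y - x) (ltW y1); rewrite (addrC x) subrK.
have h0 := enorm_ge0 (y - x).
have hh : enorm (y - x) ^+ 2 <= enorm (y - x) by rewrite expr2 ler_piMl // ltW.
have := CauchySchwarz (dH N rho x) (y - x).
have CC : C * enorm (y - x) ^+ 2 <= `|C| * enorm (y - x).
  exact: le_trans (ler_wpM2r (sqr_ge0 _) (ler_norm C)) (ler_wpM2l (normr_ge0 C) hh).
move: yD; rewrite ltr_pdivlMr // /D.
move: (dot _ _) => u yD; rewrite ler_norml => /andP[u1 u2];
  rewrite ler_norml => /andP[v1 v2].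
rewrite ltr_norml; apply/andP; split; nra.
Qed.

(** A regular subgradient allows an error [e * |y - x|], which near [x] absorbs
    the quadratic remainders of the expansion and of the hypothesis. *)
Lemma prox_regular_subgradient x w A : feasible x ->
  (forall y, feasible y -> dot (w - dH N rho x) (y - x) <= A * enorm (y - x) ^+ 2) ->
  regular_subdiff (Phi N K rho) x w.
Proof.
move=> fx HA; rewrite /regular_subdiff /= (Phi_feasible fx); split => // e e0.
have [C HC] := @Hjoint_expands R m nd ng N rho x.
pose D := `|A| + `|C| + 1; have D0 : 0 < D by rewrite ltr_wpDl // addr_ge0.
apply/nbhs_enormP; exists (Num.min 1 (e / D)); first by rewrite lt_min ltr01 divr_gt0.
move=> y; rewrite lt_min => /andP[y1 yD] /=.
have [fy|/Phi_infeasible ->] := pselect (feasible y); last by rewrite leey.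
rewrite (Phi_feasible fy) -EFinD lee_fin.
have := HC (y - x) (ltW y1); rewrite (addrC x) subrK ler_norml => /andP[H1 _].
have := HA y fy; rewrite dotBl => H2.
have h0 := enorm_ge0 (y - x).
have h2 : (`|A| + `|C|) * enorm (y - x) ^+ 2 <= e * enorm (y - x).
  rewrite expr2 mulrA ler_wpM2r //; move: yD; rewrite ltr_pdivlMr // /D.
  by have := normr_ge0 A; have := normr_ge0 C; lra.
have A1 : A * enorm (y - x) ^+ 2 <= `|A| * enorm (y - x) ^+ 2.
  by rewrite ler_wpM2r ?sqr_ge0 // ler_norm.
have C1 : C * enorm (y - x) ^+ 2 <= `|C| * enorm (y - x) ^+ 2.
  by rewrite ler_wpM2r ?sqr_ge0 // ler_norm.
lra.
Qed.

Lemma enorm_triple_le g z th : enorm (triple g z th : 'cV[R]_(m + (n + n))) <=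
  enorm g + enorm z + enorm th.
Proof.
rewrite -(@ler_pXn2r _ 2) ?nnegrE ?addr_ge0 ?enorm_ge0 // enorm_triple_sqr.
have := enorm_ge0 g; have := enorm_ge0 z; have := enorm_ge0 th; nra.
Qed.

Lemma triple_ge_g g z th : enorm g <= enorm (triple g z th : 'cV[R]_(m + (n + n))).
Proof.
rewrite -(@ler_pXn2r _ 2) ?nnegrE ?enorm_ge0 // enorm_triple_sqr.
by have := sqr_ge0 (enorm z); have := sqr_ge0 (enorm th); lra.
Qed.

Lemma triple_ge_z g z th : enorm z <= enorm (triple g z th : 'cV[R]_(m + (n + n))).
Proof.
rewrite -(@ler_pXn2r _ 2) ?nnegrE ?enorm_ge0 // enorm_triple_sqr.
by have := sqr_ge0 (enorm g); have := sqr_ge0 (enorm th); lra.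
Qed.

Lemma triple_ge_th g z th : enorm th <= enorm (triple g z th : 'cV[R]_(m + (n + n))).
Proof.
rewrite -(@ler_pXn2r _ 2) ?nnegrE ?enorm_ge0 // enorm_triple_sqr.
by have := sqr_ge0 (enorm z); have := sqr_ge0 (enorm g); lra.
Qed.

End Objective.

(** * Convergence of the iterates *)

Lemma prox_block_subgradient (R : realType) d (A : set 'cV[R]_d) (c : R)
    (x0 x w : 'cV[R]_d) :
  (forall y, A y ->
    dot w (x - y) + c / 2 * (enorm (x - x0) ^+ 2 - enorm (y - x0) ^+ 2) <= 0) ->
  forall y, A y ->
    dot (- w - c *: (x - x0)) (y - x) <= c / 2 * enorm (y - x) ^+ 2.
Proof.
move=> H y Ay; have := H y Ay.
rewrite (_ : y - x0 = (x - x0) + (y - x)); last by rewrite [RHS]addrC subrKA.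
rewrite (enormD_sqr (x - x0)) (dotBl (- w)) dotNl dotZl -(opprB y x) dotNr; lra.
Qed.

Section Assembly.
Context {R : realType} {m nd ng : nat}.
Let n := (nd + ng)%N.
Variables (N : network R m nd ng) (K : nat) (rho r1 r2 r3 s1 s3 Mb : R).
Variables (g : nat -> 'cV[R]_m) (z th : nat -> 'cV[R]_n).
Hypothesis rho0 : 0 < rho.
Hypothesis r11 : 1 < r1.
Hypothesis r21 : 1 < r2.
Hypothesis r31 : 1 < r3.
Hypothesis choices : line_choices (R := R) (m := m) K !=set0.
Hypothesis lip1 : lines_lipschitz N rho.
Hypothesis lip2 : forall g0 th0,
  lipschitz_with rho (fun z' => dH_z N rho g0 z' th0) setT.
Hypothesis lip3 : angles_lipschitz N rho.
Hypothesis L1_le : forall k, L1 N rho (z k) (th k) <= s1.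
Hypothesis L3_le : forall k, L3 N rho (g k) (z k) <= s3.
Hypothesis lipH : forall B : set 'cV[R]_(m + (n + n)), bounded_set B ->
  exists M : R, lipschitz_with M (dH N rho) B.
Hypothesis palm : PALM N K rho r1 r2 r3 g z th.
Let x k := triple (g k) (z k) (th k).
Hypothesis xMb : forall k, enorm (x k) <= Mb.

Lemma iterate_feasible k : feasible N K (x k.+1).
Proof.
rewrite /feasible /x on_tripleE; split.
- by have [] := g_step choices palm k.
- by have [] := z_step palm k.
- by have [] := th_step palm k.
Qed.

(** After finitely many steps the lines stay, and before that there are finitely
    many step sizes, all positive. *)
Lemma lines_decrease_uniform : exists2 c, 0 < c & forall k,
  c * enorm (g k.+1 - g k) ^+ 2 <=
  (r1 - 1) / 2 * L1 N rho (z k) (th k) * enorm (g k.+1 - g k) ^+ 2.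
Proof.
have thMb k : enorm (th k) <= Mb by apply: le_trans (xMb k); exact: triple_ge_th.
have [M HM] := lines_eventually_constant rho0 r11 r21 r31 choices lip1 lip2 lip3
  L3_le thMb palm.
have al0 k : 0 < (r1 - 1) / 2 * L1 N rho (z k) (th k).
  by rewrite mulr_gt0 ?(L1_gt0 r11 palm) // divr_gt0 ?subr_gt0.
have [|c c0 Hc] := @finite_gap R _
  (fun k : 'I_M => (r1 - 1) / 2 * L1 N rho (z k) (th k)).
  by move=> k; exact: ltW.
exists c => // k; have [Mk|kM] := leqP M k.
  by rewrite HM // subrr enorm0 expr0n /= !mulr0.
apply: ler_wpM2r; first exact: sqr_ge0.
by case: (Hc (Ordinal kM)) => //= E; have := al0 k; rewrite E ltxx.
Qed.

Lemma sufficient_decrease : exists2 d, 0 < d & forall k, feasible N K (x k) ->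
  d * enorm (x k.+1 - x k) ^+ 2 <= Hjoint N rho (x k) - Hjoint N rho (x k.+1).
Proof.
have [c1 c10 H1] := lines_decrease_uniform.
have [c3 c30 H3] := th_decrease_uniform rho0 r31 choices lip3 palm.
have c20 : 0 < (r2 - 1) / 2 * rho by rewrite mulr_gt0 // divr_gt0 ?subr_gt0.
pose d := Num.min c1 (Num.min ((r2 - 1) / 2 * rho) c3).
exists d; first by rewrite !lt_min c10 c20.
move=> k; rewrite /feasible /Hjoint /x !on_tripleE => -[gk zk thk].
rewrite triple_sub enorm_triple_sqr.
have D1 := g_decrease choices lip1 palm gk; have D2 := z_decrease lip2 palm zk.
have D3 := H3 k thk; have D1' := H1 k.
have dle c e : d <= c -> d * e ^+ 2 <= c * e ^+ 2 :> R.
  by move=> dc; rewrite ler_wpM2r ?sqr_ge0.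
have E1 : d * enorm (g k.+1 - g k) ^+ 2 <= c1 * enorm (g k.+1 - g k) ^+ 2.
  by apply: dle; rewrite ge_min lexx.
have E2 : d * enorm (z k.+1 - z k) ^+ 2 <=
  (r2 - 1) / 2 * rho * enorm (z k.+1 - z k) ^+ 2.
  by apply: dle; rewrite !ge_min lexx orbT.
have E3 : d * enorm (th k.+1 - th k) ^+ 2 <= c3 * enorm (th k.+1 - th k) ^+ 2.
  by apply: dle; rewrite !ge_min lexx !orbT.
lra.
Qed.

(** The optimality of the three blocks refers to gradients at mixed points, some
    of whose blocks are not updated yet.  The gradient is Lipschitz on a ball
    that contains these points, so the correction is of the order of the
    step. *)
Lemma iterate_subgradient : exists2 C, 0 < C & forall k,
  exists2 w, regular_subdiff (Phi N K rho) (x k.+1) w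
    & enorm w <= C * enorm (x k.+1 - x k).
Proof.
pose Bset : set 'cV[R]_(m + (n + n)) := [set y | enorm y <= Mb + Mb + Mb].
have [L HL] : exists M, lipschitz_with M (dH N rho) Bset.
  by apply: lipH; apply/bounded_enorm; exists (Mb + Mb + Mb).
have gMb k : enorm (g k) <= Mb by apply: le_trans (xMb k); exact: triple_ge_g.
have zMb k : enorm (z k) <= Mb by apply: le_trans (xMb k); exact: triple_ge_z.
have thMb k : enorm (th k) <= Mb by apply: le_trans (xMb k); exact: triple_ge_th.
have inB i j l : Bset (triple (g i) (z j) (th l)).
  by apply: le_trans (enorm_triple_le _ _ _) _; rewrite !lerD.
have s10 : 0 < s1 by apply: lt_le_trans (L1_le 0); exact: (L1_gt0 r11 palm).
have s30 : 0 < s3 by apply: lt_le_trans (L3_le 1); exact: (L3_gt0 r31 palm).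
have [r10 [r20 r30]] : 0 < r1 /\ 0 < r2 /\ 0 < r3 by split; [|split];
  exact: lt_trans ltr01 _.
pose C := (`|L| + r1 * s1) + (`|L| + r2 * rho) + (`|L| + r3 * s3).
exists C.
  have := normr_ge0 L; have := mulr_gt0 r10 s10; have := mulr_gt0 r20 rho0.
  by have := mulr_gt0 r30 s30; rewrite /C; lra.
move=> k; have [a0 b0 c0] := step_size_gt0 palm k.
have [gF gS] := g_step choices palm k; have [zF zS] := z_step palm k.
have [thF thS] := th_step palm k.
set a := r1 * _ in a0 gS; set b := r2 * _ in b0 zS; set c := r3 * _ in c0 thS.
have gP := prox_block_subgradient gS; have zP := prox_block_subgradient zS.
have thP := prox_block_subgradient thS.
pose wg := dH_g N rho (g k.+1) (z k.+1) (th k.+1)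
  + (- dH_g N rho (g k) (z k) (th k) - a *: (g k.+1 - g k)).
pose wz := dH_z N rho (g k.+1) (z k.+1) (th k.+1)
  + (- dH_z N rho (g k.+1) (z k) (th k) - b *: (z k.+1 - z k)).
pose wth := dH_th N rho (g k.+1) (z k.+1) (th k.+1)
  + (- dH_th N rho (g k.+1) (z k.+1) (th k) - c *: (th k.+1 - th k)).
have dx := enorm_ge0 (x k.+1 - x k).
have dxE : x k.+1 - x k = triple (g k.+1 - g k) (z k.+1 - z k) (th k.+1 - th k).
  by rewrite /x triple_sub.
exists (triple wg wz wth).
  apply: (@prox_regular_subgradient _ _ _ _ _ _ _ _ _ (a / 2 + b / 2 + c / 2))
    (iterate_feasible k) _.
  move=> y; rewrite [y]tripleK -/(triple _ _ _) /feasible on_tripleE => -[yg yz yth].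
  rewrite /x /dH on_tripleE !triple_sub dot_triple enorm_triple_sqr.
  have cancel d (u v : 'cV[R]_d) : u + v - u = v by rewrite addrAC subrr add0r.
  rewrite !cancel.
  move: (gP _ yg) (zP _ yz) (thP _ yth).
  move: (sqr_ge0 (enorm (usubmx y - g k.+1)))
    (sqr_ge0 (enorm (usubmx (dsubmx y) - z k.+1)))
    (sqr_ge0 (enorm (dsubmx (dsubmx y) - th k.+1))).
  move: (enorm _ ^+ 2) (enorm _ ^+ 2) (enorm _ ^+ 2) => X Y Z X0 Y0 Z0 I1 I2 I3.
  have := mulr_ge0 (ltW a0) Y0; have := mulr_ge0 (ltW a0) Z0.
  have := mulr_ge0 (ltW b0) X0; have := mulr_ge0 (ltW b0) Z0.
  have := mulr_ge0 (ltW c0) X0; have := mulr_ge0 (ltW c0) Y0.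
  by lra.
apply: le_trans (enorm_triple_le _ _ _) _.
have Lip i j l : enorm (x k.+1 - triple (g i) (z j) (th l)) <= enorm (x k.+1 - x k) ->
    enorm (dH N rho (x k.+1) - dH N rho (triple (g i) (z j) (th l))) <=
      `|L| * enorm (x k.+1 - x k).
  move=> H; apply: le_trans (HL _ _ (inB _ _ _) (inB i j l)) _.
  apply: le_trans (ler_wpM2r (enorm_ge0 _) (ler_norm L)) _.
  by apply: ler_wpM2l.
have part d (u v w : 'cV[R]_d) (t s : R) : 0 < t -> t <= s ->
    enorm (u - v) <= `|L| * enorm (x k.+1 - x k) -> enorm w <= enorm (x k.+1 - x k) ->
    enorm (u + (- v - t *: w)) <= (`|L| + s) * enorm (x k.+1 - x k).
  move=> t0 ts uv wx; rewrite addrA; apply: le_trans (enormB _ _) _.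
  rewrite mulrDl enormZ (gtr0_norm t0); apply: lerD => //.
  by apply: ler_pM; rewrite ?enorm_ge0 ?(ltW t0).
rewrite /C !mulrDl -![`|L| * _ + _]mulrDl; apply: lerD; first apply: lerD.
- apply: part => //; first by rewrite ler_pM2l.
    have := Lip k k k (lexx _); rewrite /dH !on_tripleE triple_sub; apply: le_trans.
    exact: triple_ge_g.
  by rewrite dxE triple_ge_g.
- apply: part => //.
    have := Lip k.+1 k k; rewrite /dH !on_tripleE triple_sub => H.
    apply: le_trans (H _); first exact: triple_ge_z.
    rewrite dxE /x triple_sub subrr.
    rewrite -(@ler_pXn2r _ 2) ?nnegrE ?enorm_ge0 // !enorm_triple_sqr enorm0
      expr0n /= add0r.
    by rewrite -addrA lerDr sqr_ge0.
  by rewrite dxE triple_ge_z.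
apply: part => //; first by rewrite ler_pM2l.
  have := Lip k.+1 k.+1 k; rewrite /dH !on_tripleE triple_sub => H.
  apply: le_trans (H _); first exact: triple_ge_th.
  rewrite dxE /x triple_sub !subrr.
  rewrite -(@ler_pXn2r _ 2) ?nnegrE ?enorm_ge0 // !enorm_triple_sqr !enorm0
    expr0n /= !add0r.
  by rewrite lerDr addr_ge0 ?sqr_ge0.
by rewrite dxE triple_ge_th.
Qed.

End Assembly.

Lemma nneseries_bounded (R : realType) (u : nat -> R) (S : R) :
  (forall k, 0 <= u k) ->
  (forall j, \sum_(i < j) u i.+1 <= S) -> (\sum_(1 <= k <oo) (u k)%:E < +oo)%E.
Proof.
move=> u0 uS; apply: (@le_lt_trans _ _ S%:E); last exact: ltry.
apply: lime_le; first by apply: is_cvg_nneseries => k _ _; rewrite lee_fin.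
exists 0%N => // j _ /=; rewrite sumEFin lee_fin; case: j => [|j].
  by rewrite big_geq //; have := uS 0%N; rewrite big_ord0.
by rewrite big_add1 /= big_mkord.
Qed.

Theorem proposition1 (R : realType) (m nd ng : nat) (N : network R m nd ng)
    (K : nat) (rho r1 r2 r3 : R)
    (g : nat -> 'cV[R]_m) (z th : nat -> 'cV[R]_(nd + ng)) :
  0 < rho -> 1 < r1 -> 1 < r2 -> 1 < r3 ->
  KL_function (Phi N K rho) ->
  (* (i) *)
  (-oo < ereal_inf (range (Phi N K rho)))%E ->
  (-oo < ereal_inf (range (@phi1 R m K)))%E ->
  (-oo < ereal_inf (range (phi2 N)))%E ->
  (-oo < ereal_inf (range (phi3 N)))%E ->
  (* (ii) *)
  (forall z0 th0,
     lipschitz_with (L1 N rho z0 th0) (fun g' => grad_g N rho g' z0 th0) setT) ->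
  (forall g0 th0,
     lipschitz_with (L2 rho g0 th0) (fun z' => grad_z N rho g0 z' th0) setT) ->
  (forall g0 z0,
     lipschitz_with (L3 N rho g0 z0) (fun th' => grad_th N rho g0 z0 th') setT) ->
  (* (iii) *)
  (exists s1 s2 s3 : R,
     [/\ 0 < s1, 0 < s2 & 0 < s3] /\
     [/\ ereal_sup (range (fun k => (L1 N rho (z k) (th k))%:E)) <= s1%:E,
         ereal_sup (range (fun k => (@L2 R m nd ng rho (g k) (th k))%:E)) <= s2%:E
       & ereal_sup (range (fun k => (L3 N rho (g k) (z k))%:E)) <= s3%:E]%E) ->
  (* (iv) *)
  (forall B : set 'cV[R]_(m + ((nd + ng) + (nd + ng))), bounded_set B ->
     exists M : R, lipschitz_with M (grad (Hjoint N rho)) B) ->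
  PALM N K rho r1 r2 r3 g z th ->
  let x := fun k => triple (g k) (z k) (th k) in
  bounded_set (range x) ->
  [/\ (\sum_(1 <= k <oo) (enorm (x k.+1 - x k))%:E < +oo)%E,
      (exists (gs : 'cV[R]_m) (zs ths : 'cV[R]_(nd + ng)),
         x @ \oo --> triple gs zs ths /\
         critical_point (Phi N K rho) (triple gs zs ths))
    & nonincreasing_seq (Phi N K rho \o x) /\
      (exists d : R, 0 < d /\ forall k : nat,
         ((d / 2 * enorm (x k.+1 - x k) ^+ 2)%:E
            <= Phi N K rho (x k) - Phi N K rho (x k.+1))%E)].
Proof.
move=> rho0 r11 r21 r31 [[_ [y0 y0fin]] lsc KL] _ _ _ _ Hlip1 Hlip2 Hlip3.
move=> [s1 [s2 [s3 [[_ _ _] [L1s _ L3s]]]]] Hlip palm x xbnd.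
have [Mb xMb'] := (bounded_enorm _).1 xbnd.
have xMb k : enorm (x k) <= Mb by apply: xMb'; exists k.
have choices : line_choices (R := R) (m := m) K !=set0.
  by have := Phi_fin_feasible y0fin; rewrite /feasible /on_triple => -[? _ _];
    exists (usubmx y0).
have lip1 : lines_lipschitz N rho.
  move=> z0 th0 u v _ _; have := Hlip1 z0 th0 u v I I.
  by rewrite /grad_g !(expands_grad (expands_g _ _ _ _ _)).
have lip2 g0 th0 : lipschitz_with rho (fun z' => dH_z N rho g0 z' th0) setT.
  move=> u v _ _; have := Hlip2 g0 th0 u v I I.
  by rewrite /grad_z !(expands_grad (expands_z _ _ _ _ _)).
have lip3 : angles_lipschitz N rho.
  move=> g0 z0 u v _ _; have := Hlip3 g0 z0 u v I I.
  by rewrite /grad_th !(expands_grad (expands_th _ _ _ _ _)).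
have L1_le k : L1 N rho (z k) (th k) <= s1.
  rewrite -lee_fin; apply: le_trans L1s; apply: ereal_sup_ubound; by exists k.
have L3_le k : L3 N rho (g k) (z k) <= s3.
  rewrite -lee_fin; apply: le_trans L3s; apply: ereal_sup_ubound; by exists k.
have lipH B : bounded_set B -> exists M : R, lipschitz_with M (dH N rho) B.
  by move=> /Hlip; rewrite grad_Hjoint.
have feas := iterate_feasible choices palm.
have PhiE k : Phi N K rho (x k.+1) = (Hjoint N rho (x k.+1))%:E
  by apply: Phi_feasible; exact: feas.
have [d d0 dec] := sufficient_decrease rho0 r11 r21 r31 choices lip1 lip2 lip3
  L3_le palm xMb.
have [C C0 sub] := iterate_subgradient rho0 r11 r21 r31 choices L1_le L3_le lipH
  palm xMb.
have decE k : ((2 * d / 2 * enorm (x k.+1 - x k) ^+ 2)%:E <=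
  Phi N K rho (x k) - Phi N K rho (x k.+1))%E.
  have [fx|/Phi_infeasible ->] := pselect (feasible N K (x k)); last first.
    by rewrite PhiE addye // leey.
  rewrite (Phi_feasible rho fx) PhiE -EFinB lee_fin.
  by rewrite (_ : 2 * d / 2 = d); [exact: dec|field].
have mono k : (Phi N K rho (x k.+1) <= Phi N K rho (x k))%E.
  have [fx|/Phi_infeasible ->] := pselect (feasible N K (x k)); last by rewrite leey.
  rewrite (Phi_feasible rho fx) PhiE lee_fin -subr_ge0; apply: le_trans (dec k fx).
  by rewrite mulr_ge0 ?sqr_ge0 // ltW.
have noninc := (nonincreasing_seqP (Phi N K rho \o x)).1 mono.
(* a cluster point is feasible by lower semicontinuity, as the values along the
   iterates are bounded *)
have Phi_cont xb : clusters (fun k => x k.+1) xb ->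
    Phi N K rho xb \is a fin_num /\ forall e : R, 0 < e -> exists2 del : R, 0 < del &
    forall k, enorm (x k.+1 - xb) < del ->
      `|fine (Phi N K rho (x k.+1)) - fine (Phi N K rho xb)| < e.
  move=> clus; have fb : feasible N K xb.
    apply: contrapT => /Phi_infeasible Pinf.
    have := lsc xb (Hjoint N rho (x 1)); rewrite Pinf => /(_ (ltry _)).
    move=> [V /nbhs_enormP[e e0 He] HV]; have [k _ xk] := clus e e0 0%N.
    have := HV _ (He _ xk); rewrite ltNge => /negP; apply.
    rewrite -(PhiE 0%N); exact: (noninc 1%N k.+1 isT).
  rewrite (Phi_feasible rho fb); split=> // e e0.
  have [del del0 Hdel] := Hjoint_continuous N rho xb e0.
  by exists del => // k xk; rewrite PhiE; exact: Hdel.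
have [[S sumS] [xb [xcvg crit]]] :
  (exists S, forall j, \sum_(i < j) enorm (x i.+2 - x i.+1) <= S) /\
    (exists xb, (fun k => x k.+1) @ \oo --> xb /\ critical_point (Phi N K rho) xb).
  apply: (KL_convergence d0 C0 _ _ _ (fun k => xMb k.+1) Phi_cont KL) => k.
  - by rewrite PhiE.
  - by rewrite !PhiE; exact: dec.
  - exact: sub.
split.
- exact: (nneseries_bounded (fun k => enorm_ge0 _) sumS).
- exists (usubmx xb), (usubmx (dsubmx xb)), (dsubmx (dsubmx xb)).
  rewrite /triple -tripleK; split => //.
  apply/cvg_enormP => e e0; have [M HM] := (cvg_enormP _ _).1 xcvg e e0.
  by exists M.+1 => -[//|k]; exact: HM.
split; first exact: noninc.
by exists (2 * d); split; [exact: mulr_gt0|exact: decE].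
Qed.
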